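(* Let $d=d_{\mathbf{C}}$ be the level of $\mathbf{C}$. For every integer $n\ge1$, there is a natural isomorphism of functors $${}^{\mathbf{C}}\!\operatorname{Res}^{n+1}_n\,{}^{\mathbf{C}}\!\operatorname{Ind}^{n+1}_n\;\cong\;\operatorname{id}^{\oplus d\dim F_{\mathrm{even}}}\oplus\Pi^{\oplus d\dim F_{\mathrm{odd}}}\oplus{}^{\mathbf{C}}\!\operatorname{Ind}^n_{n-1}\,{}^{\mathbf{C}}\!\operatorname{Res}^n_{n-1}$$ on $\mathcal{A}_n^{\mathbf{C}}(F)$-modules, where $F_{\mathrm{even}}$ and $F_{\mathrm{odd}}$ are the even and odd parts of $F$, respectively.
   Context: $\Bbbk$ is a commutative ring of characteristic not equal to $2$; $\mathbb{N}$ is the set of nonnegative integers. ''Algebra'' means associative unital $\mathbb{Z}$-graded $\Bbbk$-superalgebra, ''module'' means $\mathbb{Z}$-graded left supermodule, and module categories consist of finitely generated modules; $|a|$ is the degree and $\bar a$ the parity. Tensor products are over $\Bbbk$ unless indicated, with $(a_1\otimes a_2)(b_1\otimes b_2)=(-1)^{\bar a_2\bar b_1}a_1b_1\otimes a_2b_2$. $\Pi$ is the parity shift functor: $(\Pi M)_{i,\varepsilon}=M_{i,\varepsilon+1}$ with action $a\cdot m=(-1)^{\bar a}am$. The symbol $\cong$ denotes isomorphisms not required to preserve the $\mathbb{Z}$-degree (shifts of the $\mathbb{Z}$-grading of the summands are suppressed). $F$ is an $\mathbb{N}$-graded Frobenius superalgebra, free of finite rank over $\Bbbk$: there is a parity-preserving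 linear trace map $\operatorname{tr}\colon F\to\Bbbk$, homogeneous in degree, such that $f\mapsto(g\mapsto(-1)^{\bar f\bar g}\operatorname{tr}(gf))$ is an isomorphism $F\to\operatorname{Hom}_\Bbbk(F,\Bbbk)$. The Nakayama automorphism $\psi$ is defined by $\operatorname{tr}(fg)=(-1)^{\bar f\bar g}\operatorname{tr}(g\psi(f))$. $\delta$ is the maximum degree of elements of $F$. It is assumed that $\psi$ has finite order $\theta$, that the characteristic of $\Bbbk$ does not divide $\theta$, and that $F$ has a basis of eigenvectors of $\psi$. $B$ is a homogeneous basis of $F$ and $\{b^\vee\}$ its left dual basis: $\operatorname{tr}(b^\vee c)=\delta_{b,c}$; $\dim F_{\mathrm{even}}$, $\dim F_{\mathrm{odd}}$ are the numbers of even and odd elements of $B$. For $f\in F$: $f_i=1^{\otimes(i-1)}\otimes f\otimes1^{\otimes(n-i)}\in F^{\otimes n}$ and $\psi_i=\operatorname{id}^{\otimes(i-1)}\otimes\psi\otimes\operatorname{id}^{\otimes(n-i)}$. $S_n$ acts on $F^{\otimes n}$ by superpermuting factors, written ${}^\pi\mathbf{f}$: ${}^{s_i}(f_1\otimes\cdots\otimes f_n)=(-1)^{\bar f_i\bar f_{i+1}}f_1\otimes\cdots\otimes f_{i+1}\otimes f_i\otimes\cdots\otimes f_n$, with $s_i$ the transposition of $i,i+1$. The affine wreath product algebra $\mathcal{A}_n(F)$ is the free product $\Bbbk[x_1,\dots,x_n]\star F^{\otimes n}\star\Bbbk S_n$ modulo the relations: $\mathbf{f}x_i=x_i\psi_i(\mathbf{f})$;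 $s_ix_j=x_js_i$ ($j\ne i,i+1$); $s_ix_i=x_{i+1}s_i-t_{i,i+1}$; $\pi\mathbf{f}={}^\pi\mathbf{f}\,\pi$ ($\pi\in S_n$), where $t_{i,j}=\sum_{b\in B}b_i(b^\vee)_j$ for $i\neq j$. Gradings: $|x_i|=\delta$, $\bar x_i=0$; $f_i$ has the degree and parity of $f$; $\pi\in S_n$ has degree and parity $0$. For $k\in\mathbb{Z}$: $F_\psi=\{f\in F\mid\psi(f)=f\}$, $F^{(k)}=\{f\in F\mid gf=(-1)^{\bar f\bar g}f\psi^k(g)\ \forall g\in F\}$, $F_\psi^{(k)}=F^{(k)}\cap F_\psi$. For $1\le k\le\theta$ choose $e_k\in\mathbb{N}$ and even elements $\mathbf{c}^{(k,1)},\dots,\mathbf{c}^{(k,e_k)}\in F_\psi^{(k)}$ of degree $k\delta$, where $F$ is identified with the first tensor factor $F\otimes\Bbbk^{\otimes(n-1)}\subseteq F^{\otimes n}$ for each $n\ge1$; $\mathbf{C}$ is the tuple of all these elements. Let $\chi_{\mathbf{C}}=\prod_{k=1}^\theta\prod_{j=1}^{e_k}(x_1^k-\mathbf{c}^{(k,j)})$. For $n\ge1$, $\mathcal{A}_n^{\mathbf{C}}(F)$ is the quotient of $\mathcal{A}_n(F)$ by the two-sided ideal generated by $\chi_{\mathbf{C}}$; $\mathcal{A}_0^{\mathbf{C}}(F)=\Bbbk$. The level is $d_{\mathbf{C}}=\sum_{k=1}^\theta ke_k$, assumed to be at least $1$. The subalgebra of $\mathcal{A}_{n+1}^{\mathbf{C}}(F)$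 generated by $x_1,\dots,x_n$, $F^{\otimes n}\otimes1$ and $S_n$ is isomorphic to $\mathcal{A}_n^{\mathbf{C}}(F)$; via this inclusion, ${}^{\mathbf{C}}\!\operatorname{Ind}_n^{n+1}=\mathcal{A}_{n+1}^{\mathbf{C}}(F)\otimes_{\mathcal{A}_n^{\mathbf{C}}(F)}-$ and ${}^{\mathbf{C}}\!\operatorname{Res}^{n+1}_n$ is restriction. *)

(* Defs.v *)
From HB Require Import structures.
From mathcomp Require Import all_boot all_order all_fingroup all_algebra generic_quotient.
From mathcomp Require Import boolp classical_sets cardinality fsbigop.

Set Implicit Arguments.
Unset Strict Implicit.
Unset Printing Implicit Defensive.

Import Order.TTheory GRing.Theory Num.Theory.
Local Open Scope ring_scope.

Section FSum.
Variables (T : choiceType) (V : zmodType).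
Implicit Types (F : T -> V) (s : seq T).

Lemma fsumE s F : (forall i, i \notin s -> F i = 0) ->
  \sum_(i \in [set: T]) F i = \sum_(i <- undup s) F i.
Proof.
move=> F0; rewrite (@fsbigE _ _ _ _ _ (undup s)) ?undup_uniq//; last first.
  by move=> i _; rewrite mem_undup; exact: F0.
by apply: eq_bigl => i; rewrite in_setT.
Qed.

Lemma fsumD s1 s2 F1 F2 : (forall i, i \notin s1 -> F1 i = 0) ->
  (forall i, i \notin s2 -> F2 i = 0) ->
  \sum_(i \in [set: T]) (F1 i + F2 i) =
  \sum_(i \in [set: T]) F1 i + \sum_(i \in [set: T]) F2 i.
Proof.
move=> F10 F20.
rewrite !(@fsumE (s1 ++ s2)) ?big_split// => i; rewrite mem_cat negb_or;
  by move=> /andP[? ?]; rewrite ?F10 ?F20 ?addr0.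
Qed.

Lemma fsum1 i0 F : (forall i, i != i0 -> F i = 0) ->
  \sum_(i \in [set: T]) F i = F i0.
Proof.
move=> F0; rewrite (@fsumE [:: i0]) ?big_seq1// => i.
by rewrite inE; exact: F0.
Qed.

End FSum.

Lemma fsum_morph (T : choiceType) (V W : zmodType) (s : seq T) (F : T -> V)
    (h : V -> W) :
  h 0 = 0 -> {morph h : x y / x + y} -> (forall i, i \notin s -> F i = 0) ->
  h (\sum_(i \in [set: T]) F i) = \sum_(i \in [set: T]) h (F i).
Proof.
move=> h0 hD F0; rewrite (fsumE F0) (@fsumE _ _ s); last first.
  by move=> i /F0 ->.
exact: big_morph.
Qed.

(* Z x Z/2-gradings: the pair (i, e) stands for degree i and parity e, [bool] *)
(* being the two-element group.  A direct sum decomposition of [V] is encoded *)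
(* by the projections [V -> V_(i, e)].                                        *)

Notation Gam := (int * bool)%type.

Record grading (V : zmodType) := Grading {
  gproj :> Gam -> V -> V;
  gprojB : forall g, {morph gproj g : x y / x - y};
  gproj_orth : forall g h v, gproj g (gproj h v) = if g == h then gproj h v else 0;
  gproj_fin : forall v, exists2 s : seq Gam, uniq s & v = \sum_(g <- s) gproj g v }.

Definition ghom (V : zmodType) (G : grading V) (g : Gam) (v : V) := G g v = v.

Definition ppart (V : zmodType) (G : grading V) (p : bool) (v : V) : V :=
  \sum_(d \in [set: int]) G (d, p) v.

(* v |-> (-1)^p v on vectors of parity p *)
Definition psgn (V : zmodType) (G : grading V) (v : V) : V :=
  ppart G false v - ppart G true v.

(* [sbil G h a b] is the biadditive extension of the expression             *)
(* [(-1)^(p q) h a b] for [a] of parity [p] and [b] of parity [q].            *)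
Definition sbil (V W : zmodType) (G : grading V) (h : V -> V -> W) (a b : V) :=
  \sum_(p : bool) \sum_(q : bool)
     h (ppart G p a) (ppart G q b) *~ (-1) ^+ (p && q).

Section GradingTheory.
Variables (V : zmodType) (G : grading V).
Implicit Types (g h : Gam) (v w : V).

Lemma gproj0 g : G g 0 = 0.
Proof. by rewrite -(subrr 0) gprojB !subrr. Qed.

Lemma gprojN g v : G g (- v) = - G g v.
Proof. by rewrite -sub0r gprojB gproj0 sub0r. Qed.

Lemma gprojD g v w : G g (v + w) = G g v + G g w.
Proof. by rewrite -{1}(opprK w) gprojB gprojN opprK. Qed.

Lemma gproj_sum g I (r : seq I) P (F : I -> V) :
  G g (\sum_(i <- r | P i) F i) = \sum_(i <- r | P i) G g (F i).
Proof. by apply: big_morph; [exact: gprojD | exact: gproj0]. Qed.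

Lemma ghom_gproj g v : ghom G g (G g v).
Proof. by rewrite /ghom gproj_orth eqxx. Qed.

Lemma ghomE g h v : ghom G h v -> G g v = if g == h then v else 0.
Proof. by move=> <-; exact: gproj_orth. Qed.

Lemma ghom0 g : ghom G g 0.
Proof. exact: gproj0. Qed.

Lemma ghomN g v : ghom G g v -> ghom G g (- v).
Proof. by rewrite /ghom gprojN => ->. Qed.

Lemma ghomD g v w : ghom G g v -> ghom G g w -> ghom G g (v + w).
Proof. by rewrite /ghom gprojD => -> ->. Qed.

Lemma ghom_sum g I (r : seq I) (P : pred I) (F : I -> V) :
  (forall i, P i -> ghom G g (F i)) -> ghom G g (\sum_(i <- r | P i) F i).
Proof. by move=> FP; rewrite /ghom gproj_sum; apply: eq_bigr. Qed.

Lemma gproj_supp v : exists s : seq Gam, forall g, g \notin s -> G g v = 0.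
Proof.
have [s us vE] := gproj_fin G v; exists s => g gs.
rewrite vE gproj_sum big1_seq// => h /= hs; rewrite gproj_orth; case: eqP => //.
by move=> gh; rewrite -gh (negPf gs) in hs.
Qed.

Lemma gproj_fsum v : v = \sum_(g \in [set: Gam]) G g v.
Proof.
have [s us vE] := gproj_fin G v; rewrite {1}vE (@fsumE _ _ s) ?undup_id// => g gs.
rewrite vE gproj_sum big1_seq// => h /= hs; rewrite gproj_orth; case: eqP => //.
by move=> gh; rewrite -gh (negPf gs) in hs.
Qed.

Lemma ghom_ind (P : V -> Prop) : P 0 -> (forall v w, P v -> P w -> P (v + w)) ->
  (forall g v, ghom G g v -> P v) -> forall v, P v.
Proof.
move=> P0 PD Ph v; have [s _ ->] := gproj_fin G v.
by elim/big_ind: _ => // g _; apply: (Ph g); exact: ghom_gproj.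
Qed.

Lemma ppart_hom p g v : ghom G g v -> ppart G p v = if g.2 == p then v else 0.
Proof.
case: g => d q vh; rewrite /ppart (@fsum1 _ _ d) => [|e ed].
  by rewrite (ghomE _ vh) xpair_eqE eqxx eq_sym.
by rewrite (ghomE _ vh) xpair_eqE (negPf ed).
Qed.

Lemma pproj_supp p v :
  exists s : seq int, forall d, d \notin s -> G (d, p) v = 0.
Proof.
have [s sP] := gproj_supp v; exists (map fst s) => d ds; apply: sP.
by apply: contra ds => ds; apply/mapP; exists (d, p).
Qed.

Lemma ppartD p v w : ppart G p (v + w) = ppart G p v + ppart G p w.
Proof.
have [s sP] := pproj_supp p v; have [t tP] := pproj_supp p w.
rewrite -(fsumD sP tP) /ppart; apply: eq_fsbigr => d _; exact: gprojD.
Qed.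

Lemma ppart0 p : ppart G p 0 = 0.
Proof. by rewrite (ppart_hom p (ghom0 0)) if_same. Qed.

Lemma psgn_hom g v : ghom G g v -> psgn G v = if g.2 then - v else v.
Proof.
by move=> vh; rewrite /psgn !(ppart_hom _ vh); case: g.2; rewrite /= ?subr0 ?sub0r.
Qed.

Lemma psgnD v w : psgn G (v + w) = psgn G v + psgn G w.
Proof. by rewrite /psgn !ppartD opprD addrACA. Qed.

Lemma psgn0 : psgn G 0 = 0. Proof. by rewrite /psgn !ppart0 subrr. Qed.

Lemma ghom_psgn g v : ghom G g v -> ghom G g (psgn G v).
Proof.
by move=> vh; rewrite (psgn_hom vh); case: g.2 => //; exact: ghomN.
Qed.

End GradingTheory.

Lemma sbil_hom (V W : zmodType) (G : grading V) (h : V -> V -> W) g1 g2 a b :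
  (forall x, h x 0 = 0) -> (forall y, h 0 y = 0) ->
  ghom G g1 a -> ghom G g2 b ->
  sbil G h a b = h a b *~ (-1) ^+ (g1.2 && g2.2).
Proof.
move=> h0r h0l ah bh; rewrite /sbil !big_bool/= !(ppart_hom _ ah).
rewrite !(ppart_hom _ bh).
by case: g1.2; case: g2.2; rewrite /= ?h0l ?h0r ?mul0rz ?addr0 ?add0r.
Qed.

(* A family of additive endomorphisms is a grading as soon as every vector is *)
(* a sum of vectors on which the family acts by Kronecker deltas.             *)
Section MkGrading.
Variables (V : zmodType) (pr : Gam -> V -> V).
Hypothesis prB : forall g, {morph pr g : x y / x - y}.
Hypothesis pr_dec : forall v, exists2 L : seq (Gam * V),
  v = \sum_(x <- L) x.2 &
  forall x, x \in L -> forall g, pr g x.2 = if g == x.1 then x.2 else 0.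

Let pr0 g : pr g 0 = 0.
Proof. by rewrite -(subrr 0) prB !subrr. Qed.

Let prD g v w : pr g (v + w) = pr g v + pr g w.
Proof. by rewrite -{1}(opprK w) -(sub0r w) !prB pr0 sub0r opprK. Qed.

Let pr_sum g I (r : seq I) P (F : I -> V) :
  pr g (\sum_(i <- r | P i) F i) = \sum_(i <- r | P i) pr g (F i).
Proof. by apply: big_morph; [exact: prD | exact: pr0]. Qed.

Lemma mk_orth g h v : pr g (pr h v) = if g == h then pr h v else 0.
Proof.
have [L -> LP] := pr_dec v; rewrite !pr_sum.
case: (eqVneq g h) => [<-|gh].
  rewrite !big_seq; apply: eq_bigr => x xL; rewrite (LP x xL g).
  by case: eqP => [e|_]; [rewrite (LP x xL) e eqxx | exact: pr0].
rewrite big1_seq// => x /andP[_ xL]; rewrite (LP x xL h).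
case: eqP => [e|_]; last exact: pr0.
by rewrite (LP x xL) -e (negPf gh).
Qed.

Lemma mk_fin v : exists2 s : seq Gam, uniq s & v = \sum_(g <- s) pr g v.
Proof.
have [L vE LP] := pr_dec v; exists (undup (map fst L)); first exact: undup_uniq.
have prv g : pr g v = \sum_(x <- L) pr g x.2 by rewrite {1}vE pr_sum.
rewrite (eq_bigr _ (fun g _ => prv g)) exchange_big/= {1}vE !big_seq; apply: eq_bigr => x xL.
have xs : x.1 \in undup (map fst L) by rewrite mem_undup map_f.
rewrite (bigD1_seq x.1)/= ?undup_uniq// (LP x xL) eqxx big1 ?addr0//.
by move=> g gx; rewrite (LP x xL) (negPf gx).
Qed.

Definition mk_grading : grading V := Grading prB mk_orth mk_fin.

End MkGrading.

(* The carrier is a [pzRingType] rather than an [algType] because an algebra  *)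
(* given by a presentation is not known to be nonzero; [sa_scal] is the       *)
(* structure map from [k].                                                    *)
Record superalg (k : comNzRingType) := Superalg {
  sa_sort :> pzRingType;
  sa_scal : {rmorphism k -> sa_sort};
  sa_gr : grading sa_sort;
  sa_scalC : forall c (a : sa_sort), sa_scal c * a = a * sa_scal c;
  sa_scal_hom : forall c, ghom sa_gr 0 (sa_scal c);
  sa_mul_hom : forall g h a b,
    ghom sa_gr g a -> ghom sa_gr h b -> ghom sa_gr (g + h) (a * b) }.

Record superalg_hom (k : comNzRingType) (A B : superalg k) := SuperalgHom {
  sah_fun :> {rmorphism A -> B};
  sah_scal : forall c, sah_fun (sa_scal A c) = sa_scal B c;
  sah_hom : forall g a, ghom (sa_gr A) g a -> ghom (sa_gr B) g (sah_fun a) }.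

Record supermod (k : comNzRingType) (A : superalg k) := Supermod {
  sm_sort :> lmodType A;
  sm_gr : grading sm_sort;
  sm_act_hom : forall g h (a : A) (m : sm_sort),
    ghom (sa_gr A) g a -> ghom sm_gr h m -> ghom sm_gr (g + h) (a *: m) }.

Record smhom (k : comNzRingType) (A : superalg k) (M N : supermod A) := SMHom {
  smh_fun :> M -> N;
  smh_lin : linear smh_fun;
  smh_hom : forall g m, ghom (sm_gr M) g m -> ghom (sm_gr N) g (smh_fun m) }.

Section SuperTheory.
Variables (k : comNzRingType).

Lemma sa1_hom (A : superalg k) : ghom (sa_gr A) 0 1.
Proof. by rewrite -(rmorph1 (sa_scal A)); exact: sa_scal_hom. Qed.

Lemma psgnM (A : superalg k) (a b : A) :
  psgn (sa_gr A) (a * b) = psgn (sa_gr A) a * psgn (sa_gr A) b.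
Proof.
elim/(ghom_ind (G := sa_gr A)): a => [|a a' IHa IHa'|g a ah].
- by rewrite mul0r psgn0 mul0r.
- by rewrite mulrDl !psgnD IHa IHa' -mulrDl.
elim/(ghom_ind (G := sa_gr A)): b => [|b b' IHb IHb'|h b bh].
- by rewrite mulr0 psgn0 mulr0.
- by rewrite mulrDr !psgnD IHb IHb' -mulrDr.
rewrite (psgn_hom ah) (psgn_hom bh) (psgn_hom (sa_mul_hom ah bh)) /=.
by case: g.2; case: h.2; rewrite /= ?mulrNN ?mulNr ?mulrN.
Qed.

Lemma psgn1 (A : superalg k) : psgn (sa_gr A) 1 = 1.
Proof. by rewrite (psgn_hom (sa1_hom A)). Qed.

Variable A : superalg k.

Lemma smhD (M N : supermod A) (f : smhom M N) x y : f (x + y) = f x + f y.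
Proof. by have := smh_lin f 1 x y; rewrite !scale1r. Qed.

Lemma smh0 (M N : supermod A) (f : smhom M N) : f 0 = 0.
Proof. by apply: (addIr (f 0)); rewrite -smhD !add0r. Qed.

Lemma smhZ (M N : supermod A) (f : smhom M N) a x : f (a *: x) = a *: f x.
Proof. by have := smh_lin f a x 0; rewrite smh0 !addr0. Qed.

Lemma smhB (M N : supermod A) (f : smhom M N) x y : f (x - y) = f x - f y.
Proof. by rewrite -scaleN1r smhD smhZ scaleN1r. Qed.

Lemma smh_gproj (M N : supermod A) (f : smhom M N) g x :
  f (sm_gr M g x) = sm_gr N g (f x).
Proof.
elim/(ghom_ind (G := sm_gr M)): x => [|x y IHx IHy|h x xh].
- by rewrite gproj0 smh0 gproj0.
- by rewrite gprojD !smhD gprojD IHx IHy.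
rewrite (ghomE _ xh) (ghomE _ (smh_hom f xh)).
by case: ifP => // _; rewrite smh0.
Qed.

Lemma smhom_eq (M N : supermod A) (f g : smhom M N) : f =1 g -> f = g.
Proof.
case: f g => [f fl fh] [g gl gh] /= /funext fg; subst g.
by rewrite (Prop_irrelevance fl gl) (Prop_irrelevance fh gh).
Qed.

Lemma smid_lin (M : supermod A) : linear (@id M).
Proof. by []. Qed.

Definition smid (M : supermod A) : smhom M M :=
  SMHom (@smid_lin M) (fun _ _ h => h).

Lemma smcomp_lin (M N P : supermod A) (f : smhom N P) (g : smhom M N) :
  linear (f \o g).
Proof. by move=> a x y /=; rewrite smhD smhZ smhD smhZ. Qed.

Definition smcomp (M N P : supermod A) (f : smhom N P) (g : smhom M N) :
  smhom M P :=
  SMHom (smcomp_lin f g) (fun _ _ h => smh_hom f (smh_hom g h)).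

End SuperTheory.

Definition finitely_generated (k : comNzRingType) (A : superalg k)
    (M : supermod A) : Prop :=
  exists s : seq M, forall m : M, exists c : 'I_(size s) -> A,
    m = \sum_(i < size s) c i *: s`_i.

Record smfunctor (k : comNzRingType) (A B : superalg k) := SMFunctor {
  fobj :> supermod A -> supermod B;
  fmap : forall M N : supermod A, smhom M N -> smhom (fobj M) (fobj N);
  fmap_id : forall M : supermod A, fmap (smid M) = smid (fobj M);
  fmap_comp : forall (M N P : supermod A) (f : smhom N P) (g : smhom M N),
    fmap (smcomp f g) = smcomp (fmap f) (fmap g) }.

(* Natural isomorphism of the restrictions of two functors to the full        *)
(* subcategory of finitely generated modules                                  *)
Definition nat_iso (k : comNzRingType) (A B : superalg k)
    (F G : smfunctor A B) : Prop :=
  exists eta : forall M : supermod A, finitely_generated M -> smhom (F M) (G M),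
    (forall M (hM : finitely_generated M), bijective (eta M hM)) /\
    (forall M N (hM : finitely_generated M) (hN : finitely_generated N)
        (f : smhom M N),
      smcomp (eta N hN) (fmap F f) = smcomp (fmap G f) (eta M hM)).

Section BasicFunctors.
Variables (k : comNzRingType).

Definition id_functor (A : superalg k) : smfunctor A A :=
  @SMFunctor k A A (fun M => M) (fun _ _ f => f)
    (fun _ => erefl) (fun _ _ _ _ _ => erefl).

Lemma comp_functor_id (A B C : superalg k) (F : smfunctor B C) (G : smfunctor A B) M :
  fmap F (fmap G (smid M)) = smid (F (G M)).
Proof. by rewrite !fmap_id. Qed.

Lemma comp_functor_comp (A B C : superalg k) (F : smfunctor B C) (G : smfunctor A B)
    M N P (f : smhom N P) (g : smhom M N) :
  fmap F (fmap G (smcomp f g)) = smcomp (fmap F (fmap G f)) (fmap F (fmap G g)).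
Proof. by rewrite !fmap_comp. Qed.

Definition comp_functor (A B C : superalg k) (F : smfunctor B C) (G : smfunctor A B) :
    smfunctor A C :=
  @SMFunctor k A C (fun M => F (G M)) (fun _ _ f => fmap F (fmap G f))
    (comp_functor_id F G) (fun _ _ _ => @comp_functor_comp _ _ _ F G _ _ _).

Variables A B : superalg k.

Section DirectSum.
Variables M N : supermod A.

Definition add_pr (g : Gam) (x : M * N) : M * N :=
  (sm_gr M g x.1, sm_gr N g x.2).

Lemma add_prB g : {morph add_pr g : x y / x - y}.
Proof. by move=> x y; rewrite /add_pr /= !gprojB. Qed.

Lemma add_pr_dec (v : M * N) : exists2 L : seq (Gam * (M * N)),
  v = \sum_(x <- L) x.2 &
  forall x, x \in L -> forall g, add_pr g x.2 = if g == x.1 then x.2 else 0.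
Proof.
case: v => m n.
have [s _ mE] := gproj_fin (sm_gr M) m; have [t _ nE] := gproj_fin (sm_gr N) n.
exists ([seq (g, (sm_gr M g m, 0 : N)) | g <- s] ++
        [seq (g, (0 : M, sm_gr N g n)) | g <- t]).
  apply: injective_projections; rewrite raddf_sum big_cat !big_map /=.
    by rewrite -mE big1 ?addr0.
  by rewrite big1 ?add0r.
move=> x; rewrite mem_cat => /orP[] /mapP[g _ ->] h; rewrite /add_pr /= gproj0.
  by rewrite gproj_orth; case: eqP => // ->.
by rewrite gproj_orth; case: eqP => // ->.
Qed.

Definition add_gr : grading (M * N)%type := mk_grading add_prB add_pr_dec.

Lemma add_act_hom g h (a : A) (m : M * N) :
  ghom (sa_gr A) g a -> ghom add_gr h m -> ghom add_gr (g + h) (a *: m).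
Proof.
case: m => m n ah; rewrite /ghom /= /add_pr /= => -[mh nh].
by congr (_, _); apply: sm_act_hom.
Qed.

Definition add_mod : supermod A := @Supermod k A (M * N)%type add_gr add_act_hom.

End DirectSum.

Section DirectSumMap.
Variables (M N M' N' : supermod A) (f : smhom M M') (g : smhom N N').

Definition add_map (x : add_mod M N) : add_mod M' N' := (f x.1, g x.2).

Lemma add_map_lin : linear add_map.
Proof. by move=> a x y; rewrite /add_map /= !smhD !smhZ. Qed.

Lemma add_map_hom h x :
  ghom (sm_gr (add_mod M N)) h x -> ghom (sm_gr (add_mod M' N')) h (add_map x).
Proof.
by case: x => m n [mh nh]; congr (_, _); rewrite /= -smh_gproj ?mh ?nh.
Qed.

Definition add_hom : smhom (add_mod M N) (add_mod M' N') :=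
  SMHom add_map_lin add_map_hom.

End DirectSumMap.

Section Zero.

Definition zero_pr (g : Gam) (x : 'rV[A]_0) : 'rV[A]_0 := 0.

Lemma zero_prB g : {morph zero_pr g : x y / x - y}.
Proof. by move=> x y; rewrite /zero_pr subrr. Qed.

Lemma zero_pr_dec (v : 'rV[A]_0) : exists2 L : seq (Gam * 'rV[A]_0),
  v = \sum_(x <- L) x.2 &
  forall x, x \in L -> forall g, zero_pr g x.2 = if g == x.1 then x.2 else 0.
Proof. by exists [::] => //; rewrite big_nil [v]thinmx0. Qed.

Definition zero_gr : grading 'rV[A]_0 := mk_grading zero_prB zero_pr_dec.

Lemma zero_act_hom g h (a : A) (m : 'rV[A]_0) :
  ghom (sa_gr A) g a -> ghom zero_gr h m -> ghom zero_gr (g + h) (a *: m).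
Proof. by move=> _ _; rewrite /ghom [LHS]thinmx0 [RHS]thinmx0. Qed.

Definition zero_mod : supermod A := @Supermod k A 'rV[A]_0 zero_gr zero_act_hom.

End Zero.

(* Shift of the Z-grading: [shift_mod j M]_(i, e) = M_(i + j, e) *)

Section Shift.
Variables (j : int).

Section Obj.
Variable M : supermod A.

Definition shift_pr (g : Gam) (x : M) : M := sm_gr M (g + (j, false)) x.

Lemma shift_prB g : {morph shift_pr g : x y / x - y}.
Proof. by move=> x y; exact: gprojB. Qed.

Lemma shift_pr_dec (v : M) : exists2 L : seq (Gam * M),
  v = \sum_(x <- L) x.2 &
  forall x, x \in L -> forall g, shift_pr g x.2 = if g == x.1 then x.2 else 0.
Proof.
have [s _ vE] := gproj_fin (sm_gr M) v.
exists [seq (g - (j, false), sm_gr M g v) | g <- s]; first by rewrite big_map.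
by move=> x /mapP[g _ ->] h; rewrite /shift_pr /= gproj_orth eq_sym -subr_eq eq_sym.
Qed.

Definition shift_gr : grading M := mk_grading shift_prB shift_pr_dec.

Lemma shift_act_hom g h (a : A) (m : M) :
  ghom (sa_gr A) g a -> ghom shift_gr h m -> ghom shift_gr (g + h) (a *: m).
Proof.
by move=> ah mh; rewrite /ghom /= /shift_pr -addrA; exact: sm_act_hom ah mh.
Qed.

Definition shift_mod : supermod A := @Supermod k A M shift_gr shift_act_hom.

End Obj.

Definition shift_hom (M N : supermod A) (f : smhom M N) :
    smhom (shift_mod M) (shift_mod N) :=
  @SMHom k A (shift_mod M) (shift_mod N) f (smh_lin f)
    (fun g m => @smh_hom k A M N f (g + (j, false)) m).

Lemma shift_hom_id M : shift_hom (smid M) = smid (shift_mod M).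
Proof. exact: smhom_eq. Qed.

Lemma shift_hom_comp M N P (f : smhom N P) (g : smhom M N) :
  shift_hom (smcomp f g) = smcomp (shift_hom f) (shift_hom g).
Proof. exact: smhom_eq. Qed.

Definition shift_functor : smfunctor A A := SMFunctor shift_hom_id shift_hom_comp.

End Shift.

End BasicFunctors.

Section SumFunctors.
Variables (k : comNzRingType) (A B : superalg k).

Lemma dsum_functor_id (F G : smfunctor A B) M :
  add_hom (fmap F (smid M)) (fmap G (smid M)) = smid (add_mod (F M) (G M)).
Proof. by apply: smhom_eq => -[x y]; rewrite !fmap_id. Qed.

Lemma dsum_functor_comp (F G : smfunctor A B) M N P (f : smhom N P) (g : smhom M N) :
  add_hom (fmap F (smcomp f g)) (fmap G (smcomp f g)) =
  smcomp (add_hom (fmap F f) (fmap G f)) (add_hom (fmap F g) (fmap G g)).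
Proof. by apply: smhom_eq => -[x y]; rewrite !fmap_comp. Qed.

Definition dsum_functor (F G : smfunctor A B) : smfunctor A B :=
  SMFunctor (dsum_functor_id F G) (@dsum_functor_comp F G).

Lemma zero_functor_comp :
  smid (zero_mod B) = smcomp (smid (zero_mod B)) (smid (zero_mod B)).
Proof. exact: smhom_eq. Qed.

Definition zero_functor : smfunctor A B :=
  @SMFunctor k A B (fun _ => zero_mod B) (fun _ _ _ => smid (zero_mod B))
    (fun _ => erefl) (fun _ _ _ _ _ => zero_functor_comp).

Fixpoint big_dsum_functor (n : nat) (F : nat -> smfunctor A B) : smfunctor A B :=
  if n is m.+1 then dsum_functor (big_dsum_functor m F) (F m) else zero_functor.

End SumFunctors.

Definition pi_sort (k : comNzRingType) (A : superalg k) (M : supermod A) : Type :=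
  M.

Section ParityShift.
Variables (k : comNzRingType) (A : superalg k).

Section Obj.
Variable M : supermod A.

HB.instance Definition _ := GRing.Zmodule.on (pi_sort M).

Definition pi_scale (a : A) (m : pi_sort M) : pi_sort M :=
  psgn (sa_gr A) a *: (m : M).

Lemma pi_scaleA a b m : pi_scale a (pi_scale b m) = pi_scale (a * b) m.
Proof. by rewrite /pi_scale psgnM scalerA. Qed.

Lemma pi_scale1 : left_id 1 pi_scale.
Proof. by move=> m; rewrite /pi_scale psgn1 scale1r. Qed.

Lemma pi_scaleDr : right_distributive pi_scale +%R.
Proof. by move=> a x y; exact: scalerDr. Qed.

Lemma pi_scaleDl m : {morph pi_scale^~ m : a b / a + b}.
Proof. by move=> a b; rewrite /pi_scale psgnD scalerDl. Qed.

HB.instance Definition _ := GRing.Zmodule_isLmodule.Build A (pi_sort M)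
  pi_scaleA pi_scale1 pi_scaleDr pi_scaleDl.

Definition pi_pr (g : Gam) (x : pi_sort M) : pi_sort M :=
  sm_gr M (g.1, ~~ g.2) x.

Lemma pi_prB g : {morph pi_pr g : x y / x - y}.
Proof. by move=> x y; exact: gprojB. Qed.

Lemma pi_pr_dec (v : pi_sort M) : exists2 L : seq (Gam * pi_sort M),
  v = \sum_(x <- L) x.2 &
  forall x, x \in L -> forall g, pi_pr g x.2 = if g == x.1 then x.2 else 0.
Proof.
have [s _ vE] := gproj_fin (sm_gr M) v.
exists [seq ((g.1, ~~ g.2), sm_gr M g v : pi_sort M) | g <- s].
  by rewrite big_map.
move=> x /mapP[[d p] _ ->] [e q]; rewrite /pi_pr /= gproj_orth !xpair_eqE.
by congr (if _ && _ then _ else _); case: p; case: q.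
Qed.

Definition pi_gr : grading (pi_sort M) := mk_grading pi_prB pi_pr_dec.

Lemma pi_act_hom g h (a : A) (m : pi_sort M) :
  ghom (sa_gr A) g a -> ghom pi_gr h m -> ghom pi_gr (g + h) (a *: m).
Proof.
move=> ah mh; rewrite /ghom /= /pi_pr.
have -> : ((g + h).1, ~~ (g + h).2) = g + (h.1, ~~ h.2) :> Gam.
  by case: g h {ah mh} => [? []] [? []].
exact: sm_act_hom (ghom_psgn ah) (mh : ghom (sm_gr M) (h.1, ~~ h.2) m).
Qed.

Definition pi_mod : supermod A := @Supermod k A (pi_sort M) pi_gr pi_act_hom.

End Obj.

Lemma pi_hom_lin (M N : supermod A) (f : smhom M N) :
  linear (f : pi_mod M -> pi_mod N).
Proof. by move=> a x y; exact: (smh_lin f (psgn (sa_gr A) a) x y). Qed.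

Definition pi_hom (M N : supermod A) (f : smhom M N) : smhom (pi_mod M) (pi_mod N) :=
  SMHom (pi_hom_lin f) (fun g m => @smh_hom k A M N f (g.1, ~~ g.2) m).

Lemma pi_hom_id M : pi_hom (smid M) = smid (pi_mod M).
Proof. exact: smhom_eq. Qed.

Lemma pi_hom_comp M N P (f : smhom N P) (g : smhom M N) :
  pi_hom (smcomp f g) = smcomp (pi_hom f) (pi_hom g).
Proof. exact: smhom_eq. Qed.

Definition pi_functor : smfunctor A A := SMFunctor pi_hom_id pi_hom_comp.

End ParityShift.

Definition res_sort (k : comNzRingType) (A B : superalg k)
  (phi : superalg_hom A B) (M : supermod B) : Type := M.

Section Restriction.
Variables (k : comNzRingType) (A B : superalg k) (phi : superalg_hom A B).

Section Obj.
Variable M : supermod B.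

HB.instance Definition _ := GRing.Zmodule.on (res_sort phi M).

Definition res_scale (a : A) (m : res_sort phi M) : res_sort phi M :=
  phi a *: (m : M).

Lemma res_scaleA a b m : res_scale a (res_scale b m) = res_scale (a * b) m.
Proof. by rewrite /res_scale rmorphM scalerA. Qed.

Lemma res_scale1 : left_id 1 res_scale.
Proof. by move=> m; rewrite /res_scale rmorph1 scale1r. Qed.

Lemma res_scaleDr : right_distributive res_scale +%R.
Proof. by move=> a x y; exact: scalerDr. Qed.

Lemma res_scaleDl m : {morph res_scale^~ m : a b / a + b}.
Proof. by move=> a b; rewrite /res_scale rmorphD scalerDl. Qed.

HB.instance Definition _ := GRing.Zmodule_isLmodule.Build A (res_sort phi M)
  res_scaleA res_scale1 res_scaleDr res_scaleDl.

Definition res_gr : grading (res_sort phi M) := sm_gr M.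

Lemma res_act_hom g h (a : A) (m : res_sort phi M) :
  ghom (sa_gr A) g a -> ghom res_gr h m -> ghom res_gr (g + h) (a *: m).
Proof. by move=> ah mh; apply: (sm_act_hom (sah_hom phi ah) mh). Qed.

Definition res_mod : supermod A := @Supermod k A (res_sort phi M) res_gr res_act_hom.

End Obj.

Lemma res_hom_lin (M N : supermod B) (f : smhom M N) :
  linear (f : res_mod M -> res_mod N).
Proof. by move=> a x y; exact: (smh_lin f (phi a) x y). Qed.

Definition res_hom (M N : supermod B) (f : smhom M N) :
    smhom (res_mod M) (res_mod N) :=
  SMHom (res_hom_lin f) (fun g m => @smh_hom k B M N f g m).

Lemma res_hom_id M : res_hom (smid M) = smid (res_mod M).
Proof. exact: smhom_eq. Qed.

Lemma res_hom_comp M N P (f : smhom N P) (g : smhom M N) :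
  res_hom (smcomp f g) = smcomp (res_hom f) (res_hom g).
Proof. exact: smhom_eq. Qed.

Definition res_functor : smfunctor B A := SMFunctor res_hom_id res_hom_comp.

End Restriction.

(* The tensor product B (x)_A M along [phi : A -> B]: formal sums of pure     *)
(* tensors modulo biadditivity and balancedness                               *)

Section TensorProduct.
Variables (A B : pzRingType) (phi : {rmorphism A -> B}) (M : lmodType A).

Inductive tterm :=
  TZero | TPure of B & M | TOpp of tterm | TAdd of tterm & tterm.

Inductive tcong : tterm -> tterm -> Prop :=
| tc_refl t : tcong t t
| tc_sym t u : tcong t u -> tcong u t
| tc_trans t u v : tcong t u -> tcong u v -> tcong t v
| tc_opp t u : tcong t u -> tcong (TOpp t) (TOpp u)
| tc_add t u t' u' : tcong t u -> tcong t' u' -> tcong (TAdd t t') (TAdd u u')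
| tc_addA t u v : tcong (TAdd t (TAdd u v)) (TAdd (TAdd t u) v)
| tc_addC t u : tcong (TAdd t u) (TAdd u t)
| tc_add0 t : tcong (TAdd TZero t) t
| tc_addN t : tcong (TAdd (TOpp t) t) TZero
| tc_pureDl b b' m : tcong (TPure (b + b') m) (TAdd (TPure b m) (TPure b' m))
| tc_pureDr b m m' : tcong (TPure b (m + m')) (TAdd (TPure b m) (TPure b m'))
| tc_pureA b a m : tcong (TPure (b * phi a) m) (TPure b (a *: m)).

Definition tcongb (t u : {classic tterm}) : bool := `[< tcong t u >].

Lemma tcongb_refl : reflexive tcongb.
Proof. by move=> t; apply/asboolP; exact: tc_refl. Qed.

Lemma tcongb_sym : symmetric tcongb.
Proof. by move=> t u; apply/asboolP/asboolP; exact: tc_sym. Qed.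

Lemma tcongb_trans : transitive tcongb.
Proof.
by move=> u t v /asboolP tu /asboolP uv; apply/asboolP; exact: tc_trans tu uv.
Qed.

Canonical tcong_equiv := EquivRel tcongb tcongb_refl tcongb_sym tcongb_trans.

Definition tensor : Type := {eq_quot tcong_equiv}%qT.

HB.instance Definition _ := Choice.on tensor.

Definition tclass (t : tterm) : tensor := (\pi_({eq_quot tcong_equiv}) t)%qT.
Definition trepr (x : tensor) : tterm := repr (x : {eq_quot tcong_equiv}%qT).

Lemma treprK x : tclass (trepr x) = x. Proof. exact: reprK. Qed.

Lemma tclassP t u : tclass t = tclass u <-> tcong t u.
Proof. by split=> [/eqquotP/asboolP|tu]; last exact/eqquotP/asboolP. Qed.

Lemma trepr_class t : tcong (trepr (tclass t)) t.
Proof. by apply/tclassP; rewrite treprK. Qed.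

Lemma tensor_term (P : tensor -> Prop) : (forall t, P (tclass t)) -> forall x, P x.
Proof. by move=> Pt x; rewrite -(treprK x). Qed.

Definition tadd (x y : tensor) := tclass (TAdd (trepr x) (trepr y)).
Definition topp (x : tensor) := tclass (TOpp (trepr x)).

Lemma taddE t u : tadd (tclass t) (tclass u) = tclass (TAdd t u).
Proof. by apply/tclassP/tc_add; exact: trepr_class. Qed.

Lemma toppE t : topp (tclass t) = tclass (TOpp t).
Proof. by apply/tclassP/tc_opp; exact: trepr_class. Qed.

Lemma taddA : associative tadd.
Proof.
elim/tensor_term=> t; elim/tensor_term=> u; elim/tensor_term=> v.
by rewrite !taddE; apply/tclassP; exact: tc_addA.
Qed.

Lemma taddC : commutative tadd.
Proof.
elim/tensor_term=> t; elim/tensor_term=> u.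
by rewrite !taddE; apply/tclassP; exact: tc_addC.
Qed.

Lemma tadd0 : left_id (tclass TZero) tadd.
Proof. by elim/tensor_term=> t; rewrite !taddE; apply/tclassP; exact: tc_add0. Qed.

Lemma taddN : left_inverse (tclass TZero) topp tadd.
Proof.
by elim/tensor_term=> t; rewrite toppE !taddE; apply/tclassP; exact: tc_addN.
Qed.

HB.instance Definition _ := GRing.isZmodule.Build tensor taddA taddC tadd0 taddN.

Lemma tclassD t u : tclass t + tclass u = tclass (TAdd t u).
Proof. exact: taddE. Qed.

Lemma tclassN t : - tclass t = tclass (TOpp t).
Proof. exact: toppE. Qed.

Definition pure (b : B) (m : M) : tensor := tclass (TPure b m).

Lemma pureDl b b' m : pure (b + b') m = pure b m + pure b' m.
Proof.
by rewrite tclassD; apply/tclassP; exact: tc_pureDl.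
Qed.

Lemma pureDr b m m' : pure b (m + m') = pure b m + pure b m'.
Proof.
by rewrite tclassD; apply/tclassP; exact: tc_pureDr.
Qed.

Lemma pureA b a m : pure (b * phi a) m = pure b (a *: m).
Proof. by apply/tclassP; exact: tc_pureA. Qed.

Lemma pure0l m : pure 0 m = 0.
Proof. by apply: (addIr (pure 0 m)); rewrite -pureDl !add0r. Qed.

Lemma pure0r b : pure b 0 = 0.
Proof. by apply: (addIr (pure b 0)); rewrite -pureDr !add0r. Qed.

Lemma pureNl b m : pure (- b) m = - pure b m.
Proof. by apply/eqP; rewrite -addr_eq0 -pureDl addNr pure0l. Qed.

Lemma tensor_sum x :
  exists L : seq (B * M), x = \sum_(p <- L) pure p.1 p.2.
Proof.
elim/tensor_term: x; elim=> [|b m|t [L tE]|t [L tE] u [K uE]].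
- by exists [::]; rewrite big_nil.
- by exists [:: (b, m)]; rewrite big_seq1.
- exists [seq (- p.1, p.2) | p <- L].
  rewrite -tclassN tE big_map -sumrN.
  by apply: eq_bigr => p _; rewrite pureNl.
- by exists (L ++ K); rewrite -tclassD big_cat -tE -uE.
Qed.

Lemma tensor_ind (P : tensor -> Prop) : (forall b m, P (pure b m)) ->
  (forall x y, P x -> P y -> P (x + y)) -> forall x, P x.
Proof.
move=> Pp PD x; have [L ->] := tensor_sum x.
by elim/big_ind: _ => //; rewrite -(pure0l 0).
Qed.

Section Lift.
Variables (W : zmodType) (h : B -> M -> W).
Hypothesis hDl : forall b b' m, h (b + b') m = h b m + h b' m.
Hypothesis hDr : forall b m m', h b (m + m') = h b m + h b m'.
Hypothesis hA : forall b a m, h (b * phi a) m = h b (a *: m).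

Fixpoint teval (t : tterm) : W :=
  match t with
  | TZero => 0
  | TPure b m => h b m
  | TOpp t => - teval t
  | TAdd t u => teval t + teval u
  end.

Lemma teval_cong t u : tcong t u -> teval t = teval u.
Proof.
elim=> //=.
- by move=> ? ? ? _ -> _ ->.
- by move=> ? ? _ ->.
- by move=> ? ? ? ? _ -> _ ->.
- by move=> *; rewrite addrA.
- by move=> *; rewrite addrC.
- by move=> *; rewrite add0r.
- by move=> *; rewrite addNr.
Qed.

End Lift.

Definition tlift (W : zmodType) (h : B -> M -> W) (x : tensor) : W :=
  teval h (trepr x).

Section LiftTheory.
Variables (W : zmodType) (h : B -> M -> W).
Hypothesis hDl : forall b b' m, h (b + b') m = h b m + h b' m.
Hypothesis hDr : forall b m m', h b (m + m') = h b m + h b m'.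
Hypothesis hA : forall b a m, h (b * phi a) m = h b (a *: m).

Lemma tlift_class t : tlift h (tclass t) = teval h t.
Proof. by apply: teval_cong => //; exact: trepr_class. Qed.

Lemma tlift_pure b m : tlift h (pure b m) = h b m.
Proof. by rewrite tlift_class. Qed.

Lemma tliftD x y : tlift h (x + y) = tlift h x + tlift h y.
Proof.
elim/tensor_term: x => t; elim/tensor_term: y => u.
by rewrite tclassD !tlift_class.
Qed.

Lemma tliftN x : tlift h (- x) = - tlift h x.
Proof. by elim/tensor_term: x => t; rewrite tclassN !tlift_class. Qed.

Lemma tliftB : {morph tlift h : x y / x - y}.
Proof. by move=> x y; rewrite tliftD tliftN. Qed.

End LiftTheory.
End TensorProduct.

Section Induction.
Variables (k : comNzRingType) (A B : superalg k) (phi : superalg_hom A B).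

Section Obj.
Variable M : supermod A.
Local Notation BM := (tensor phi M).
Local Notation pure := (@pure A B phi M).
Implicit Types (b : B) (m : M) (x : BM).

Definition ind_scale (b : B) : BM -> BM := tlift (fun b' m => pure (b * b') m).

Lemma ind_scale_pure b b' m : ind_scale b (pure b' m) = pure (b * b') m.
Proof.
apply: (tlift_pure (h := fun b' m => pure (b * b') m)) => *.
- by rewrite mulrDr pureDl.
- by rewrite pureDr.
- by rewrite mulrA pureA.
Qed.

Lemma ind_scaleDr : right_distributive ind_scale +%R.
Proof.
move=> b x y; apply: (tliftD (h := fun b' m => pure (b * b') m)) => *.
- by rewrite mulrDr pureDl.
- by rewrite pureDr.
- by rewrite mulrA pureA.
Qed.

Lemma ind_scaleA b b' x : ind_scale b (ind_scale b' x) = ind_scale (b * b') x.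
Proof.
elim/tensor_ind: x => [c m|x y IHx IHy]; first by rewrite !ind_scale_pure mulrA.
by rewrite !ind_scaleDr IHx IHy.
Qed.

Lemma ind_scale1 : left_id 1 ind_scale.
Proof.
elim/tensor_ind=> [c m|x y IHx IHy]; first by rewrite ind_scale_pure mul1r.
by rewrite ind_scaleDr IHx IHy.
Qed.

Lemma ind_scaleDl x : {morph ind_scale^~ x : a b / a + b}.
Proof.
move=> a b; elim/tensor_ind: x => [c m|x y IHx IHy].
  by rewrite !ind_scale_pure mulrDl pureDl.
by rewrite !ind_scaleDr IHx IHy addrACA.
Qed.

HB.instance Definition _ := GRing.Zmodule_isLmodule.Build B BM
  ind_scaleA ind_scale1 ind_scaleDr ind_scaleDl.

Lemma scale_pure b b' m : b *: pure b' m = pure (b * b') m.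
Proof. exact: ind_scale_pure. Qed.

(* The component of degree [g] of [b (x) m] is the sum of the                 *)
(* [b_h (x) m_(g - h)].                                                       *)
Definition ind_proj (g : Gam) (b : B) (m : M) : BM :=
  \sum_(h \in [set: Gam]) pure (sa_gr B h b) (sm_gr M (g - h) m).

Lemma ind_projDl g b b' m :
  ind_proj g (b + b') m = ind_proj g b m + ind_proj g b' m.
Proof.
have [s sP] := gproj_supp (sa_gr B) b; have [t tP] := gproj_supp (sa_gr B) b'.
rewrite /ind_proj -(@fsumD _ _ s t) => [|h /sP ->|h /tP ->]; rewrite ?pure0l//.
by apply: eq_fsbigr => h _; rewrite gprojD pureDl.
Qed.

Lemma ind_projDr g b m m' :
  ind_proj g b (m + m') = ind_proj g b m + ind_proj g b m'.
Proof.
have [s sP] := gproj_supp (sa_gr B) b.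
rewrite /ind_proj -(@fsumD _ _ s s) => [|h /sP ->|h /sP ->]; rewrite ?pure0l//.
by apply: eq_fsbigr => h _; rewrite gprojD pureDr.
Qed.

Lemma ind_proj0l g m : ind_proj g 0 m = 0.
Proof. by apply: (addIr (ind_proj g 0 m)); rewrite -ind_projDl !add0r. Qed.

Lemma ind_proj0r g b : ind_proj g b 0 = 0.
Proof. by apply: (addIr (ind_proj g b 0)); rewrite -ind_projDr !add0r. Qed.

Lemma ind_proj_hom g hb hm b m : ghom (sa_gr B) hb b -> ghom (sm_gr M) hm m ->
  ind_proj g b m = if g == hb + hm then pure b m else 0.
Proof.
move=> bh mh; rewrite /ind_proj (@fsum1 _ _ hb) => [|h hhb].
  rewrite (ghomE _ bh) eqxx (ghomE _ mh) subr_eq addrC.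
  by case: ifP => // _; rewrite pure0r.
by rewrite (ghomE _ bh) (negPf hhb) pure0l.
Qed.

Lemma ind_projA g b a m : ind_proj g (b * phi a) m = ind_proj g b (a *: m).
Proof.
elim/(ghom_ind (G := sa_gr B)): b => [|b b' IHb IHb'|hb b bh].
- by rewrite mul0r !ind_proj0l.
- by rewrite mulrDl !ind_projDl IHb IHb'.
elim/(ghom_ind (G := sa_gr A)): a => [|a a' IHa IHa'|ha a ah].
- by rewrite rmorph0 mulr0 scale0r ind_proj0l ind_proj0r.
- by rewrite rmorphD mulrDr scalerDl ind_projDl ind_projDr IHa IHa'.
elim/(ghom_ind (G := sm_gr M)): m => [|m m' IHm IHm'|hm m mh].
- by rewrite scaler0 !ind_proj0r.
- by rewrite scalerDr !ind_projDr IHm IHm'.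
rewrite (ind_proj_hom _ (sa_mul_hom bh (sah_hom phi ah)) mh).
by rewrite (ind_proj_hom _ bh (sm_act_hom ah mh)) addrA pureA.
Qed.

Definition ind_pr (g : Gam) : BM -> BM := tlift (ind_proj g).

Lemma ind_pr_pure g b m : ind_pr g (pure b m) = ind_proj g b m.
Proof.
apply: tlift_pure => *; [exact: ind_projDl|exact: ind_projDr|exact: ind_projA].
Qed.

Lemma ind_prB g : {morph ind_pr g : x y / x - y}.
Proof.
apply: tliftB => *; [exact: ind_projDl|exact: ind_projDr|exact: ind_projA].
Qed.

Lemma ind_prD g x y : ind_pr g (x + y) = ind_pr g x + ind_pr g y.
Proof.
apply: tliftD => *; [exact: ind_projDl|exact: ind_projDr|exact: ind_projA].
Qed.

Lemma ind_pr_hom g hb hm b m : ghom (sa_gr B) hb b -> ghom (sm_gr M) hm m ->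
  ind_pr g (pure b m) = if g == hb + hm then pure b m else 0.
Proof. by move=> bh mh; rewrite ind_pr_pure (ind_proj_hom _ bh mh). Qed.

Lemma ind_pr_dec x : exists2 L : seq (Gam * BM),
  x = \sum_(y <- L) y.2 &
  forall y, y \in L -> forall g, ind_pr g y.2 = if g == y.1 then y.2 else 0.
Proof.
elim/tensor_ind: x => [b m|x y [L xE LP] [K yE KP]]; last first.
  exists (L ++ K); first by rewrite big_cat xE yE.
  by move=> z; rewrite mem_cat => /orP[/LP|/KP].
elim/(ghom_ind (G := sa_gr B)): b => [|b b' [L xE LP] [K yE KP]|hb b bh].
- by exists [::] => //; rewrite big_nil pure0l.
- exists (L ++ K); first by rewrite big_cat pureDl xE yE.
  by move=> z; rewrite mem_cat => /orP[/LP|/KP].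
elim/(ghom_ind (G := sm_gr M)): m => [|m m' [L xE LP] [K yE KP]|hm m mh].
- by exists [::] => //; rewrite big_nil pure0r.
- exists (L ++ K); first by rewrite big_cat pureDr xE yE.
  by move=> z; rewrite mem_cat => /orP[/LP|/KP].
exists [:: (hb + hm, pure b m)]; first by rewrite big_seq1.
by move=> y; rewrite inE => /eqP-> g /=; exact: ind_pr_hom.
Qed.

Definition ind_gr : grading BM := mk_grading ind_prB ind_pr_dec.

Lemma ind_scale_pr g h b x : ghom (sa_gr B) g b ->
  ind_pr (g + h) (b *: x) = b *: ind_pr h x.
Proof.
move=> bh; elim/tensor_ind: x => [c m|x y IHx IHy]; last first.
  by rewrite scalerDr !ind_prD scalerDr IHx IHy.
rewrite scale_pure.
elim/(ghom_ind (G := sa_gr B)): c => [|c c' IHc IHc'|hc c ch].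
- by rewrite mulr0 !ind_pr_pure !ind_proj0l scaler0.
- by rewrite mulrDr !pureDl !ind_prD scalerDr IHc IHc'.
elim/(ghom_ind (G := sm_gr M)): m => [|m m' IHm IHm'|hm m mh].
- by rewrite !ind_pr_pure !ind_proj0r scaler0.
- by rewrite !pureDr !ind_prD scalerDr IHm IHm'.
rewrite (ind_pr_hom _ (sa_mul_hom bh ch) mh) (ind_pr_hom _ ch mh).
rewrite -addrA (inj_eq (addrI g)); case: ifP => _; first by rewrite scale_pure.
by rewrite scaler0.
Qed.

Lemma ind_act_hom g h b x :
  ghom (sa_gr B) g b -> ghom ind_gr h x -> ghom ind_gr (g + h) (b *: x).
Proof.
by move=> bh xh; rewrite /ghom [LHS](ind_scale_pr h x bh); congr (_ *: _).
Qed.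

Definition ind_mod : supermod B := @Supermod k B BM ind_gr ind_act_hom.

Lemma ind_pure_hom hb hm b m : ghom (sa_gr B) hb b -> ghom (sm_gr M) hm m ->
  ghom (sm_gr ind_mod) (hb + hm) (pure b m).
Proof. by move=> bh mh; rewrite /ghom /= (ind_pr_hom _ bh mh) eqxx. Qed.

End Obj.

Section Map.
Variables (M N : supermod A) (f : smhom M N).

Definition ind_map : ind_mod M -> ind_mod N :=
  tlift (fun b m => pure phi b (f m)).

Lemma ind_map_pure b m : ind_map (pure phi b m) = pure phi b (f m).
Proof.
apply: (tlift_pure (h := fun b m => pure phi b (f m))) => *.
- by rewrite pureDl.
- by rewrite smhD pureDr.
- by rewrite smhZ pureA.
Qed.

Lemma ind_mapD x y : ind_map (x + y) = ind_map x + ind_map y.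
Proof.
apply: (tliftD (h := fun b m => pure phi b (f m))) => *.
- by rewrite pureDl.
- by rewrite smhD pureDr.
- by rewrite smhZ pureA.
Qed.

Lemma ind_map_lin : linear ind_map.
Proof.
move=> b x y; rewrite ind_mapD; congr (_ + _).
elim/tensor_ind: x => [c m|x x' IHx IHx'].
  by rewrite [b *: _]scale_pure !ind_map_pure [RHS]scale_pure.
by rewrite scalerDr !ind_mapD IHx IHx' scalerDr.
Qed.

Lemma ind_map_gproj g x : sm_gr (ind_mod N) g (ind_map x) =
  ind_map (sm_gr (ind_mod M) g x).
Proof.
elim/tensor_ind: x => [c m|x x' IHx IHx']; last first.
  by rewrite ind_mapD !gprojD ind_mapD IHx IHx'.
have ind_map0 : ind_map 0 = 0.
  by rewrite -(pure0l phi 0) ind_map_pure smh0 pure0l.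
elim/(ghom_ind (G := sa_gr B)): c => [|c c' IHc IHc'|hc c ch].
- by rewrite pure0l gproj0 ind_map0 gproj0.
- by rewrite pureDl ind_mapD !gprojD ind_mapD IHc IHc'.
elim/(ghom_ind (G := sm_gr M)): m => [|m m' IHm IHm'|hm m mh].
- by rewrite pure0r gproj0 ind_map0 gproj0.
- by rewrite pureDr ind_mapD !gprojD ind_mapD IHm IHm'.
rewrite ind_map_pure (ghomE _ (ind_pure_hom ch mh)).
rewrite (ghomE _ (ind_pure_hom ch (smh_hom f mh))).
by case: ifP => _; rewrite ?ind_map_pure// ind_map0.
Qed.

Lemma ind_map_hom g x :
  ghom (sm_gr (ind_mod M)) g x -> ghom (sm_gr (ind_mod N)) g (ind_map x).
Proof. by rewrite /ghom ind_map_gproj => ->. Qed.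

Definition ind_hom : smhom (ind_mod M) (ind_mod N) := SMHom ind_map_lin ind_map_hom.

End Map.

Lemma ind_hom_id M : ind_hom (smid M) = smid (ind_mod M).
Proof.
apply: smhom_eq; elim/tensor_ind=> [b m|x y IHx IHy]; first exact: ind_map_pure.
by rewrite smhD IHx IHy.
Qed.

Lemma ind_hom_comp M N P (f : smhom N P) (g : smhom M N) :
  ind_hom (smcomp f g) = smcomp (ind_hom f) (ind_hom g).
Proof.
apply: smhom_eq; elim/tensor_ind=> [b m|x y IHx IHy].
  by rewrite /= !ind_map_pure.
by rewrite !smhD IHx IHy.
Qed.

Definition ind_functor : smfunctor A B := SMFunctor ind_hom_id ind_hom_comp.

End Induction.

Section Presentation.
Variables (k : comNzRingType) (X : Type).

Inductive expr :=
  Scal of k | Gen of X | Add of expr & expr | Mul of expr & expr.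

Definition Opp (t : expr) : expr := Mul (Scal (-1)) t.

Variable R : expr -> expr -> Prop.

Inductive acong : expr -> expr -> Prop :=
| ac_rel t u : R t u -> acong t u
| ac_refl t : acong t t
| ac_sym t u : acong t u -> acong u t
| ac_trans t u v : acong t u -> acong u v -> acong t v
| ac_add t u t' u' : acong t u -> acong t' u' -> acong (Add t t') (Add u u')
| ac_mul t u t' u' : acong t u -> acong t' u' -> acong (Mul t t') (Mul u u')
| ac_addA t u v : acong (Add t (Add u v)) (Add (Add t u) v)
| ac_addC t u : acong (Add t u) (Add u t)
| ac_add0 t : acong (Add (Scal 0) t) t
| ac_addN t : acong (Add (Opp t) t) (Scal 0)
| ac_mulA t u v : acong (Mul t (Mul u v)) (Mul (Mul t u) v)
| ac_mul1 t : acong (Mul (Scal 1) t) t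
| ac_mulDl t u v : acong (Mul (Add t u) v) (Add (Mul t v) (Mul u v))
| ac_mulDr t u v : acong (Mul t (Add u v)) (Add (Mul t u) (Mul t v))
| ac_scalD c d : acong (Scal (c + d)) (Add (Scal c) (Scal d))
| ac_scalM c d : acong (Scal (c * d)) (Mul (Scal c) (Scal d))
| ac_scalC c t : acong (Mul (Scal c) t) (Mul t (Scal c)).

Definition acongb (t u : {classic expr}) : bool := `[< acong t u >].

Lemma acongb_refl : reflexive acongb.
Proof. by move=> t; apply/asboolP; exact: ac_refl. Qed.

Lemma acongb_sym : symmetric acongb.
Proof. by move=> t u; apply/asboolP/asboolP; exact: ac_sym. Qed.

Lemma acongb_trans : transitive acongb.
Proof.
by move=> u t v /asboolP tu /asboolP uv; apply/asboolP; exact: ac_trans tu uv.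
Qed.

Canonical acong_equiv := EquivRel acongb acongb_refl acongb_sym acongb_trans.

Definition presalg : Type := {eq_quot acong_equiv}%qT.

HB.instance Definition _ := Choice.on presalg.

Definition aclass (t : expr) : presalg := (\pi_({eq_quot acong_equiv}) t)%qT.
Definition arepr (x : presalg) : expr := repr (x : {eq_quot acong_equiv}%qT).

Lemma areprK x : aclass (arepr x) = x. Proof. exact: reprK. Qed.

Lemma aclassP t u : aclass t = aclass u <-> acong t u.
Proof. by split=> [/eqquotP/asboolP|tu]; last exact/eqquotP/asboolP. Qed.

Lemma arepr_class t : acong (arepr (aclass t)) t.
Proof. by apply/aclassP; rewrite areprK. Qed.

Lemma presalg_term (P : presalg -> Prop) :
  (forall t, P (aclass t)) -> forall x, P x.
Proof. by move=> Pt x; rewrite -(areprK x). Qed.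

Definition aadd (x y : presalg) := aclass (Add (arepr x) (arepr y)).
Definition amul (x y : presalg) := aclass (Mul (arepr x) (arepr y)).
Definition aopp (x : presalg) := aclass (Opp (arepr x)).

Lemma aaddE t u : aadd (aclass t) (aclass u) = aclass (Add t u).
Proof. by apply/aclassP/ac_add; exact: arepr_class. Qed.

Lemma amulE t u : amul (aclass t) (aclass u) = aclass (Mul t u).
Proof. by apply/aclassP/ac_mul; exact: arepr_class. Qed.

Lemma aoppE t : aopp (aclass t) = aclass (Opp t).
Proof. by apply/aclassP/ac_mul; [exact: ac_refl|exact: arepr_class]. Qed.

Lemma aaddA : associative aadd.
Proof.
elim/presalg_term=> t; elim/presalg_term=> u; elim/presalg_term=> v.
by rewrite !aaddE; apply/aclassP; exact: ac_addA.
Qed.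

Lemma aaddC : commutative aadd.
Proof.
elim/presalg_term=> t; elim/presalg_term=> u.
by rewrite !aaddE; apply/aclassP; exact: ac_addC.
Qed.

Lemma aadd0 : left_id (aclass (Scal 0)) aadd.
Proof. by elim/presalg_term=> t; rewrite !aaddE; apply/aclassP; exact: ac_add0. Qed.

Lemma aaddN : left_inverse (aclass (Scal 0)) aopp aadd.
Proof.
by elim/presalg_term=> t; rewrite aoppE !aaddE; apply/aclassP; exact: ac_addN.
Qed.

HB.instance Definition _ := GRing.isZmodule.Build presalg aaddA aaddC aadd0 aaddN.

Lemma amulA : associative amul.
Proof.
elim/presalg_term=> t; elim/presalg_term=> u; elim/presalg_term=> v.
by rewrite !amulE; apply/aclassP; exact: ac_mulA.
Qed.

Lemma amul1l : left_id (aclass (Scal 1)) amul.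
Proof. by elim/presalg_term=> t; rewrite !amulE; apply/aclassP; exact: ac_mul1. Qed.

Lemma amul1r : right_id (aclass (Scal 1)) amul.
Proof.
elim/presalg_term=> t; rewrite !amulE; apply/aclassP.
exact: ac_trans (ac_sym (ac_scalC _ _)) (ac_mul1 _).
Qed.

Lemma amulDl : left_distributive amul aadd.
Proof.
elim/presalg_term=> t; elim/presalg_term=> u; elim/presalg_term=> v.
by rewrite !(amulE, aaddE); apply/aclassP; exact: ac_mulDl.
Qed.

Lemma amulDr : right_distributive amul aadd.
Proof.
elim/presalg_term=> t; elim/presalg_term=> u; elim/presalg_term=> v.
by rewrite !(amulE, aaddE); apply/aclassP; exact: ac_mulDr.
Qed.

HB.instance Definition _ := GRing.Zmodule_isPzRing.Build presalg
  amulA amul1l amul1r amulDl amulDr.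

Lemma aclassD t u : aclass (Add t u) = aclass t + aclass u.
Proof. exact/esym/aaddE. Qed.

Lemma aclassM t u : aclass (Mul t u) = aclass t * aclass u.
Proof. exact/esym/amulE. Qed.

Lemma aclassN t : aclass (Opp t) = - aclass t.
Proof. exact/esym/aoppE. Qed.

Lemma aclass_rel t u : R t u -> aclass t = aclass u.
Proof. by move=> /ac_rel tu; exact/aclassP. Qed.

Definition ascal (c : k) : presalg := aclass (Scal c).

Lemma ascalB : {morph ascal : x y / x - y}.
Proof.
move=> c d; apply: (addIr (ascal d)); rewrite subrK.
rewrite -aclassD -[in LHS](subrK d c) addrK; apply/esym/aclassP.
by have := ac_scalD (c - d) d; rewrite subrK.
Qed.

Lemma ascalM : monoid_morphism ascal.
Proof. by split=> // c d; rewrite -aclassM; apply/aclassP; exact: ac_scalM. Qed.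

HB.instance Definition _ := GRing.isZmodMorphism.Build k presalg ascal ascalB.
HB.instance Definition _ := GRing.isMonoidMorphism.Build k presalg ascal ascalM.

Lemma ascalC c a : ascal c * a = a * ascal c.
Proof.
elim/presalg_term: a => t; rewrite -!aclassM; apply/aclassP; exact: ac_scalC.
Qed.

Section Lift.
Variables (W : pzRingType) (s : {rmorphism k -> W}) (h : X -> W).

Fixpoint aeval (t : expr) : W :=
  match t with
  | Scal c => s c
  | Gen x => h x
  | Add t u => aeval t + aeval u
  | Mul t u => aeval t * aeval u
  end.

Definition alift (x : presalg) : W := aeval (arepr x).

Hypothesis sC : forall c w, s c * w = w * s c.
Hypothesis hR : forall t u, R t u -> aeval t = aeval u.

Lemma aeval_cong t u : acong t u -> aeval t = aeval u.
Proof.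
elim=> //=.
- by move=> ? ? ? _ -> _ ->.
- by move=> ? ? ? ? _ -> _ ->.
- by move=> ? ? ? ? _ -> _ ->.
- by move=> *; rewrite addrA.
- by move=> *; rewrite addrC.
- by move=> *; rewrite rmorph0 add0r.
- by move=> *; rewrite rmorphN rmorph1 mulN1r addNr rmorph0.
- by move=> *; rewrite mulrA.
- by move=> *; rewrite rmorph1 mul1r.
- by move=> *; rewrite mulrDl.
- by move=> *; rewrite mulrDr.
- by move=> *; rewrite rmorphD.
- by move=> *; rewrite rmorphM.
Qed.

Lemma alift_class t : alift (aclass t) = aeval t.
Proof. by apply: aeval_cong; exact: arepr_class. Qed.

Lemma aliftB : {morph alift : x y / x - y}.
Proof.
elim/presalg_term=> t; elim/presalg_term=> u.
rewrite -aclassN -aclassD !alift_class /=.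
by rewrite rmorphN rmorph1 mulN1r.
Qed.

Lemma aliftM : monoid_morphism alift.
Proof.
split; first by rewrite alift_class /= rmorph1.
elim/presalg_term=> t; elim/presalg_term=> u.
by rewrite -aclassM !alift_class.
Qed.

End Lift.

(* A grading of a presented algebra [A] is built from operators on the        *)
(* functions [Gam -> A] through which an element of degree [g] acts by        *)
(* [w |-> (d |-> a * w (d - g))].                                             *)

Section PresentedGrading.
Local Notation A := presalg.
Local Notation W := (Gam -> A).
Variable gact : X -> W -> W.
Hypothesis gactD : forall x (w v : W),
  gact x (fun d => w d + v d) = fun d => gact x w d + gact x v d.
Hypothesis gactZ : forall x c (w : W),
  gact x (fun d => ascal c * w d) = fun d => ascal c * gact x w d.

Fixpoint eact (t : expr) (w : W) : W :=
  match t with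
  | Scal c => fun d => ascal c * w d
  | Gen x => gact x w
  | Add t u => fun d => eact t w d + eact u w d
  | Mul t u => eact t (eact u w)
  end.

Hypothesis eactR : forall t u, R t u -> eact t = eact u.

Lemma eactD t (w v : W) :
  eact t (fun d => w d + v d) = fun d => eact t w d + eact t v d.
Proof.
elim: t w v => [c|x|t IHt u IHu|t IHt u IHu] w v /=.
- by apply/funext => d; rewrite mulrDr.
- exact: gactD.
- by apply/funext => d; rewrite IHt IHu addrACA.
- by rewrite IHu IHt.
Qed.

Lemma eactZ t c (w : W) :
  eact t (fun d => ascal c * w d) = fun d => ascal c * eact t w d.
Proof.
elim: t w => [b|x|t IHt u IHu|t IHt u IHu] w /=.
- by apply/funext => d; rewrite !mulrA (ascalC b).
- exact: gactZ.
- by apply/funext => d; rewrite IHt IHu mulrDr.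
- by rewrite IHu IHt.
Qed.

Lemma eact_cong t u : acong t u -> eact t = eact u.
Proof.
elim=> //=.
- by move=> ? ? ? _ -> _ ->.
- by move=> ? ? ? ? _ -> _ ->.
- by move=> ? ? ? ? _ -> _ ->.
- by move=> *; apply/funext => w; apply/funext => d; rewrite addrA.
- by move=> *; apply/funext => w; apply/funext => d; rewrite addrC.
- move=> *; apply/funext => w; apply/funext => d.
  by rewrite (rmorph0 ascal) mul0r add0r.
- move=> *; apply/funext => w; apply/funext => d.
  by rewrite (rmorph0 ascal) mul0r (rmorphN1 ascal) mulN1r addNr.
- by move=> *; apply/funext => w; apply/funext => d; rewrite (rmorph1 ascal) mul1r.
- by move=> *; apply/funext => w; rewrite eactD.
- by move=> *; apply/funext => w; apply/funext => d; rewrite rmorphD mulrDl.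
- by move=> *; apply/funext => w; apply/funext => d; rewrite rmorphM mulrA.
- by move=> *; apply/funext => w; rewrite eactZ.
Qed.

Definition aact (a : A) : W -> W := eact (arepr a).

Lemma aact_class t : aact (aclass t) = eact t.
Proof. by apply: eact_cong; exact: arepr_class. Qed.

Definition ahom (g : Gam) (a : A) := forall w d, aact a w d = a * w (d - g).

Lemma aactD a b w d : aact (a + b) w d = aact a w d + aact b w d.
Proof.
elim/presalg_term: a => t; elim/presalg_term: b => u.
by rewrite -aclassD !aact_class.
Qed.

Lemma aactM a b w : aact (a * b) w = aact a (aact b w).
Proof.
elim/presalg_term: a => t; elim/presalg_term: b => u.
by rewrite -aclassM !aact_class.
Qed.

Lemma aactN a w d : aact (- a) w d = - aact a w d.
Proof.
elim/presalg_term: a => t; rewrite -aclassN !aact_class /=.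
by rewrite (rmorphN1 ascal) mulN1r.
Qed.

Lemma ahom_scal c : ahom 0 (ascal c).
Proof. by move=> w d; rewrite aact_class subr0. Qed.

Lemma ahomD g a b : ahom g a -> ahom g b -> ahom g (a + b).
Proof. by move=> ah bh w d; rewrite aactD ah bh mulrDl. Qed.

Lemma ahomN g a : ahom g a -> ahom g (- a).
Proof. by move=> ah w d; rewrite aactN ah mulNr. Qed.

Lemma ahom0 g : ahom g 0.
Proof.
by move=> w d; rewrite aact_class /= (rmorph0 ascal) !mul0r.
Qed.

Lemma ahomM g h a b : ahom g a -> ahom h b -> ahom (g + h) (a * b).
Proof. by move=> ah bh w d; rewrite aactM ah bh mulrA opprD addrA. Qed.

Definition apr (g : Gam) (a : A) : A := aact a (fun d => (d == 0)%:R) g.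

Lemma aprB g : {morph apr g : a b / a - b}.
Proof. by move=> a b; rewrite /apr aactD aactN. Qed.

Lemma ahom_apr g h a : ahom g a -> apr h a = if h == g then a else 0.
Proof.
move=> ah; rewrite /apr ah subr_eq0.
by case: ifP => _; rewrite ?mulr1 ?mulr0.
Qed.

Hypothesis gdec : forall x, exists2 L : seq (Gam * A),
  aclass (Gen x) = \sum_(y <- L) y.2 & forall y, y \in L -> ahom y.1 y.2.

Lemma ahom_dec a : exists2 L : seq (Gam * A),
  a = \sum_(y <- L) y.2 & forall y, y \in L -> ahom y.1 y.2.
Proof.
elim/presalg_term: a; elim=> [c|x|t [L tE LP] u [K uE KP]|t [L tE LP] u [K uE KP]].
- exists [:: (0, ascal c)]; rewrite ?big_seq1// => y.
  by rewrite inE => /eqP ->; exact: ahom_scal.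
- exact: gdec.
- exists (L ++ K); first by rewrite aclassD big_cat tE uE.
  by move=> y; rewrite mem_cat => /orP[/LP|/KP].
- exists [seq (x.1 + y.1, x.2 * y.2) | x <- L, y <- K].
    rewrite aclassM tE uE big_allpairs_dep mulr_suml; apply: eq_bigr => x _.
    by rewrite mulr_sumr.
  move=> z /allpairsP[[x y] /= [xL yK ->]] /=.
  by apply: ahomM; [exact: LP|exact: KP].
Qed.

Lemma apr_dec a : exists2 L : seq (Gam * A), a = \sum_(x <- L) x.2 &
  forall x, x \in L -> forall g, apr g x.2 = if g == x.1 then x.2 else 0.
Proof.
have [L aE LP] := ahom_dec a; exists L => // x xL g; exact/ahom_apr/LP.
Qed.

Definition pres_gr : grading A := mk_grading aprB apr_dec.

Lemma ahomP g a : ahom g a <-> ghom pres_gr g a.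
Proof.
split=> [ah|]; first by rewrite /ghom /= (ahom_apr _ ah) eqxx.
have [L aE LP] := ahom_dec a.
rewrite /ghom => <-; rewrite aE (gproj_sum pres_gr).
have : forall y, y \in L -> ahom g (pres_gr g y.2).
  move=> y yL; rewrite /= (ahom_apr _ (LP y yL)).
  by case: eqP => [->|_]; [exact: LP | exact: ahom0].
elim: {aE LP} L => [|y L IHL] yP; first by rewrite big_nil; exact: ahom0.
rewrite big_cons; apply: ahomD; first by apply: yP; rewrite mem_head.
by apply: IHL => z zL; apply: yP; rewrite inE zL orbT.
Qed.

Lemma pres_scal_hom c : ghom pres_gr 0 (ascal c).
Proof. exact/ahomP/ahom_scal. Qed.

Lemma pres_mul_hom g h a b :
  ghom pres_gr g a -> ghom pres_gr h b -> ghom pres_gr (g + h) (a * b).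
Proof. by move=> /ahomP ah /ahomP bh; apply/ahomP/ahomM. Qed.

Definition pres_superalg : superalg k :=
  @Superalg k presalg ascal pres_gr ascalC pres_scal_hom pres_mul_hom.

Lemma pres_hom_graded (B : superalg k) (phi : {rmorphism A -> B}) :
  (forall c, phi (ascal c) = sa_scal B c) ->
  (forall x, exists2 L : seq (Gam * A), aclass (Gen x) = \sum_(y <- L) y.2 &
    forall y, y \in L -> ahom y.1 y.2 /\ ghom (sa_gr B) y.1 (phi y.2)) ->
  forall g a, ghom pres_gr g a -> ghom (sa_gr B) g (phi a).
Proof.
move=> phi_scal phi_gen g a.
have [L aE LP] : exists2 L : seq (Gam * A), a = \sum_(y <- L) y.2 &
    forall y, y \in L -> ahom y.1 y.2 /\ ghom (sa_gr B) y.1 (phi y.2).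
  elim/presalg_term: a; elim=> [c|x|t [L tE LP] u [K uE KP]|t [L tE LP] u [K uE KP]].
  - exists [:: (0, ascal c)]; rewrite ?big_seq1// => y.
    rewrite inE => /eqP ->; split; first exact: ahom_scal.
    by rewrite phi_scal; exact: sa_scal_hom.
  - exact: phi_gen.
  - exists (L ++ K); first by rewrite aclassD big_cat tE uE.
    by move=> y; rewrite mem_cat => /orP[/LP|/KP].
  - exists [seq (x.1 + y.1, x.2 * y.2) | x <- L, y <- K].
      rewrite aclassM tE uE big_allpairs_dep mulr_suml; apply: eq_bigr => x _.
      by rewrite mulr_sumr.
    move=> z /allpairsP[[x y] /= [xL yK ->]] /=.
    have [xh xh'] := LP _ xL; have [yh yh'] := KP _ yK.
    by rewrite rmorphM; split; [exact: ahomM|exact: sa_mul_hom].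
rewrite /ghom => <-; rewrite aE (gproj_sum pres_gr) raddf_sum big_seq.
apply: ghom_sum => y yL; have [yh yh'] := LP _ yL.
rewrite /= (ahom_apr _ yh); case: eqP => [->//|_]; rewrite raddf0; exact: ghom0.
Qed.

End PresentedGrading.
End Presentation.

Definition is_basis (k : comNzRingType) (V : lmodType k) (I : finType)
    (b : I -> V) : Prop :=
  forall v, exists! c : {ffun I -> k}, v = \sum_i c i *: b i.

Record frobenius (k : comNzRingType) := Frobenius {
  fr_alg :> algType k;
  fr_gr : grading fr_alg;
  fr_scal_hom : forall c : k, ghom fr_gr 0 c%:A;
  fr_mul_hom : forall g h a b,
    ghom fr_gr g a -> ghom fr_gr h b -> ghom fr_gr (g + h) (a * b);
  (* N-graded *)
  fr_ge0 : forall d p f, ghom fr_gr (d, p) f -> d < 0 -> f = 0;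
  fr_tr : {scalar fr_alg};
  (* parity-preserving, and homogeneous of degree [- t] for some [t] *)
  fr_tr_even : forall d f, ghom fr_gr (d, true) f -> fr_tr f = 0;
  fr_tr_deg : exists t, forall d p f, ghom fr_gr (d, p) f -> d <> t -> fr_tr f = 0;
  fr_nondeg : forall u : {scalar fr_alg}, exists! f, forall g,
    u g = sbil fr_gr (fun f g => fr_tr (g * f)) f g }.

Record wreath_data (k : comNzRingType) := WreathData {
  wd_F :> frobenius k;
  wd_psi : {lrmorphism wd_F -> wd_F};
  wd_psiP : forall f g, fr_tr wd_F (f * g) =
    sbil (fr_gr wd_F) (fun f g => fr_tr wd_F (g * wd_psi f)) f g;
  wd_theta : nat;
  wd_theta_gt0 : (0 < wd_theta)%N;
  wd_psi_theta : iter wd_theta wd_psi =1 id;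
  wd_theta_min : forall m, (0 < m < wd_theta)%N -> ~ iter m wd_psi =1 id;
  wd_eigen : exists (J : finType) (v : J -> wd_F),
    is_basis v /\ forall j, exists z : k, wd_psi (v j) = z *: v j;
  (* the maximum degree of elements of F *)
  wd_delta : int;
  wd_delta_max : forall d p f, ghom (fr_gr wd_F) (d, p) f -> wd_delta < d -> f = 0;
  wd_delta_ex : exists p f, ghom (fr_gr wd_F) (wd_delta, p) f /\ f <> 0;
  (* a homogeneous basis and its left dual basis *)
  wd_I : finType;
  wd_B : wd_I -> wd_F;
  wd_deg : wd_I -> Gam;
  wd_B_basis : is_basis wd_B;
  wd_B_hom : forall i, ghom (fr_gr wd_F) (wd_deg i) (wd_B i);
  wd_Bv : wd_I -> wd_F;
  wd_BvP : forall i j, fr_tr wd_F (wd_Bv i * wd_B j) = (i == j)%:R }.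

Arguments wd_B {k} w i.
Arguments wd_deg {k} w i.
Arguments wd_Bv {k} w i.

Definition dim_even (k : comNzRingType) (D : wreath_data k) : nat :=
  #|[set i | ~~ (wd_deg D i).2]|.

Definition dim_odd (k : comNzRingType) (D : wreath_data k) : nat :=
  #|[set i | (wd_deg D i).2]|.

Section WreathTheory.
Variables (k : comNzRingType) (D : wreath_data k).
Local Notation F := (wd_F D).
Local Notation G := (fr_gr (wd_F D)).
Local Notation tr := (fr_tr (wd_F D)).
Local Notation psi := (wd_psi D).
Local Notation tau := ((wd_delta D, false) : Gam).

Lemma fr_projZ g (c : k) (f : F) : G g (c *: f) = c *: G g f.
Proof.
elim/(ghom_ind (G := G)): f => [|f f' IHf IHf'|h f fh].
- by rewrite scaler0 !gproj0 scaler0.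
- by rewrite scalerDr !gprojD IHf IHf' scalerDr.
have cfh : ghom G h (c *: f).
  by rewrite -[f]mul1r scalerAl -[h]add0r; apply: fr_mul_hom => //;
    exact: fr_scal_hom.
by rewrite (ghomE _ cfh) (ghomE _ fh); case: ifP; rewrite ?scaler0.
Qed.

Lemma nondegr g (f : F) : ghom G g f -> (forall x, tr (x * f) = 0) -> f = 0.
Proof.
move=> fh f0; have [f1 [f1P uf1]] := fr_nondeg (\0 : {scalar F}).
have uE (f' : F) : (forall x, tr (x * f') = 0) -> ghom G g f' -> f1 = f'.
  move=> f'0 f'h; apply: uf1 => x; rewrite /sbil !big_bool/= !(ppart_hom _ f'h).
  by case: g.2; rewrite /= !(mulr0, linear0, f'0, mul0rz, addr0).
by rewrite -(uE f f0 fh); apply: uE => [x|]; [rewrite mulr0 linear0|exact: ghom0].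
Qed.

Lemma nondegr_hom g (f : F) : ghom G g f ->
  (forall h x, ghom G h x -> tr (x * f) = 0) -> f = 0.
Proof.
move=> fh f0; apply: (nondegr fh) => x.
elim/(ghom_ind (G := G)): x => [|x y IHx IHy|]; last exact: f0.
  by rewrite mul0r linear0.
by rewrite mulrDl linearD /= IHx IHy addr0.
Qed.

Lemma fr1_hom : ghom G 0 1.
Proof. by rewrite -(scale1r 1); exact: fr_scal_hom. Qed.

Lemma tr_hom g f : ghom G g f -> g != tau -> tr f = 0.
Proof.
have [t tP] := fr_tr_deg F.
suff <- : t = wd_delta D.
  case: g => d [] fh; first by move=> _; exact: fr_tr_even fh.
  by rewrite xpair_eqE andbT => /eqP; exact: tP fh.
apply/le_anti/andP; split; rewrite leNgt; apply/negP => lt.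
  have [p [f0 [f0h f0n]]] := wd_delta_ex D.
  have := oner_neq0 F; rewrite (nondegr_hom fr1_hom) ?eqxx// => -[d q] x xh.
  rewrite mulr1; case: (eqVneq d t) xh => [->|/eqP dt] xh; last exact: tP xh dt.
  by rewrite (wd_delta_max xh lt) linear0.
have [p [f0 [f0h]]] := wd_delta_ex D; apply.
apply: (nondegr_hom f0h) => -[d q] x xh.
have [d0|d0] := ltP d 0; first by rewrite (fr_ge0 xh d0) mul0r linear0.
apply: (tP (d + wd_delta D) (q + p)); first exact: fr_mul_hom xh f0h.
by move=> e; move: lt; rewrite -e ltNge lerDr d0.
Qed.

Lemma tr_proj h x f : ghom G h x -> tr (x * f) = tr (x * G (tau - h) f).
Proof.
move=> xh; elim/(ghom_ind (G := G)): f => [|f f' IHf IHf'|g f fh].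
- by rewrite gproj0.
- by rewrite gprojD !mulrDr !linearD /= IHf IHf'.
rewrite (ghomE _ fh) subr_eq addrC eq_sym; case: ifPn => // gh.
rewrite mulr0 linear0; exact: tr_hom (fr_mul_hom xh fh) gh.
Qed.

Lemma tr_projl h x f : ghom G h x -> tr (f * x) = tr (G (tau - h) f * x).
Proof.
move=> xh; elim/(ghom_ind (G := G)): f => [|f f' IHf IHf'|g f fh].
- by rewrite gproj0.
- by rewrite gprojD !mulrDl !linearD /= IHf IHf'.
rewrite (ghomE _ fh) subr_eq eq_sym; case: ifPn => // gh.
rewrite mul0r linear0; exact: tr_hom (fr_mul_hom fh xh) gh.
Qed.

Lemma tr_psi g h f x : ghom G g f -> ghom G h x ->
  tr (f * x) = tr (x * psi f) *~ (-1) ^+ (g.2 && h.2).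
Proof.
move=> fh xh; rewrite wd_psiP; apply: sbil_hom => //.
  by move=> y; rewrite mul0r linear0.
by move=> y; rewrite linear0 mulr0 linear0.
Qed.

Lemma mulrz_sign_eq0 (R : zmodType) (a : R) (b : bool) :
  a *~ (-1) ^+ b = 0 -> a = 0.
Proof. by case: b => // /eqP; rewrite /= mulrNz oppr_eq0 => /eqP. Qed.

Lemma psi_hom g f : ghom G g f -> ghom G g (psi f).
Proof.
move=> fh.
have pr0 h : h != g -> G h (psi f) = 0.
  move=> hg; apply: (nondegr_hom (ghom_gproj G h (psi f))) => e x xh.
  have [eh|eh] := eqVneq (e + h) tau; last first.
    exact: tr_hom (fr_mul_hom xh (ghom_gproj _ _ _)) eh.
  have -> : h = tau - e by rewrite -eh addrAC subrr add0r.
  rewrite -(tr_proj _ xh); apply: (mulrz_sign_eq0 (b := g.2 && e.2)).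
  rewrite -(tr_psi fh xh).
  apply: (tr_hom (fr_mul_hom fh xh)); rewrite -eh addrC (inj_eq (addrI e)).
  by rewrite eq_sym.
by rewrite /ghom {2}(gproj_fsum G (psi f)) (fsum1 pr0).
Qed.

Lemma psi_inj f : psi f = 0 -> f = 0.
Proof.
move=> f0; rewrite -[f](@wd_psi_theta k D f).
case: (wd_theta D) (wd_theta_gt0 D) => // m _; rewrite iterSr f0.
by elim: m => //= m ->; rewrite linear0.
Qed.

Lemma psi_proj g f : G g (psi f) = psi (G g f).
Proof.
elim/(ghom_ind (G := G)): f => [|f f' IHf IHf'|h f fh].
- by rewrite gproj0 !linear0 gproj0.
- by rewrite linearD /= !gprojD IHf IHf' linearD.
by rewrite (ghomE _ (psi_hom fh)) (ghomE _ fh); case: ifP; rewrite ?linear0.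
Qed.

Lemma Bv_hom i : ghom G (tau - wd_deg D i) (wd_Bv D i).
Proof.
have pr0 h : h != tau - wd_deg D i -> G h (wd_Bv D i) = 0.
  move=> hi; set v := G h _.
  have vh : ghom G h v by exact: ghom_gproj.
  have vB j : tr (v * wd_B D j) = 0.
    have [hj|hj] := eqVneq h (tau - wd_deg D j); last first.
      apply: (tr_hom (fr_mul_hom vh (wd_B_hom j))).
      by apply: contra hj => /eqP <-; rewrite addrK.
    rewrite /v hj -(tr_projl _ (wd_B_hom j)) wd_BvP; case: eqP => // ij.
    by rewrite ij hj eqxx in hi.
  have v0 x : tr (v * x) = 0.
    have [c [-> _]] := wd_B_basis x; rewrite mulr_sumr linear_sum big1// => j _.
    by rewrite -scalerAr linearZ /= vB mulr0.
  apply: psi_inj; apply: (nondegr_hom (psi_hom vh)) => e x xh.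
  apply: (mulrz_sign_eq0 (b := h.2 && e.2)); rewrite -(tr_psi vh xh).
  exact: v0.
by rewrite /ghom {2}(gproj_fsum G (wd_Bv D i)) (fsum1 pr0).
Qed.

End WreathTheory.

Section AffineWreath.
Variables (k : comNzRingType) (D : wreath_data k).
Local Notation F := (wd_F D).
Local Notation G := (fr_gr (wd_F D)).
Local Notation psi := (wd_psi D).

(* [GT f] is the pure tensor [f_0 (x) ... (x) f_(n-1)] of [F^(x)n] *)
Inductive awp_gen (n : nat) :=
  GX of 'I_n | GT of {ffun 'I_n -> F} | GS of 'S_n.

Section Relations.
Variable n : nat.
Local Notation term := (expr k (awp_gen n)).
Local Notation tens := {ffun 'I_n -> F}.

Definition eX (i : 'I_n) : term := Gen k (GX i).
Definition eT (f : tens) : term := Gen k (GT f).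
Definition eS (s : 'S_n) : term := Gen k (GS s).

Definition setat (f : tens) (i : 'I_n) (a : F) : tens :=
  [ffun j => if j == i then a else f j].

Definition tens1 : tens := [ffun => 1].

(* 1 (x) ... (x) a (x) ... (x) 1, with [a] in position [i] *)
Definition at_pos (i : 'I_n) (a : F) : tens := setat tens1 i a.

(* t_(i,j) = sum_b b_i (b^vee)_j *)
Definition eteleporter (i j : 'I_n) : term :=
  \big[@Add _ _ / Scal _ 0]_(b : wd_I D)
     Mul (eT (at_pos i (wd_B D b))) (eT (at_pos j (wd_Bv D b))).

Definition tens_hom (g : 'I_n -> Gam) (f : tens) : Prop :=
  forall i, ghom G (g i) (f i).

(* Sign of (f_0 (x) ... (x) f_(n-1)) (h_0 (x) ... (x) h_(n-1)) *)
Definition mul_sign (g h : 'I_n -> Gam) : k :=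
  \prod_(i < n) \prod_(j < n | (j < i)%N) (-1) ^+ ((g i).2 && (h j).2).

(* Superpermutation: the factor in position [i] moves to position [s i], and  *)
(* every inversion of [s] between two odd factors contributes a sign.         *)
Definition perm_sign (s : 'S_n) (g : 'I_n -> Gam) : k :=
  \prod_(i < n) \prod_(j < n | (i < j)%N && (s j < s i)%N)
     (-1) ^+ ((g i).2 && (g j).2).

Definition perm_tens (s : 'S_n) (f : tens) : tens := [ffun i => f (s^-1%g i)].

(* The relations from [rel_XX] to [rel_SM] present the free product of        *)
(* k[x_0, ..., x_(n-1)], F^(x)n and k S_n.  In [rel_SM], [(s * t)%g] is s     *)
(* followed by t.                                                             *)
Inductive awp_rel : term -> term -> Prop :=
| rel_XX i j : awp_rel (Mul (eX i) (eX j)) (Mul (eX j) (eX i))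
| rel_TD f i a b : awp_rel (eT (setat f i (a + b)))
    (Add (eT (setat f i a)) (eT (setat f i b)))
| rel_TZ f i c a : awp_rel (eT (setat f i (c *: a)))
    (Mul (Scal _ c) (eT (setat f i a)))
| rel_T1 : awp_rel (eT tens1) (Scal _ 1)
| rel_TM g h f f' : tens_hom g f -> tens_hom h f' ->
    awp_rel (Mul (eT f) (eT f'))
            (Mul (Scal _ (mul_sign g h)) (eT [ffun i => f i * f' i]))
| rel_S1 : awp_rel (eS 1%g) (Scal _ 1)
| rel_SM s t : awp_rel (Mul (eS t) (eS s)) (eS (s * t)%g)
| rel_TX f i : awp_rel (Mul (eT f) (eX i)) (Mul (eX i) (eT (setat f i (psi (f i)))))
| rel_SX_far (i i' j : 'I_n) : i' = i.+1 :> nat -> j != i -> j != i' ->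
    awp_rel (Mul (eS (tperm i i')) (eX j)) (Mul (eX j) (eS (tperm i i')))
| rel_SX (i i' : 'I_n) : i' = i.+1 :> nat ->
    awp_rel (Mul (eS (tperm i i')) (eX i))
      (Add (Mul (eX i') (eS (tperm i i'))) (Opp (eteleporter i i')))
| rel_ST s g f : tens_hom g f ->
    awp_rel (Mul (eS s) (eT f))
      (Mul (Scal _ (perm_sign s g)) (Mul (eT (perm_tens s f)) (eS s))).

End Relations.

(* F^(m): gf = (-1)^(|f||g|) f psi^m(g) for all g *)
Definition in_Ftwist (m : nat) (f : F) : Prop :=
  forall g, g * f = sbil G (fun f g => f * iter m psi g) f g.

Definition in_Fpsi (f : F) : Prop := psi f = f.

(* The tuple C; [cy_c m j] is meaningful for 1 <= m <= theta, 1 <= j <= e_m *)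
Record cyclo_data := CycloData {
  cy_e : nat -> nat;
  cy_c : nat -> nat -> F;
  cy_hom : forall m j, (1 <= m <= wd_theta D)%N -> (1 <= j <= cy_e m)%N ->
    ghom G (m%:Z * wd_delta D, false) (cy_c m j);
  cy_twist : forall m j, (1 <= m <= wd_theta D)%N -> (1 <= j <= cy_e m)%N ->
    in_Ftwist m (cy_c m j) /\ in_Fpsi (cy_c m j) }.

Variable C : cyclo_data.

Definition level : nat := \sum_(1 <= m < (wd_theta D).+1) m * cy_e C m.

Definition chi (n : nat) : expr k (awp_gen n.+1) :=
  \big[@Mul _ _ / Scal _ 1]_(1 <= m < (wd_theta D).+1)
    \big[@Mul _ _ / Scal _ 1]_(1 <= j < (cy_e C m).+1)
      Add (iter m (Mul (eX ord0)) (Scal _ 1)) (Opp (eT (at_pos ord0 (cy_c C m j)))).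

(* A_(n+1)(F) modulo the two-sided ideal generated by [chi n] is presented by *)
(* the relations of A_(n+1)(F) together with [chi n = 0].                      *)
Inductive cyc_rel (n : nat) (t u : expr k (awp_gen n.+1)) : Prop :=
| rel_awp of awp_rel t u
| rel_chi of t = chi n & u = Scal _ 0.

Section Grading.
Variable n : nat.
Local Notation N := n.+1.
Local Notation A := (presalg (@cyc_rel n)).
Local Notation W := (Gam -> A).
Local Notation "[ t ]" := (aclass (@cyc_rel n) t).
Implicit Types (f : {ffun 'I_N -> F}) (w : W) (d : Gam).

Definition proj_tens (g : {ffun 'I_N -> Gam}) f : {ffun 'I_N -> F} :=
  [ffun i => G (g i) (f i)].

Definition tens_act f w : W := fun d =>
  \sum_(g \in [set: {ffun 'I_N -> Gam}]) [eT (proj_tens g f)] * w (d - \sum_i g i).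

Definition cyc_gact (x : awp_gen N) (w : W) : W :=
  match x with
  | GX i => fun d => [eX i] * w (d - (wd_delta D, false))
  | GT f => tens_act f w
  | GS s => fun d => [eS s] * w d
  end.

Lemma setat_id f i : setat f i (f i) = f.
Proof. by apply/ffunP => j; rewrite ffunE; case: eqP => // ->. Qed.

Lemma setat_setat f i a b : setat (setat f i a) i b = setat f i b.
Proof. by apply/ffunP => j; rewrite !ffunE; case: eqP. Qed.

Lemma T_add f i a b : [eT (setat f i (a + b))] = [eT (setat f i a)] + [eT (setat f i b)].
Proof. by rewrite -aclassD; apply: aclass_rel; left; exact: rel_TD. Qed.

Lemma T_scale f i c a : [eT (setat f i (c *: a))] = ascal _ c * [eT (setat f i a)].
Proof. by rewrite -aclassM; apply: aclass_rel; left; exact: rel_TZ. Qed.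

Lemma T_setat0 f i : [eT (setat f i 0)] = 0.
Proof. by rewrite -(scale0r 0) T_scale (rmorph0 (ascal _)) mul0r. Qed.

Lemma T_zero f i : f i = 0 -> [eT f] = 0.
Proof. by move=> fi; rewrite -(setat_id f i) fi T_setat0. Qed.

Lemma T_psi f i : [eT f] * [eX i] = [eX i] * [eT (setat f i (psi (f i)))].
Proof. by rewrite -!aclassM; apply: aclass_rel; left; exact: rel_TX. Qed.

Lemma tens_supp f : exists s : seq {ffun 'I_N -> Gam},
  forall g, g \notin s -> [eT (proj_tens g f)] = 0.
Proof.
have /choice[s sP] : forall i, exists s : seq Gam,
    forall g, g \notin s -> G g (f i) = 0 by move=> i; exact: gproj_supp.
pose S := flatten [seq s i | i <- enum 'I_N].
exists [seq [ffun i => val (h i)] | h : {ffun 'I_N -> seq_sub S}] => g gS.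
have [i giS] : exists i, g i \notin S.
  apply/existsP; apply: contraR gS; rewrite negb_exists => /forallP gS.
  have gS' i : g i \in S by have := gS i; rewrite negbK.
  apply/mapP; exists [ffun i => SeqSub (gS' i)]; first by rewrite mem_enum.
  by apply/ffunP => i; rewrite !ffunE.
apply: (@T_zero _ i); rewrite ffunE; apply: sP; apply: contra giS => gi.
by apply/flatten_mapP; exists i => //; rewrite mem_enum.
Qed.

Lemma tens_act_hom (g : 'I_N -> Gam) f w d :
  tens_hom g f -> tens_act f w d = [eT f] * w (d - \sum_i g i).
Proof.
move=> fh; rewrite /tens_act (@fsum1 _ _ [ffun i => g i]) => [|h hg].
  congr ([eT _] * w (d - _)).
    by apply/ffunP => i; rewrite !ffunE; exact: fh.
  by apply: eq_bigr => i _; rewrite ffunE.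
suff [i gi] : exists i, h i != g i.
  by rewrite (@T_zero _ i) ?mul0r// ffunE (ghomE _ (fh i)) (negPf gi).
apply/existsP; apply: contraR hg; rewrite negb_exists => /forallP hg.
by apply/eqP/ffunP => i; have := hg i; rewrite negbK ffunE => /eqP.
Qed.

Lemma cyc_gactD x (w v : W) :
  cyc_gact x (fun d => w d + v d) = fun d => cyc_gact x w d + cyc_gact x v d.
Proof.
apply/funext => d; case: x => [i|f|s] /=; rewrite ?mulrDr//.
have [s sP] := tens_supp f.
rewrite /tens_act -(@fsumD _ _ s s) => [|g /sP ->|g /sP ->]; rewrite ?mul0r//.
by apply: eq_fsbigr => g _; rewrite mulrDr.
Qed.

Lemma cyc_gactZ x c (w : W) :
  cyc_gact x (fun d => ascal _ c * w d) = fun d => ascal _ c * cyc_gact x w d.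
Proof.
apply/funext => d; case: x => [i|f|s] /=; [by rewrite !mulrA ascalC| |by rewrite !mulrA ascalC].
have [s sP] := tens_supp f.
rewrite /tens_act (fsum_morph (s := s) (h := fun a => ascal _ c * a)).
- by apply: eq_fsbigr => g _; rewrite !mulrA ascalC.
- exact: mulr0.
- by move=> a b; exact: mulrDr.
- by move=> g /sP ->; rewrite mul0r.
Qed.

Local Notation act := (eact cyc_gact).

Definition ehom (g : Gam) (t : expr k (awp_gen N)) : Prop :=
  forall w d, act t w d = [t] * w (d - g).

Lemma ehom_scal c : ehom 0 (Scal _ c).
Proof. by move=> w d; rewrite /= subr0. Qed.

Lemma ehom_X i : ehom (wd_delta D, false) (eX i).
Proof. by []. Qed.

Lemma ehom_S s : ehom 0 (eS s).
Proof. by move=> w d; rewrite /= subr0. Qed.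

Lemma ehom_T (g : 'I_N -> Gam) f : tens_hom g f -> ehom (\sum_i g i) (eT f).
Proof. by move=> fh w d; exact: tens_act_hom. Qed.

Lemma ehom_add g t u : ehom g t -> ehom g u -> ehom g (Add t u).
Proof. by move=> th uh w d; rewrite /= th uh aclassD mulrDl. Qed.

Lemma ehom_mul g h t u : ehom g t -> ehom h u -> ehom (g + h) (Mul t u).
Proof. by move=> th uh w d; rewrite /= th uh aclassM mulrA opprD addrA. Qed.

Lemma ehom_opp g t : ehom g t -> ehom g (Opp t).
Proof. by move=> th; rewrite -[g]add0r; apply: ehom_mul th; exact: ehom_scal. Qed.

Lemma ehom_zero g : ehom g (Scal _ 0).
Proof. by move=> w d; rewrite /= (rmorph0 (ascal _)) !mul0r. Qed.

Lemma at_pos_hom (i : 'I_N) g a :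
  ghom G g a -> tens_hom (fun j => if j == i then g else 0) (at_pos i a).
Proof.
by move=> ah j; rewrite !ffunE; case: eqP => // _; exact: fr1_hom.
Qed.

Lemma ehom_at_pos (i : 'I_N) g a : ghom G g a -> ehom g (eT (at_pos i a)).
Proof.
move=> ah; have := ehom_T (at_pos_hom i ah).
by rewrite -big_mkcond /= big_pred1_eq.
Qed.

Lemma ehom_teleporter (i j : 'I_N) : ehom (wd_delta D, false) (eteleporter i j).
Proof.
apply: (big_ind (ehom _)) => [|t u|b _]; first exact: ehom_zero.
  exact: ehom_add.
have -> : (wd_delta D, false) = wd_deg D b + ((wd_delta D, false) - wd_deg D b).
  by rewrite addrC subrK.
by apply: ehom_mul; apply: ehom_at_pos; [exact: wd_B_hom | exact: Bv_hom].
Qed.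

Lemma ehom_chi : exists g, ehom g (chi n).
Proof.
rewrite /chi big_nat_cond.
apply: (big_ind (fun t => exists g, ehom g t)).
- by exists 0; exact: ehom_scal.
- by move=> t u [g tg] [h uh]; exists (g + h); exact: ehom_mul.
move=> m /andP[mP _]; rewrite big_nat_cond.
apply: (big_ind (fun t => exists g, ehom g t)).
- by exists 0; exact: ehom_scal.
- by move=> t u [g tg] [h uh]; exists (g + h); exact: ehom_mul.
move=> j /andP[jP _]; exists (m%:Z * wd_delta D, false); apply: ehom_add.
  elim: m {mP jP} => [|m IHm] /=; first by rewrite mul0r; exact: ehom_scal.
  have -> : (m.+1%:Z * wd_delta D, false) =
      (wd_delta D, false) + (m%:Z * wd_delta D, false) :> Gam.
    by congr (_, _); rewrite intS mulrDl mul1r.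
  by apply: ehom_mul IHm; exact: ehom_X.
by apply/ehom_opp/ehom_at_pos/cy_hom.
Qed.

Lemma proj_setat g f i a :
  proj_tens g (setat f i a) = setat (proj_tens g f) i (G (g i) a).
Proof. by apply/ffunP => j; rewrite !ffunE; case: eqP => // ->. Qed.

Lemma ehom_eq g t u : [t] = [u] -> ehom g t -> ehom g u -> act t = act u.
Proof.
by move=> tu th uh; apply/funext => w; apply/funext => d; rewrite th uh tu.
Qed.

Lemma cyc_eactR t u : cyc_rel t u -> act t = act u.
Proof.
move=> tu; have := aclass_rel tu; case: tu => [|-> ->]; last first.
  move=> e; have [g gP] := ehom_chi; apply: (ehom_eq e gP); exact: ehom_zero.
case=> {t u} => [i j|f i a b|f i c a||g h f f' fh fh'||s t|f i|i i' j ii' ji ji'|i i' ii'|s g f fh] e.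
- by apply: (ehom_eq e); apply: ehom_mul; exact: ehom_X.
- apply/funext => w; apply/funext => d; rewrite /= /tens_act.
  have [s sP] := tens_supp (setat f i a); have [t tP] := tens_supp (setat f i b).
  rewrite -(@fsumD _ _ s t) => [|g /sP ->|g /tP ->]; rewrite ?mul0r//.
  by apply: eq_fsbigr => g _; rewrite !proj_setat gprojD T_add mulrDl.
- apply/funext => w; apply/funext => d; rewrite /= /tens_act.
  have [s sP] := tens_supp (setat f i a).
  rewrite (fsum_morph (s := s) (h := fun a => ascal _ c * a)).
  + by apply: eq_fsbigr => g _; rewrite !proj_setat fr_projZ T_scale mulrA.
  + exact: mulr0.
  + by move=> x y; exact: mulrDr.
  + by move=> g /sP ->; rewrite mul0r.
- apply: (ehom_eq e); last exact: ehom_scal.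
  have : tens_hom (fun _ => 0) (tens1 N) by move=> i; rewrite ffunE; exact: fr1_hom.
  by move/ehom_T; rewrite big1.
- apply: (ehom_eq e (ehom_mul (ehom_T fh) (ehom_T fh'))).
  rewrite -[X in ehom X _]add0r -big_split; apply: ehom_mul; first exact: ehom_scal.
  by apply: ehom_T => i; rewrite ffunE; exact: fr_mul_hom.
- by apply: (ehom_eq e); [exact: ehom_S|exact: ehom_scal].
- apply: (ehom_eq e (ehom_mul (ehom_S _) (ehom_S _))).
  by rewrite addr0; exact: ehom_S.
- apply/funext => w; apply/funext => d; rewrite /= /tens_act.
  have [s sP] := tens_supp (setat f i (psi (f i))).
  rewrite (fsum_morph (s := s) (h := fun a => [eX i] * a)).
  + apply: eq_fsbigr => g _; rewrite !mulrA T_psi proj_setat psi_proj !ffunE.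
    by rewrite addrAC.
  + exact: mulr0.
  + by move=> x y; exact: mulrDr.
  + by move=> g /sP ->; rewrite mul0r.
- apply: (ehom_eq e (ehom_mul (ehom_S _) (ehom_X _))).
  by rewrite addrC; apply: ehom_mul; [exact: ehom_X|exact: ehom_S].
- apply: (ehom_eq e (ehom_mul (ehom_S _) (ehom_X _))).
  rewrite add0r; apply: ehom_add; last by apply: ehom_opp; exact: ehom_teleporter.
  by rewrite -[X in ehom X _]addr0; apply: ehom_mul; [exact: ehom_X|exact: ehom_S].
- apply: (ehom_eq e (ehom_mul (ehom_S _) (ehom_T fh))).
  apply: ehom_mul; first exact: ehom_scal.
  rewrite -[X in ehom X _]addr0; apply: ehom_mul; last exact: ehom_S.
  have : tens_hom (fun i => g (s^-1%g i)) (perm_tens s f).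
    by move=> i; rewrite ffunE; exact: fh.
  move/ehom_T; congr ehom.
  by rewrite [RHS](reindex_inj (@perm_inj _ s^-1%g)).
Qed.

Lemma ehom_class g t : ehom g t -> ahom cyc_gact g [t].
Proof.
by move=> th w d; rewrite aact_class//; [exact: cyc_gactD|exact: cyc_gactZ|exact: cyc_eactR].
Qed.

Lemma tens_dec (P : Gam -> A -> Prop) :
  (forall (g : 'I_N -> Gam) f, tens_hom g f -> P (\sum_i g i) [eT f]) ->
  forall f, exists2 L : seq (Gam * A),
    [eT f] = \sum_(y <- L) y.2 & forall y, y \in L -> P y.1 y.2.
Proof.
move=> hP.
suff H m : forall f, (forall i : 'I_N, (m <= i)%N -> exists g, ghom G g (f i)) ->
    exists2 L : seq (Gam * A),
      [eT f] = \sum_(y <- L) y.2 & forall y, y \in L -> P y.1 y.2.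
  by move=> f; apply: (H N) => i; rewrite leqNgt ltn_ord.
elim: m => [|m IHm] f fP.
  have /choice[g gP] : forall i, exists g, ghom G g (f i) by move=> i; exact: fP.
  exists [:: (\sum_i g i, [eT f])]; first by rewrite big_seq1.
  by move=> y; rewrite inE => /eqP ->; exact: hP.
have [mN|Nm] := ltnP m N; last first.
  apply: IHm => i mi; apply: fP; have := ltn_ord i.
  by rewrite ltnNge (leq_trans Nm mi).
pose i := Ordinal mN; rewrite -(setat_id f i).
elim/(ghom_ind (G := G)): (f i) => [|a b [L aE LP] [K bE KP]|g a ah].
- by exists [::] => //; rewrite big_nil T_setat0.
- exists (L ++ K); first by rewrite T_add big_cat aE bE.
  by move=> y; rewrite mem_cat => /orP[/LP|/KP].
apply: IHm => j mj; rewrite ffunE; case: eqP => [_|/eqP ji]; first by exists g.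
apply: fP; rewrite ltn_neqAle mj andbT; apply: contra ji => /eqP mj'.
by apply/eqP/val_inj.
Qed.

Lemma cyc_gdec x : exists2 L : seq (Gam * A),
  aclass (@cyc_rel n) (Gen k x) = \sum_(y <- L) y.2 &
  forall y, y \in L -> ahom cyc_gact y.1 y.2.
Proof.
case: x => [i|f|s].
- exists [:: ((wd_delta D, false), [eX i])]; first by rewrite big_seq1.
  by move=> y; rewrite inE => /eqP ->; apply: ehom_class; exact: ehom_X.
- by apply: tens_dec => g h hh; apply: ehom_class; exact: ehom_T.
- exists [:: (0, [eS s])]; first by rewrite big_seq1.
  by move=> y; rewrite inE => /eqP ->; apply: ehom_class; exact: ehom_S.
Qed.

(* The algebra on [n.+1] positions, graded by |x_i| = delta, |f_i| = |f| and  *)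
(* |s| = 0.                                                                   *)
Definition cyc_pos : superalg k :=
  pres_superalg cyc_gactD cyc_gactZ cyc_eactR cyc_gdec.

Lemma cyc_hom g t : ehom g t -> ghom (sa_gr cyc_pos) g [t].
Proof. by move=> th; apply/ahomP; exact: ehom_class. Qed.

End Grading.
End AffineWreath.

Section Cyclotomic.
Variables (k : comNzRingType) (D : wreath_data k) (C : cyclo_data D).
Local Notation F := (wd_F D).
Local Notation G := (fr_gr (wd_F D)).

Section Positions.
Variable n : nat.

Definition up (i : 'I_n) : 'I_n.+1 := lift ord_max i.

Lemma up_val i : up i = i :> nat.
Proof. by rewrite /= /bump leqNgt ltn_ord. Qed.

Lemma up_inj : injective up.
Proof. exact: lift_inj. Qed.

Lemma up_eq i j : (up i == up j) = (i == j).
Proof. exact: (inj_eq up_inj). Qed.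

Lemma up_neq_max i : (ord_max == up i) = false.
Proof. by rewrite /up (negPf (neq_lift _ _)). Qed.

Lemma upP (i : 'I_n.+1) : (i = ord_max) \/ exists j, i = up j.
Proof. by case: (unliftP ord_max i) => [j ->|->]; [right; exists j|left]. Qed.

Definition up_val_fun (T : Type) (t0 : T) (f : 'I_n -> T) (i : 'I_n.+1) : T :=
  oapp f t0 (unlift ord_max i).

Lemma up_val_funE (T : Type) (t0 : T) f i : up_val_fun t0 f (up i) = f i.
Proof. by rewrite /up_val_fun /up liftK. Qed.

Lemma up_val_fun_max (T : Type) (t0 : T) f : up_val_fun t0 f ord_max = t0.
Proof. by rewrite /up_val_fun unlift_none. Qed.

Lemma prod_up (P : pred 'I_n.+1) (E : 'I_n.+1 -> k) :
  (P ord_max -> E ord_max = 1) ->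
  \prod_(i | P i) E i = \prod_(i | P (up i)) E (up i).
Proof.
move=> E1; rewrite big_mkcond [RHS]big_mkcond big_ord_recr /=.
rewrite [X in _ * X](_ : _ = 1) ?mulr1; last by case: ifP => // /E1.
apply: eq_bigr => i _; suff -> : widen_ord (leqnSn n) i = up i by [].
by apply/val_inj; rewrite [RHS]up_val.
Qed.

Lemma sum_up (E : 'I_n.+1 -> Gam) : E ord_max = 0 ->
  \sum_i E i = \sum_i E (up i).
Proof.
move=> E1; rewrite big_ord_recr /= E1 addr0.
apply: eq_bigr => i _; suff -> : widen_ord (leqnSn n) i = up i by [].
by apply/val_inj; rewrite [RHS]up_val.
Qed.

(* f_0 (x) ... (x) f_(n-1) (x) 1 *)
Definition up_tens (f : {ffun 'I_n -> F}) : {ffun 'I_n.+1 -> F} :=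
  [ffun i => up_val_fun 1 f i].

Definition up_perm (s : 'S_n) : 'S_n.+1 := lift_perm ord_max ord_max s.

Lemma up_permE s i : up_perm s (up i) = up (s i).
Proof. exact: lift_perm_lift. Qed.

Lemma up_perm_max s : up_perm s ord_max = ord_max.
Proof. exact: lift_perm_id. Qed.

Lemma up_tensE f i : up_tens f (up i) = f i.
Proof. by rewrite ffunE up_val_funE. Qed.

Lemma up_tens_max f : up_tens f ord_max = 1.
Proof. by rewrite ffunE up_val_fun_max. Qed.

Lemma up_tens_setat f i a : up_tens (setat f i a) = setat (up_tens f) (up i) a.
Proof.
apply/ffunP => j; rewrite [RHS]ffunE; case: (upP j) => [->|[j' ->]].
  by rewrite !up_tens_max up_neq_max.
by rewrite !up_tensE ffunE up_eq.
Qed.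

Lemma up_tens1 : up_tens (tens1 D n) = tens1 D n.+1.
Proof.
apply/ffunP => j; rewrite [RHS]ffunE; case: (upP j) => [->|[j' ->]].
  by rewrite up_tens_max.
by rewrite up_tensE ffunE.
Qed.

Lemma up_tens_at_pos i a : up_tens (at_pos i a) = at_pos (up i) a.
Proof. by rewrite /at_pos up_tens_setat up_tens1. Qed.

Lemma up_tens_mul (f f' : {ffun 'I_n -> F}) : up_tens [ffun i => f i * f' i] =
  [ffun i => up_tens f i * up_tens f' i].
Proof.
apply/ffunP => j; rewrite [RHS]ffunE; case: (upP j) => [->|[j' ->]].
  by rewrite !up_tens_max mulr1.
by rewrite !up_tensE ffunE.
Qed.

Lemma up_permV s : ((up_perm s)^-1 = up_perm s^-1)%g.
Proof. by rewrite /up_perm lift_permV. Qed.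

Lemma up_tens_perm s f : up_tens (perm_tens s f) = perm_tens (up_perm s) (up_tens f).
Proof.
apply/ffunP => j; rewrite [RHS]ffunE up_permV; case: (upP j) => [->|[j' ->]].
  by rewrite up_perm_max !up_tens_max.
by rewrite up_permE !up_tensE ffunE.
Qed.

Lemma up_tperm i j : up_perm (tperm i j) = tperm (up i) (up j).
Proof.
apply/permP => l; case: (upP l) => [->|[l' ->]].
  by rewrite up_perm_max tpermD// eq_sym up_neq_max.
rewrite up_permE !permE /= !up_eq; case: ifP => // _.
by case: ifP.
Qed.

Lemma up_tens_hom g f :
  tens_hom g f -> tens_hom (up_val_fun 0 g) (up_tens f).
Proof.
move=> fh j; case: (upP j) => [->|[j' ->]].
  by rewrite up_val_fun_max up_tens_max; exact: fr1_hom.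
by rewrite up_val_funE up_tensE.
Qed.

Lemma up_mul_sign (g h : 'I_n -> Gam) :
  mul_sign k (up_val_fun 0 g) (up_val_fun 0 h) = mul_sign k g h.
Proof.
rewrite /mul_sign prod_up => [|_].
  apply: eq_bigr => i _; rewrite prod_up => [|_].
    by apply: eq_big => j; rewrite ?up_val_funE// !up_val.
  by rewrite up_val_fun_max andbF.
by rewrite big1// => j _; rewrite up_val_fun_max.
Qed.

Lemma up_perm_sign s (g : 'I_n -> Gam) :
  perm_sign k (up_perm s) (up_val_fun 0 g) = perm_sign k s g.
Proof.
rewrite /perm_sign prod_up => [|_].
  apply: eq_bigr => i _; rewrite prod_up => [|_].
    by apply: eq_big => j; rewrite ?up_val_funE// !up_permE !up_val.
  by rewrite up_val_fun_max andbF.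
by rewrite big1// => j _; rewrite up_val_fun_max.
Qed.

End Positions.

Section Inclusion.
Variable n : nat.
Local Notation B := (presalg (@cyc_rel k D C n.+1)).
Local Notation "[ t ]" := (aclass (@cyc_rel k D C n.+1) t).

Definition incl_gen (x : awp_gen D n.+1) : B :=
  match x with
  | GX i => [eX D (up i)]
  | GT f => [eT (up_tens f)]
  | GS s => [eS D (up_perm s)]
  end.

Local Notation ev := (aeval (ascal (@cyc_rel k D C n.+1)) incl_gen).

Lemma ev_teleporter (i j : 'I_n.+1) : ev (eteleporter D i j) = [eteleporter D (up i) (up j)].
Proof.
apply: (big_ind2 (fun t u => ev t = [u])) => [//|t t' u u' IHt IHu|b _].
  by rewrite aclassD /= IHt IHu.
by rewrite aclassM /= !up_tens_at_pos.
Qed.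

Lemma up_ord0 : up (ord0 : 'I_n.+1) = ord0.
Proof. by apply/val_inj; exact: up_val. Qed.

Lemma ev_chi : ev (chi C n) = [chi C n.+1].
Proof.
apply: (big_ind2 (fun t u => ev t = [u])) => [//|t t' u u' IHt IHu|m _].
  by rewrite aclassM /= IHt IHu.
apply: (big_ind2 (fun t u => ev t = [u])) => [//|t t' u u' IHt IHu|j _].
  by rewrite aclassM /= IHt IHu.
rewrite aclassD aclassN /= up_tens_at_pos up_ord0; congr (_ + _).
  by elim: m => //= m ->; rewrite aclassM up_ord0.
by rewrite (rmorphN1 (ascal _)) mulN1r.
Qed.

Lemma incl_rel t u : cyc_rel C t u -> ev t = ev u.
Proof.
case=> [|-> ->]; last first.
  by rewrite ev_chi; apply: aclass_rel; right.
have rel t' u' : awp_rel t' u' -> [t'] = [u'] by move=> tu; apply: aclass_rel; left.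
case=> {t u} [i j|f i a b|f i c a||g h f f' fh fh'||s t|f i|i i' j ii' ji ji'|i i' ii'|s g f fh] /=.
- by rewrite -!aclassM; exact/rel/rel_XX.
- by rewrite -aclassD !up_tens_setat; exact/rel/rel_TD.
- by rewrite -aclassM !up_tens_setat; exact/rel/rel_TZ.
- by rewrite up_tens1; exact/rel/rel_T1.
- rewrite -!aclassM up_tens_mul -up_mul_sign.
  by apply/rel/rel_TM; exact: up_tens_hom.
- by rewrite /up_perm lift_perm1; exact/rel/rel_S1.
- by rewrite -aclassM /up_perm -(lift_permM _ ord_max); exact/rel/rel_SM.
- by rewrite -!aclassM up_tens_setat -[f i]up_tensE; exact/rel/rel_TX.
- rewrite -!aclassM up_tperm; apply/rel/rel_SX_far; rewrite ?up_eq//.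
  by rewrite !up_val.
- rewrite ev_teleporter (rmorphN1 (ascal _)) mulN1r -aclassN -!aclassM -aclassD.
  by rewrite up_tperm; apply/rel/rel_SX; rewrite !up_val.
- rewrite -(aclassM _ (eT _)) -!aclassM up_tens_perm -up_perm_sign.
  by apply/rel/rel_ST; exact: up_tens_hom.
Qed.

Definition incl_fun : presalg (@cyc_rel k D C n) -> B :=
  alift (ascal (@cyc_rel k D C n.+1)) incl_gen.

Let scC := ascalC (R := @cyc_rel k D C n.+1).

HB.instance Definition _ :=
  GRing.isZmodMorphism.Build _ _ incl_fun (aliftB scC incl_rel).
HB.instance Definition _ :=
  GRing.isMonoidMorphism.Build _ _ incl_fun (aliftM scC incl_rel).

Lemma incl_class t : incl_fun (aclass _ t) = ev t.
Proof. exact: (alift_class scC incl_rel). Qed.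

Lemma incl_scal c : incl_fun (ascal _ c) = ascal _ c.
Proof. exact: incl_class. Qed.

Lemma incl_class_hom g t : ghom (sa_gr (cyc_pos C n.+1)) g (ev t) ->
  ghom (sa_gr (cyc_pos C n.+1)) g (incl_fun (aclass _ t)).
Proof. by rewrite incl_class. Qed.

Lemma incl_hom g a : ghom (sa_gr (cyc_pos C n)) g a ->
  ghom (sa_gr (cyc_pos C n.+1)) g (incl_fun a).
Proof.
apply: (pres_hom_graded (phi := incl_fun) (B := cyc_pos C n.+1)) => [c|x].
  exact: incl_scal.
case: x => [i|f|s].
- exists [:: ((wd_delta D, false), aclass _ (eX D i))]; first by rewrite big_seq1.
  move=> y; rewrite inE => /eqP ->; split; first by apply: ehom_class; exact: ehom_X.
  by apply: incl_class_hom; apply: cyc_hom; exact: ehom_X.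
- apply: (tens_dec (P := fun g a => ahom (cyc_gact (C := C) (n:= n)) g a /\
            ghom (sa_gr (cyc_pos C n.+1)) g (incl_fun a))) => h f' fh.
  split; first by apply: ehom_class; exact: ehom_T.
  apply: incl_class_hom; apply: cyc_hom.
  have := ehom_T (C := C) (up_tens_hom fh); congr ehom.
  rewrite sum_up ?up_val_fun_max//.
  by apply: eq_bigr => i _; rewrite up_val_funE.
- exists [:: (0, aclass _ (eS D s))]; first by rewrite big_seq1.
  move=> y; rewrite inE => /eqP ->; split; first by apply: ehom_class; exact: ehom_S.
  by apply: incl_class_hom; apply: cyc_hom; exact: ehom_S.
Qed.

Definition incl_pos : superalg_hom (cyc_pos C n) (cyc_pos C n.+1) :=
  @SuperalgHom k (cyc_pos C n) (cyc_pos C n.+1) incl_fun incl_scal incl_hom.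

End Inclusion.

Section Base.

Definition base_pr (g : Gam) (c : k) : k := if g == 0 then c else 0.

Lemma base_prB g : {morph base_pr g : x y / x - y}.
Proof. by move=> x y; rewrite /base_pr; case: ifP; rewrite ?subrr. Qed.

Lemma base_pr_dec (c : k) : exists2 L : seq (Gam * k),
  c = \sum_(x <- L) x.2 &
  forall x, x \in L -> forall g, base_pr g x.2 = if g == x.1 then x.2 else 0.
Proof.
exists [:: (0, c)]; first by rewrite big_seq1.
by move=> x; rewrite inE => /eqP ->.
Qed.

Definition base_gr : grading k := mk_grading base_prB base_pr_dec.

Lemma base_scalC (c a : k) : idfun c * a = a * idfun c.
Proof. exact: mulrC. Qed.

Lemma base_scal_hom (c : k) : ghom base_gr 0 (idfun c).
Proof. by rewrite /ghom /= /base_pr eqxx. Qed.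

Lemma base_homE g c : ghom base_gr g c -> g = 0 \/ c = 0.
Proof. by rewrite /ghom /= /base_pr; case: eqP => [|_ <-]; [left|right]. Qed.

Lemma base_mul_hom g h (a b : k) :
  ghom base_gr g a -> ghom base_gr h b -> ghom base_gr (g + h) (a * b).
Proof.
move=> /base_homE[->|->]; last by rewrite mul0r => _; exact: ghom0.
move=> /base_homE[->|->]; last by rewrite mulr0; exact: ghom0.
rewrite addr0; exact: base_scal_hom.
Qed.

Definition base_superalg : superalg k :=
  @Superalg k k idfun base_gr base_scalC base_scal_hom base_mul_hom.

Variable A : superalg k.

Lemma base_incl_hom g (c : k) :
  ghom base_gr g c -> ghom (sa_gr A) g (sa_scal A c).
Proof.
move=> /base_homE[->|->]; first exact: sa_scal_hom.
rewrite rmorph0; exact: ghom0.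
Qed.

Definition base_incl : superalg_hom base_superalg A :=
  @SuperalgHom k base_superalg A (sa_scal A) (fun _ => erefl) base_incl_hom.

End Base.

Definition cyc_alg (n : nat) : superalg k :=
  if n is m.+1 then cyc_pos C m else base_superalg.

(* x_i |-> x_i, f |-> f (x) 1, s |-> s *)
Definition cyc_incl (n : nat) : superalg_hom (cyc_alg n) (cyc_alg n.+1) :=
  match n with
  | 0 => base_incl (cyc_alg 1)
  | m.+1 => incl_pos m
  end.

Definition cyc_ind (n : nat) : smfunctor (cyc_alg n) (cyc_alg n.+1) :=
  ind_functor (cyc_incl n).

Definition cyc_res (n : nat) : smfunctor (cyc_alg n.+1) (cyc_alg n) :=
  res_functor (cyc_incl n).

End Cyclotomic.

Definition has_char (R : nzRingType) (p : nat) : Prop :=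
  forall m : nat, (m%:R = 0 :> R) <-> (p %| m)%N.

(* Main.v *)
Require Import Defs.
From HB Require Import structures.
From mathcomp Require Import all_boot all_order all_fingroup all_algebra.
From mathcomp Require Import boolp functions.
Set Implicit Arguments.
Unset Strict Implicit.
Unset Printing Implicit Defensive.
Import GRing.Theory.
Local Open Scope ring_scope.

(** Write A_n for the cyclotomic algebra on [n] positions and [d] for the level.
    The functor Res Ind on A_(n+1)-modules is tensoring with A_(n+2), seen as a
    bimodule over A_(n+1), and the theorem describes this bimodule.

    The core is that A_(n+1) is free as a right A_n-module, with basis
    w_j b x^a: here w_j runs over representatives of the cosets of S_n in
    S_(n+1), [b] over the basis [B] placed on the last position, [x] is the last
    polynomial generator and [a < d] ([basis_surj], [basis_inj]).  To see this, a
    module for the affine algebra on [n+1] positions is built from scratch: its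
    vectors are families, indexed by the w_j, of polynomials in [b] and [x] with
    coefficients in A_n.  It is the module induced from the parabolic subalgebra
    acting on F[x] (x) A_n.  The only operators that are hard to define on it are
    those of the polynomial generators.  Their relations with S_n become
    transparent once a Jucys-Murphy element is subtracted: the differences
    z_i are simply permuted by S_n ([covariant_sub_jucys]), which dictates
    their action on each component; adding the Jucys-Murphy elements back gives
    the x_i, and their commutativity follows by symmetry from the last
    component ([ind_XC]).

    On this module the cyclotomic polynomial [chi] vanishes on all components but
    the first, since it vanishes in A_n.  So the sum [chi_sum] of its
    conjugates acts on every component as a polynomial of degree [d] in [x] whose
    leading coefficient is a power of [psi], hence invertible.  Its image is a
    submodule ([chi_image_eval]), long division by it leaves unique remainders of
    degree less than [d] ([div_exists], [div_unique]), and A_(n+1) acts on the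
    quotient ([ev_cong]).  Comparing this quotient with A_(n+1) by evaluating
    polynomials in one direction, and by acting on the vector 1 in the other,
    yields the basis ([total_sum_surj], [total_sum_inj]).

    For the theorem let [s] be the transposition of the last two of the [n+2]
    positions.  The elements b x^a on the last position commute with
    A_(n+1) up to the sign determined by the parity of [b], so that
    m |-> b x^a (x) m embeds a copy of the identity functor or of the parity
    shift for each of the [d] exponents and each [b].  Since [s] commutes with A_n,
    u (x) m |-> u s (x) m is a natural map from Ind Res to Res Ind.  These maps
    together form an isomorphism: [basis_swap] shows that a basis element of
    A_(n+1) times [s] is one of the basis elements of A_(n+2) with w_j different
    from 1, modulo right combinations of the b x^a, so that the matrix of the sum
    of these maps is unitriangular ([mackey_sum_coords]).  The degree shifts
    of the summands undo the degrees of the b x^a. *)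

(** * The endomorphism ring of a module *)

Section Endo.
Variables (k : comNzRingType) (V : lmodType k).

Record endo := Endo { endo_fun :> V -> V; endo_lin : linear endo_fun }.

Lemma endo_eq (a b : endo) : a =1 b -> a = b.
Proof.
case: a b => [a aB] [b bB] /= /funext ab; subst b.
by rewrite (Prop_irrelevance aB bB).
Qed.

HB.instance Definition _ := gen_eqMixin endo.
HB.instance Definition _ := gen_choiceMixin endo.

Lemma endoD (a : endo) x y : a (x + y) = a x + a y.
Proof. by have := endo_lin a 1 x y; rewrite !scale1r. Qed.

Lemma endo0 (a : endo) : a 0 = 0.
Proof. by apply: (addIr (a 0)); rewrite -endoD !add0r. Qed.

Lemma endoZ (a : endo) c x : a (c *: x) = c *: a x.
Proof. by have := endo_lin a c x 0; rewrite endo0 !addr0. Qed.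

Lemma endoN (a : endo) x : a (- x) = - a x.
Proof. by rewrite -scaleN1r endoZ scaleN1r. Qed.

Lemma endoB (a : endo) x y : a (x - y) = a x - a y.
Proof. by rewrite endoD endoN. Qed.

Lemma endo_sum (a : endo) I (r : seq I) P (f : I -> V) :
  a (\sum_(i <- r | P i) f i) = \sum_(i <- r | P i) a (f i).
Proof. by apply: big_morph; [exact: endoD | exact: endo0]. Qed.

Let add_fun (a b : endo) x := a x + b x.
Let opp_fun (a : endo) x := - a x.
Let mul_fun (a b : endo) x := a (b x).

Let scal_fun c (x : V) := c *: x.

Lemma endo_add_subproof a b : linear (add_fun a b).
Proof. by move=> c x y; rewrite /add_fun !endo_lin scalerDr addrACA. Qed.
Lemma endo_opp_subproof a : linear (opp_fun a).
Proof. by move=> c x y; rewrite /opp_fun endo_lin opprD scalerN. Qed.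
Lemma endo_mul_subproof a b : linear (mul_fun a b).
Proof. by move=> c x y; rewrite /mul_fun !endo_lin. Qed.
Lemma endo_zero_subproof : linear (fun _ : V => 0 : V).
Proof. by move=> c x y; rewrite scaler0 addr0. Qed.
Lemma endo_one_subproof : linear (id : V -> V).
Proof. by []. Qed.
Lemma endo_scal_subproof c : linear (scal_fun c).
Proof. by move=> d x y; rewrite /scal_fun scalerDr !scalerA mulrC. Qed.

Definition endo_add a b := Endo (@endo_add_subproof a b).
Definition endo_opp a := Endo (@endo_opp_subproof a).
Definition endo_mul a b := Endo (@endo_mul_subproof a b).
Definition endo_zero := Endo endo_zero_subproof.
Definition endo_one := Endo endo_one_subproof.
Definition endo_scal c := Endo (endo_scal_subproof c).

Lemma endo_addA : associative endo_add.
Proof. by move=> a b c; apply: endo_eq => x; exact: addrA. Qed.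
Lemma endo_addC : commutative endo_add.
Proof. by move=> a b; apply: endo_eq => x; exact: addrC. Qed.
Lemma endo_add0 : left_id endo_zero endo_add.
Proof. by move=> a; apply: endo_eq => x; exact: add0r. Qed.
Lemma endo_addN : left_inverse endo_zero endo_opp endo_add.
Proof. by move=> a; apply: endo_eq => x; exact: addNr. Qed.

HB.instance Definition _ :=
  GRing.isZmodule.Build endo endo_addA endo_addC endo_add0 endo_addN.

Lemma endo_mulA : associative endo_mul.
Proof. by move=> a b c; apply: endo_eq. Qed.
Lemma endo_mul1 : left_id endo_one endo_mul.
Proof. by move=> a; apply: endo_eq. Qed.
Lemma endo_mulr1 : right_id endo_one endo_mul.
Proof. by move=> a; apply: endo_eq. Qed.
Lemma endo_mulDl : left_distributive endo_mul endo_add.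
Proof. by move=> a b c; apply: endo_eq. Qed.
Lemma endo_mulDr : right_distributive endo_mul endo_add.
Proof. by move=> a b c; apply: endo_eq => x; exact: endoD. Qed.

HB.instance Definition _ := GRing.Zmodule_isPzRing.Build endo
  endo_mulA endo_mul1 endo_mulr1 endo_mulDl endo_mulDr.

Lemma endo_addE (a b : endo) x : (a + b) x = a x + b x. Proof. by []. Qed.
Lemma endo_subE (a b : endo) x : (a - b) x = a x - b x. Proof. by []. Qed.
Lemma endo_mulE (a b : endo) x : (a * b) x = a (b x). Proof. by []. Qed.
Lemma endo_oneE x : (1 : endo) x = x. Proof. by []. Qed.

Lemma endo_scalB : {morph endo_scal : c d / c - d}.
Proof. by move=> c d; apply: endo_eq => x; exact: scalerBl. Qed.
Lemma endo_scalM : monoid_morphism endo_scal.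
Proof. by split=> [|c d]; apply: endo_eq => x /=; rewrite /scal_fun ?scale1r ?scalerA. Qed.

HB.instance Definition _ := GRing.isZmodMorphism.Build k endo endo_scal endo_scalB.
HB.instance Definition _ := GRing.isMonoidMorphism.Build k endo endo_scal endo_scalM.

Lemma endo_scalE c x : endo_scal c x = c *: x. Proof. by []. Qed.

Lemma endo_scalC c (a : endo) : endo_scal c * a = a * endo_scal c.
Proof. by apply: endo_eq => x; rewrite !endo_mulE !endo_scalE endoZ. Qed.

Lemma endo_sumE I (r : seq I) P (a : I -> endo) x :
  (\sum_(i <- r | P i) a i) x = \sum_(i <- r | P i) a i x.
Proof. by apply: (big_morph (fun a : endo => a x)). Qed.

End Endo.

(** * Dual bases *)

Section Frobenius.
Variables (k : comNzRingType) (D : wreath_data k).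
Local Notation F := (wd_F D).
Local Notation G := (fr_gr (wd_F D)).
Local Notation tr := (fr_tr (wd_F D)).
Local Notation B := (wd_B D).
Local Notation Bv := (wd_Bv D).
Local Notation dg := (wd_deg D).

Lemma B_expand v : v = \sum_b tr (Bv b * v) *: B b.
Proof.
have [c [vE _]] := wd_B_basis v; rewrite {1}vE; apply: eq_bigr => b _.
congr (_ *: _); rewrite vE mulr_sumr linear_sum (bigD1 b)//= big1 => [|b' bb'].
  by rewrite -scalerAr linearZ /= wd_BvP eqxx mulr1 addr0.
by rewrite -scalerAr linearZ /= wd_BvP eq_sym (negPf bb') mulr0.
Qed.

(** Nondegeneracy on one side is part of the structure; the Nakayama automorphism
    carries it to the other side, homogeneous component by component. *)
Lemma nondegl (u : F) : (forall x, tr (u * x) = 0) -> u = 0.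
Proof.
move=> u0; have u0p g : G g u = 0.
  set v := G g u; have vh : ghom G g v by exact: ghom_gproj.
  have v0 h x : ghom G h x -> tr (v * x) = 0.
    move=> xh; have [gh|gh] := eqVneq (g + h) ((wd_delta D, false) : Gam); last first.
      exact: tr_hom (fr_mul_hom vh xh) gh.
    have -> : v = G ((wd_delta D, false) - h) u by rewrite -gh addrK.
    by rewrite -(tr_projl _ xh).
  apply: psi_inj; apply: (nondegr_hom (psi_hom vh)) => e x xh.
  apply: (mulrz_sign_eq0 (b := g.2 && e.2)); rewrite -(tr_psi vh xh).
  exact: v0 xh.
by have [s _ ->] := gproj_fin G u; rewrite big1.
Qed.

Lemma Bv_expand v : v = \sum_b tr (v * B b) *: Bv b.
Proof.
apply/eqP; rewrite -subr_eq0; apply/eqP; apply: nondegl => x.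
rewrite (B_expand x) mulr_sumr linear_sum big1// => c _.
rewrite -scalerAr linearZ /= mulrBl linearB /= mulr_suml linear_sum (bigD1 c)//=.
rewrite big1 => [|b bc]; rewrite -scalerAl linearZ /= wd_BvP.
  by rewrite eqxx mulr1 addr0 subrr mulr0.
by rewrite (negPf bc) mulr0.
Qed.

Lemma tr_parity g f : ghom G g f -> g.2 -> tr f = 0.
Proof. by case: g => d [] fh // _; exact: fr_tr_even fh. Qed.

Lemma dual_parity b : ((wd_delta D, false) - dg b : Gam).2 = (dg b).2.
Proof. by case: (dg b) => d []. Qed.

End Frobenius.

(** * Representations of wreath products and of affine wreath products *)

Section WreathReps.
Variables (k : comNzRingType) (D : wreath_data k).
Local Notation F := (wd_F D).
Local Notation G := (fr_gr (wd_F D)).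
Local Notation tr := (fr_tr (wd_F D)).
Local Notation psi := (wd_psi D).
Local Notation B := (wd_B D).
Local Notation Bv := (wd_Bv D).
Local Notation dg := (wd_deg D).

(** The algebra [F^(x)N # S_N] through its single sites: the sign rule then
    involves pairs of homogeneous elements only, instead of all inversions of a
    tensor.  The reversal in [wSM] reflects that a product of permutations
    composes from left to right. *)
Record wreath_rep (N : nat) (E : pzRingType) (sc : k -> E) := WreathRep {
  wT : 'I_N -> F -> E;
  wS : 'S_N -> E;
  wTD : forall i f g, wT i (f + g) = wT i f + wT i g;
  wTZ : forall i c f, wT i (c *: f) = sc c * wT i f;
  wT1 : forall i, wT i 1 = 1;
  wTM : forall i f g, wT i (f * g) = wT i f * wT i g;
  wTC : forall i j g h f f', i != j -> ghom G g f -> ghom G h f' ->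
    wT i f * wT j f' = (-1) ^+ (g.2 && h.2) * (wT j f' * wT i f);
  wS1 : wS 1%g = 1;
  wSM : forall s t, wS (s * t)%g = wS t * wS s;
  wST : forall s i f, wS s * wT i f = wT (s i) f * wS s }.

Definition tele N E sc (r : @wreath_rep N E sc) i j : E :=
  \sum_b wT r i (B b) * wT r j (Bv b).

Record affine_rep (N : nat) (E : pzRingType) (sc : k -> E) := AffineRep {
  aw :> @wreath_rep N E sc;
  aX : 'I_N -> E;
  aXC : forall i j, aX i * aX j = aX j * aX i;
  aTX : forall i j f, wT aw i f * aX j = aX j * wT aw i (if i == j then psi f else f);
  aSX_far : forall i i' j : 'I_N, i' = i.+1 :> nat -> j != i -> j != i' ->
    wS aw (tperm i i') * aX j = aX j * wS aw (tperm i i');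
  aSX : forall i i' : 'I_N, i' = i.+1 :> nat ->
    wS aw (tperm i i') * aX i = aX i' * wS aw (tperm i i') - tele aw i i' }.

Section Wreath.
Variables (N : nat) (E : pzRingType) (sc : {rmorphism k -> E}).
Hypothesis scC : forall c a, sc c * a = a * sc c.
Variable r : @wreath_rep N E sc.
Local Notation T := (wT r).
Local Notation S := (wS r).
Local Notation t := (tele r).
Implicit Types (i j l : 'I_N) (s : 'S_N).

Lemma sc_sign c (b : bool) : sc (c *~ (-1) ^+ b) = (-1) ^+ b * sc c.
Proof. by case: b; rewrite /= ?expr1 ?expr0 ?mulrN1z ?mulr1z ?rmorphN ?mulN1r ?mul1r. Qed.

Lemma wT0 i : T i 0 = 0.
Proof. by rewrite -(scale0r 0) wTZ rmorph0 mul0r. Qed.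

Lemma wT_sum i J (q : seq J) P (f : J -> F) :
  T i (\sum_(b <- q | P b) f b) = \sum_(b <- q | P b) T i (f b).
Proof. by apply: big_morph; [exact: wTD | exact: wT0]. Qed.

Lemma wS_tperm2 i j : S (tperm i j) * S (tperm i j) = 1.
Proof. by rewrite -wSM tperm2 wS1. Qed.

Lemma wS_invr s : S s * S s^-1%g = 1.
Proof. by rewrite -wSM mulVg wS1. Qed.

Lemma tele_perm s i j : S s * t i j = t (s i) (s j) * S s.
Proof.
rewrite mulr_sumr mulr_suml; apply: eq_bigr => b _.
by rewrite mulrA wST -mulrA wST mulrA.
Qed.

(** The two factors of each summand of the teleporter have equal parities, so
    that it is even. *)
Lemma tele_far l i j f : l != i -> l != j -> T l f * t i j = t i j * T l f.
Proof.
move=> li lj; rewrite mulr_sumr mulr_suml; apply: eq_bigr => b _.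
elim/(ghom_ind (G := G)): f => [|f f' IHf IHf'|g f fh].
- by rewrite wT0 mul0r mulr0.
- by rewrite wTD mulrDl mulrDr IHf IHf'.
rewrite mulrA (wTC r li fh (wd_B_hom b)) -!mulrA (wTC r lj fh (Bv_hom b)).
rewrite dual_parity 2!mulrA -commr_sign -!mulrA; congr (_ * _).
by rewrite mulrA -signr_addb addbb expr0 mul1r.
Qed.

(** Expanding [f b] in the basis and [c^vee f] in the dual basis produces the same
    coefficients tr(c^vee f b) on both sides. *)
Lemma tele_left i j f : T i f * t i j = t i j * T j f.
Proof.
rewrite mulr_sumr mulr_suml.
transitivity (\sum_b \sum_c sc (tr (Bv c * (f * B b))) * (T i (B c) * T j (Bv b))).
  apply: eq_bigr => b _.
  rewrite mulrA -wTM [in LHS](B_expand (f * B b)) wT_sum mulr_suml.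
  by apply: eq_bigr => c _; rewrite wTZ -mulrA.
rewrite exchange_big; apply: eq_bigr => c _ /=.
rewrite -[RHS]mulrA -wTM [in RHS](Bv_expand (Bv c * f)) wT_sum mulr_sumr.
by apply: eq_bigr => b _; rewrite wTZ !mulrA scC.
Qed.

(** As for [tele_left]; the coefficients tr(f b^vee c) and tr(b^vee c psi(f)) now
    agree by the definition of the Nakayama automorphism. *)
Lemma tele_right i j f : i != j -> T j f * t i j = t i j * T i (psi f).
Proof.
move=> ij; have ji : j != i by rewrite eq_sym.
elim/(ghom_ind (G := G)): f => [|f f' IHf IHf'|g f fh].
- by rewrite linear0 !wT0 mul0r mulr0.
- by rewrite linearD /= !wTD mulrDl mulrDr IHf IHf'.
rewrite mulr_sumr mulr_suml.
transitivity (\sum_b \sum_c (-1) ^+ (g.2 && (dg b).2) *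
    (sc (tr (f * Bv b * B c)) * (T i (B b) * T j (Bv c)))).
  apply: eq_bigr => b _; rewrite mulrA (wTC r ji fh (wd_B_hom b)) -2!mulrA -wTM.
  rewrite [in LHS](Bv_expand (f * Bv b)) wT_sum !mulr_sumr.
  by apply: eq_bigr => c _; rewrite wTZ !mulrA -(mulrA _ (T i _) (sc _)) -scC !mulrA.
rewrite exchange_big; apply: eq_bigr => c _ /=.
rewrite -[RHS]mulrA (wTC r ji (Bv_hom c) (psi_hom fh)) dual_parity.
rewrite mulrA commr_sign -mulrA [T i _ * (T i _ * _)]mulrA -wTM.
rewrite [in RHS](B_expand (B c * psi f)) wT_sum mulr_suml mulr_sumr.
apply: eq_bigr => b _; have bch := fr_mul_hom (Bv_hom b) (wd_B_hom c).
rewrite wTZ -[f * _ * _]mulrA (tr_psi fh bch) sc_sign -[Bv b * B c * psi f]mulrA.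
set u := sc _; rewrite -!mulrA [LHS]mulrA -signr_addb.
congr ((-1) ^+ nat_of_bool _ * _).
by case: (g) (dg b) (dg c) => ? [] [? []] [? []].
Qed.

(** Expanding psi(b^vee) in the basis, the definition of the Nakayama automorphism
    makes its coordinates, up to sign, those of the dual basis vectors; resumming
    over [b] exchanges the members of each pair. *)
Lemma tele_psi i j : i != j -> \sum_b T i (B b) * T j (psi (Bv b)) = t j i.
Proof.
move=> ij.
transitivity (\sum_b \sum_c sc (tr (Bv c * psi (Bv b))) * (T i (B b) * T j (B c))).
  apply: eq_bigr => b _; rewrite [in LHS](B_expand (psi (Bv b))) wT_sum mulr_sumr.
  by apply: eq_bigr => c _; rewrite wTZ mulrA -scC -mulrA.
rewrite exchange_big; apply: eq_bigr => c _ /=.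
have ji : j != i by rewrite eq_sym.
rewrite (wTC r ji (wd_B_hom c) (Bv_hom c)) dual_parity [in RHS](B_expand (Bv c)).
rewrite wT_sum mulr_suml mulr_sumr; apply: eq_bigr => b _.
rewrite wTZ (tr_psi (Bv_hom b) (Bv_hom c)) sc_sign dual_parity andbb dual_parity.
have [bc|bc] := eqVneq (dg b).2 (dg c).2.
  by rewrite bc andbb -!mulrA [RHS]mulrA -signr_addb addbb expr0 mul1r.
rewrite (tr_parity (fr_mul_hom (Bv_hom c) (psi_hom (Bv_hom b)))).
  by rewrite !rmorph0 !(mulr0, mul0r).
by move: bc => /=; case: (dg b) (dg c) => ? [] [? []].
Qed.

(** The teleporter times the transposition of its two positions: it is
    permuted by the symmetric group and twists by [psi] the action of [F] in
    its second position, exactly as the polynomial generator there does. *)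
Definition swap_tele i j : E := t i j * S (tperm i j).
Local Notation Y := swap_tele.

Lemma swap_tele_perm s i j : S s * Y i j = Y (s i) (s j) * S s.
Proof.
rewrite /Y mulrA tele_perm -!mulrA -!wSM; congr (_ * S _).
by rewrite -tpermJ conjgE !mulgA mulgV mul1g.
Qed.

Lemma swap_tele_T i j l f : i != j ->
  T l f * Y i j = Y i j * T l (if l == j then psi f else f).
Proof.
move=> ij; rewrite /Y mulrA -[RHS]mulrA wST.
have [->|lj] := eqVneq l j; first by rewrite tpermR tele_right// mulrA.
have [->|li] := eqVneq l i; first by rewrite tpermL tele_left mulrA.
by rewrite tpermD 1?eq_sym// tele_far// mulrA.
Qed.

(** The Jucys-Murphy element of position [i], with the transposition [(l, i)]
    replaced by the swapping teleporter. *)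
Definition jucys i : E := \sum_(l : 'I_N | (l < i)%N) Y l i.
Local Notation J := jucys.

Lemma jucys_T i l f : T l f * J i = J i * T l (if l == i then psi f else f).
Proof.
rewrite mulr_sumr mulr_suml; apply: eq_bigr => m mi; apply: swap_tele_T.
by rewrite -(inj_eq val_inj) neq_ltn mi.
Qed.

Lemma jucys_perm s i : S s * J i = (\sum_(l : 'I_N | (s^-1%g l < i)%N) Y l (s i)) * S s.
Proof.
rewrite mulr_sumr mulr_suml (reindex_inj (@perm_inj _ s^-1%g)) /=.
by apply: eq_bigr => l _; rewrite swap_tele_perm permKV.
Qed.

Section Adjacent.
Variables l l' : 'I_N.
Hypothesis ll' : l' = l.+1 :> nat.

Lemma tperm_lt i m : i != l -> i != l' -> (tperm l l' m < i)%N = (m < i)%N.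
Proof.
move=> il il'; have e : (l' < i)%N = (l < i)%N.
  rewrite [RHS]leq_eqVlt -ll' -[_ == _]/(l' == i) eq_sym (negPf il') orFb.
  by rewrite ltn_neqAle ll'.
by case: tpermP => [->|->|//].
Qed.

Lemma tperm_lt_low m : (tperm l l' m < l)%N = (m < l)%N.
Proof.
have e : (l' < l)%N = false by apply/negbTE; rewrite -leqNgt ll' leqnSn.
by case: tpermP => [->|->|//]; rewrite e ltnn.
Qed.

Lemma jucys_far i : i != l -> i != l' ->
  S (tperm l l') * J i = J i * S (tperm l l').
Proof.
move=> il il'; rewrite jucys_perm tpermD 1?eq_sym//; congr (_ * _).
by apply: eq_bigl => m; rewrite tpermV tperm_lt.
Qed.

Lemma jucys_high : J l' = \sum_(m : 'I_N | (m < l)%N) Y m l' + Y l l'.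
Proof.
rewrite /J (bigD1 l) /=; last by rewrite ll'.
rewrite addrC; congr (_ + _); apply: eq_bigl => m.
by rewrite ll' ltnS leq_eqVlt (inj_eq val_inj); case: eqVneq => [->|]; rewrite ?ltnn ?andbT.
Qed.

Lemma jucys_adj : S (tperm l l') * J l = J l' * S (tperm l l') - t l l'.
Proof.
rewrite jucys_perm tpermL jucys_high mulrDl -[t l l']mulr1 -(wS_tperm2 l l') mulrA.
rewrite addrK; congr (_ * _).
by apply: eq_bigl => m; rewrite tpermV tperm_lt_low.
Qed.

End Adjacent.

End Wreath.

Lemma adjacent_ind N (P : 'S_N -> Prop) : P 1%g ->
  (forall s u, P s -> P u -> P (s * u)%g) ->
  (forall i i' : 'I_N, i' = i.+1 :> nat -> P (tperm i i')) -> forall s, P s.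
Proof.
move=> P1 PM Padj.
have Ptp d : forall i j : 'I_N, j = (i + d.+1)%N :> nat -> P (tperm i j).
  elim: d => [|d IHd] i j ij; first by apply: Padj; rewrite ij addn1.
  have lt_i : (i.+1 < N)%N by rewrite (leq_trans _ (ltn_ord j))// ij addnS ltnS leq_addr.
  pose m := Ordinal lt_i.
  have mi : m != i by rewrite -(inj_eq val_inj) /= neq_ltn ltnS leqnn orbT.
  have ji : j != i by rewrite -(inj_eq val_inj) /= ij -[X in _ != X]addn0 eqn_add2l.
  have Pim : P (tperm i m) by exact: Padj.
  have mj : m != j.
    by rewrite -(inj_eq val_inj) /= ij -[X in X != _]addn1 eqn_add2l.
  have -> : tperm i j = (tperm i m * (tperm m j * tperm i m))%g.
    have := tpermJ m j (tperm i m); rewrite conjgE tpermV tpermR.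
    by rewrite (tpermD _ mj) 1?eq_sym// => ->.
  by apply: (PM) => //; apply: (PM) => //; apply: IHd; rewrite ij /= addSnnS.
have Ptp' i j : P (tperm i j).
  have [ij|ji|/val_inj ->] := ltngtP i j; last by rewrite tperm1.
    by apply: (Ptp (j - i).-1); rewrite prednK ?subn_gt0// subnKC// ltnW.
  by rewrite tpermC; apply: (Ptp (i - j).-1); rewrite prednK ?subn_gt0// subnKC// ltnW.
move=> s; have [ts -> _] := prod_tpermP s.
by elim: ts => [|u ts IHts]; rewrite ?big_nil// big_cons; apply: PM.
Qed.

End WreathReps.

(** * Covariant elements *)

Section AffineTheory.
Variables (k : comNzRingType) (D : wreath_data k).
Local Notation psi := (wd_psi D).
Variables (N : nat) (E : pzRingType) (sc : {rmorphism k -> E}).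
Hypothesis scC : forall c a, sc c * a = a * sc c.
Variable r : @wreath_rep k D N E sc.
Local Notation T := (wT r).
Local Notation S := (wS r).
Local Notation t := (tele r).
Local Notation J := (jucys r).
Implicit Types (i j l : 'I_N) (s : 'S_N).

Definition covariant (z : 'I_N -> E) := forall s i, S s * z i = z (s i) * S s.

Section Shifted.
Variable z : 'I_N -> E.
Hypothesis zS : covariant z.
Hypothesis zT : forall i j f, T i f * z j = z j * T i (if i == j then psi f else f).
Let x i := z i + J i.

(** Adding the Jucys-Murphy elements to covariant elements that twist [F] produces
    every defining relation of the affine algebra except commutativity. *)
Lemma shifted_T i j f : T i f * x j = x j * T i (if i == j then psi f else f).
Proof. by rewrite mulrDr mulrDl zT (jucys_T scC). Qed.

Lemma shifted_far i i' j : i' = i.+1 :> nat -> j != i -> j != i' ->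
  S (tperm i i') * x j = x j * S (tperm i i').
Proof.
by move=> ii' ji ji'; rewrite mulrDr mulrDl zS tpermD 1?eq_sym// jucys_far.
Qed.

Lemma shifted_adj i i' : i' = i.+1 :> nat ->
  S (tperm i i') * x i = x i' * S (tperm i i') - t i i'.
Proof. by move=> ii'; rewrite mulrDr mulrDl zS tpermL jucys_adj// addrA. Qed.

End Shifted.

Section Affine.
Variable x : 'I_N -> E.
Hypothesis xT : forall i j f, T i f * x j = x j * T i (if i == j then psi f else f).
Hypothesis xS_far : forall i i' j, i' = i.+1 :> nat -> j != i -> j != i' ->
  S (tperm i i') * x j = x j * S (tperm i i').
Hypothesis xS : forall i i', i' = i.+1 :> nat ->
  S (tperm i i') * x i = x i' * S (tperm i i') - t i i'.

Lemma xS_high i i' : i' = i.+1 :> nat ->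
  S (tperm i i') * x i' = x i * S (tperm i i') + t i' i.
Proof.
move=> ii'; have s2 := wS_tperm2 r i i'.
have -> : x i' = S (tperm i i') * x i * S (tperm i i') + t i i' * S (tperm i i').
  by rewrite xS// mulrBl -mulrA s2 mulr1 subrK.
rewrite mulrDr !mulrA s2 mul1r; congr (_ + _).
by rewrite tele_perm tpermL tpermR -mulrA s2 mulr1.
Qed.

(** The defining relations between polynomial generators and transpositions say
    that subtracting the Jucys-Murphy elements makes the generators
    covariant. *)
Lemma covariant_sub_jucys : covariant (fun i => x i - J i).
Proof.
move=> s; elim/adjacent_ind: s => [i|s u IHs IHu i|l l' ll' i].
- by rewrite wS1 perm1 mul1r mulr1.
- by rewrite wSM -mulrA IHs mulrA IHu permM mulrA.
have s2 := wS_tperm2 r l l'.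
case: tpermP => [->|->|/eqP il /eqP il'].
- by rewrite mulrBr xS// jucys_adj// opprB addrA subrK mulrBl.
- have -> : J l' = S (tperm l l') * J l * S (tperm l l') + t l l' * S (tperm l l').
    by rewrite jucys_adj// mulrBl -mulrA s2 mulr1 subrK.
  rewrite mulrBr xS_high// mulrDr !mulrA s2 mul1r tele_perm tpermL tpermR.
  by rewrite -[t l' l * _ * _]mulrA s2 mulr1 mulrBl opprD addrACA subrr addr0.
- by rewrite mulrBr mulrBl xS_far// jucys_far.
Qed.

(** Moving a polynomial generator past a permutation costs Jucys-Murphy elements
    only, which involve no polynomial generator. *)
Lemma x_mul_S s i : x i * S s = S s * (x (s^-1%g i) - J (s^-1%g i)) + J i * S s.
Proof. by rewrite covariant_sub_jucys permKV mulrBl subrK. Qed.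

Lemma tele_x_far i j l : l != i -> l != j -> t i j * x l = x l * t i j.
Proof.
move=> li lj; rewrite mulr_suml mulr_sumr; apply: eq_bigr => b _.
by rewrite -mulrA xT eq_sym (negPf lj) mulrA xT eq_sym (negPf li) mulrA.
Qed.

Lemma tele_x i j : i != j -> t i j * x j = x j * t j i.
Proof.
move=> ij; rewrite mulr_suml -(tele_psi scC r ij) mulr_sumr; apply: eq_bigr => b _.
by rewrite -mulrA xT eqxx mulrA xT (negPf ij) mulrA.
Qed.

(** The [x_i] are not permuted by the symmetric group, but their commutators are:
    the correction terms cancel by [tele_x]. *)
Lemma comm_perm s i j :
  S s * (x i * x j - x j * x i) = (x (s i) * x (s j) - x (s j) * x (s i)) * S s.
Proof.
elim/adjacent_ind: s i j => [i j|s u IHs IHu i j|l l' ll' i j].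
- by rewrite wS1 !perm1 mul1r mulr1.
- by rewrite wSM -mulrA IHs mulrA IHu !permM mulrA.
have ln : l != l' by rewrite -(inj_eq val_inj) /= ll' neq_ltn leqnn.
have ln' : l' != l by rewrite eq_sym.
pose s := S (tperm l l').
have main : s * (x l * x l' - x l' * x l) = (x l' * x l - x l * x l') * s.
  rewrite mulrBr mulrBl !mulrA; congr (_ - _); rewrite /s.
    by rewrite xS// mulrBl -mulrA xS_high// mulrDr (tele_x ln) mulrA addrK.
  by rewrite xS_high// mulrDl -mulrA xS// mulrBr (tele_x ln') mulrA subrK.
have side m : m != l -> m != l' -> forall i, i = l \/ i = l' ->
    s * (x i * x m - x m * x i) =
    (x (tperm l l' i) * x m - x m * x (tperm l l' i)) * s.
  move=> ml ml' h [->|->]; rewrite /s mulrBr mulrBl !mulrA.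
    rewrite tpermL xS// (xS_far ll' ml ml') mulrBl -!mulrA xS// (xS_far ll' ml ml').
    by rewrite mulrBr (tele_x_far ml ml') !mulrA opprB addrA subrK.
  rewrite tpermR xS_high// (xS_far ll' ml ml') mulrDl -!mulrA xS_high//.
  rewrite (xS_far ll' ml ml') mulrDr (tele_x_far ml' ml) !mulrA.
  by rewrite opprD addrACA subrr addr0.
have opp a b (e f : E) : s * (x a * x b - x b * x a) = (e - f) * s ->
    s * (x b * x a - x a * x b) = (f - e) * s.
  by move=> h; rewrite -opprB mulrN h -mulNr opprB.
have [il|il] := boolP (i \in [:: l; l']); have [jl|jl] := boolP (j \in [:: l; l']).
- move: il jl; rewrite !inE => /orP[]/eqP -> /orP[]/eqP ->;
    rewrite ?tpermL ?tpermR ?subrr ?mulr0 ?mul0r//.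
  exact: opp main.
- move: il jl; rewrite !inE negb_or => il /andP[jl jl'].
  rewrite [tperm l l' j]tpermD 1?eq_sym//; apply: side => //.
  by case/orP: il => /eqP; [left|right].
- move: il jl; rewrite !inE negb_or => /andP[il il'] jl.
  rewrite [tperm l l' i]tpermD 1?eq_sym//; apply: opp; apply: side => //.
  by case/orP: jl => /eqP; [left|right].
- move: il jl; rewrite !inE !negb_or => /andP[il il'] /andP[jl jl'].
  rewrite !tpermD 1?eq_sym// mulrBr mulrBl !mulrA.
  by rewrite !xS_far// -!mulrA !xS_far.
Qed.

End Affine.
End AffineTheory.

(** * Reordering products of supercommuting elements *)

Section OrderedProducts.
Variable E : pzRingType.

Lemma prod_sign I (s : seq I) (P : pred I) (F : I -> bool) :
  \prod_(i <- s | P i) (-1) ^+ F i = (-1) ^+ (\sum_(i <- s | P i) F i)%N :> E.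
Proof.
by elim/big_rec2: _ => [|i y1 y2 _ ->]; rewrite ?expr0// exprD.
Qed.

Lemma move_prod I (s : seq I) (P : pred I) (a : E) (C : I -> E) (b : I -> bool) :
  (forall i, P i -> a * C i = (-1) ^+ b i * (C i * a)) ->
  a * \prod_(i <- s | P i) C i =
  (-1) ^+ (\sum_(i <- s | P i) b i)%N * (\prod_(i <- s | P i) C i * a).
Proof.
move=> aC; elim: s => [|i s IHs]; first by rewrite !big_nil mulr1 mul1r expr0 mul1r.
rewrite !big_cons; case: ifP => // Pi.
rewrite mulrA aC// -!mulrA IHs exprD -!mulrA; congr (_ * _).
by rewrite [LHS]mulrA commr_sign -!mulrA.
Qed.

Section Ordinal.
Variable n : nat.

Lemma prod_split (x : nat) (P : pred 'I_n) (B : 'I_n -> E) :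
  \prod_(i | P i) B i =
  \prod_(i | P i && (i < x)%N) B i * \prod_(i | P i && (x <= i)%N) B i.
Proof.
elim: n P B => [|m IHm] P B; first by rewrite !big_ord0 mulr1.
rewrite !(big_mkcond (fun i => P i && _)) (big_mkcond P) !big_ord_recr /=.
rewrite -!big_mkcond (IHm (fun i => P (widen_ord (leqnSn m) i))).
case: (ltnP m x) => mx.
  rewrite andbT andbF mulr1 [X in _ * X * _]big_pred0 ?mulr1; last first.
    by move=> i; rewrite (leqNgt x) (ltn_trans (ltn_ord i) mx) andbF.
  rewrite [X in _ = _ * X]big_pred0 ?mulr1//.
  by move=> i; rewrite (leqNgt x) (ltn_trans (ltn_ord i) mx) andbF.
by rewrite andbF andbT mulr1 mulrA.
Qed.

Lemma prod_split3 (x : 'I_n) (P : pred 'I_n) (B : 'I_n -> E) : P x ->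
  \prod_(i | P i) B i =
  \prod_(i | P i && (i < x)%N) B i * (B x * \prod_(i | P i && (x < i)%N) B i).
Proof.
move=> Px; rewrite (prod_split x); congr (_ * _); rewrite (prod_split x.+1).
rewrite (eq_bigl (pred1 x)) ?big_pred1_eq => [|i]; last first.
  rewrite /= ltnS -andbA -eqn_leq eq_sym (inj_eq val_inj).
  by case: eqVneq => [->|]; rewrite ?Px// andbF.
congr (_ * _); apply: eq_bigl => i; rewrite -andbA; congr (_ && _).
by apply: andb_idl; exact: ltnW.
Qed.

End Ordinal.

Lemma prod_super_mul n (A A' : 'I_n -> E) (p q : 'I_n -> bool) :
  (forall i j, i != j -> A i * A' j = (-1) ^+ (p i && q j) * (A' j * A i)) ->
  (\prod_i A i) * (\prod_i A' i) =
  (-1) ^+ (\sum_(i < n) \sum_(j < n | (j < i)%N) (p i && q j))%N * \prod_i (A i * A' i).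
Proof.
elim: n A A' p q => [|n IHn] A A' p q AA'; first by rewrite !big_ord0 !mulr1.
pose w := widen_ord (leqnSn n).
have w_inj i j : (w i == w j) = (i == j) by rewrite -!(inj_eq val_inj).
have mw j : ord_max != w j by rewrite -(inj_eq val_inj) /= neq_ltn ltn_ord orbT.
rewrite !big_ord_recr /= -/w.
transitivity ((\prod_i A (w i)) * (A ord_max * \prod_i A' (w i)) * A' ord_max).
  by rewrite !mulrA.
rewrite (@move_prod _ _ _ _ _ (fun j => p ord_max && q (w j))) => [|j _]; last exact: AA'.
rewrite [X in X * _]mulrA [X in X * _ * _]commr_sign -!mulrA [X in _ * X]mulrA.
rewrite (IHn _ _ (p \o w) (q \o w)) => [|i j ij]; last by apply: AA'; rewrite w_inj.
rewrite -!mulrA [LHS]mulrA -exprD addnC; congr ((-1) ^+ (_ + _)%N * _).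
  apply: eq_bigr => i _; rewrite [RHS]big_mkcond big_ord_recr /= -big_mkcond /=.
  by rewrite ltnNge ltnW//= addn0.
by rewrite [RHS]big_mkcond big_ord_recr /= ltnn addn0; apply: eq_bigr => j _; rewrite ltn_ord.
Qed.

Section Reorder.
Variables (n : nat) (B : 'I_n -> E) (q : 'I_n -> bool).
Hypothesis BB : forall i j, i != j -> B i * B j = (-1) ^+ (q i && q j) * (B j * B i).

Fixpoint odd_inversions (r : seq 'I_n) : nat :=
  if r is x :: r' then
    (odd_inversions r' + \sum_(y | (y \in r') && (y < x)) (q x && q y))%N
  else 0%N.

(** Insertion sort: by induction the tail is sorted, and the head has to pass the
    smaller entries. *)
Lemma prod_reorder (r : seq 'I_n) : uniq r ->
  \prod_(i <- r) B i = (-1) ^+ odd_inversions r * \prod_(i | i \in r) B i.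
Proof.
elim: r => [_|x r IHr /= /andP[xr ur]].
  by rewrite big_nil expr0 mul1r big_pred0.
rewrite big_cons (IHr ur) (prod_split x) (@prod_split3 _ x _ _ (mem_head x r)).
have low : \prod_(i | (i \in x :: r) && (i < x)%N) B i =
    \prod_(i | (i \in r) && (i < x)%N) B i.
  by apply: eq_bigl => i; rewrite inE; case: eqVneq => [->|//]; rewrite ltnn !andbF.
have high : \prod_(i | (i \in x :: r) && (x < i)%N) B i =
    \prod_(i | (i \in r) && (x <= i)%N) B i.
  apply: eq_bigl => i; rewrite inE; case: eqVneq => [->|ix] /=.
    by rewrite ltnn (negPf xr).
  by rewrite (leq_eqVlt x) (inj_eq val_inj) eq_sym (negPf ix).
rewrite low high [LHS]mulrA commr_sign -mulrA [B x * _]mulrA.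
rewrite [B x * \prod_(i in r | _) _](@move_prod _ _ _ _ _ (fun y => q x && q y))
  => [|y /andP[yr _]]; last first.
  by apply: BB; apply: contraNneq xr => ->.
by rewrite exprD -!mulrA.
Qed.

Lemma odd_inversions_map (s : 'S_n) (l : seq 'I_n) :
  pairwise (fun i j : 'I_n => (i < j)%N) l ->
  odd_inversions (map s l) =
  (\sum_(i <- l) \sum_(j | [&& j \in l, i < j & s j < s i]) (q (s i) && q (s j)))%N.
Proof.
elim: l => [|x l IHl] /=; first by rewrite big_nil.
move=> /andP[/allP xl sl]; rewrite big_cons addnC (IHl sl); congr (_ + _)%N.
  rewrite (reindex_inj (@perm_inj _ s)); apply: eq_bigl => j.
  rewrite (mem_map (@perm_inj _ s)) inE; case: eqVneq => [->|_] /=.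
    by rewrite !ltnn andbF.
  by case jl: (j \in l) => //=; rewrite (xl _ jl).
rewrite !big_seq; apply: eq_bigr => i /xl il; apply: eq_bigl => j.
rewrite inE; case: eqVneq => [->|//]; rewrite (ltnNge i x) (ltnW il) /=.
by rewrite andbF.
Qed.

Lemma prod_perm (s : 'S_n) : \prod_i B (s i) =
  (-1) ^+ (\sum_(i < n) \sum_(j < n | (i < j) && (s j < s i)) (q (s i) && q (s j)))%N *
  \prod_i B i.
Proof.
transitivity (\prod_(i <- map s (index_enum 'I_n)) B i); first by rewrite big_map.
rewrite prod_reorder ?map_inj_uniq ?index_enum_uniq//; last exact: perm_inj.
rewrite odd_inversions_map; last first.
  rewrite /index_enum /= -enumT.
  have : pairwise ltn (map val (enum 'I_n)).
    by rewrite val_enum_ord -sorted_pairwise; [exact: iota_ltn_sorted|exact: ltn_trans].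
  by rewrite pairwise_map.
congr ((-1) ^+ _ * _).
  by apply: eq_bigr => i _; apply: eq_bigl => j; rewrite mem_index_enum.
apply: eq_bigl => i; apply/mapP; exists (s^-1%g i); first exact: mem_index_enum.
by rewrite permKV.
Qed.

End Reorder.
End OrderedProducts.

(** * From single-site relations to the presentation, and back *)

Section Evaluation.
Variables (k : comNzRingType) (D : wreath_data k).
Local Notation F := (wd_F D).
Variables (N : nat) (E : pzRingType) (sc : {rmorphism k -> E}).
Hypothesis scC : forall c a, sc c * a = a * sc c.
Variable A : @affine_rep k D N E sc.
Local Notation T := (wT A).
Local Notation S := (wS A).
Local Notation X := (aX A).

Definition tens_prod (f : {ffun 'I_N -> F}) : E := \prod_i T i (f i).

Definition rep_gen (x : awp_gen D N) : E :=
  match x with GX i => X i | GT f => tens_prod f | GS s => S s end.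

Local Notation ev := (aeval sc rep_gen).

Lemma tens_prod_setat f i : exists L R : E,
  forall a, tens_prod (setat f i a) = L * (T i a * R).
Proof.
exists (\prod_(j < N | (j < i)%N) T j (f j)), (\prod_(j < N | (i < j)%N) T j (f j)).
move=> a; rewrite /tens_prod (@prod_split3 _ _ i)//= ffunE eqxx.
congr (_ * (_ * _)); apply: eq_bigr => j; rewrite ffunE.
  by case: eqVneq => [->|//]; rewrite ltnn.
by case: eqVneq => [->|//]; rewrite ltnn.
Qed.

Lemma tens_prod_at i a : tens_prod (at_pos i a) = T i a.
Proof.
rewrite /tens_prod (@prod_split3 _ _ i)//= ffunE eqxx !big1 ?mulr1 ?mul1r// => j ji.
  by rewrite ffunE; case: eqVneq ji => [->|]; rewrite ?ltnn// ffunE wT1.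
by rewrite ffunE; case: eqVneq ji => [->|]; rewrite ?ltnn// ffunE wT1.
Qed.

Lemma ev_tele i j : ev (eteleporter D i j) = tele A i j.
Proof.
rewrite /eteleporter /tele; elim/big_rec2: _ => /= [|b y1 y2 _ ->].
  by rewrite rmorph0.
by rewrite !tens_prod_at.
Qed.

Lemma sc_prod_sign (b : 'I_N -> 'I_N -> bool) (P : 'I_N -> 'I_N -> bool) :
  sc (\prod_(i < N) \prod_(j < N | P i j) (-1) ^+ b i j) =
  (-1) ^+ (\sum_(i < N) \sum_(j < N | P i j) b i j)%N.
Proof.
rewrite rmorph_prod; under eq_bigr do rewrite prod_sign rmorph_sign.
by elim/big_rec2: _ => [|i y1 y2 _ ->]; rewrite ?expr0// exprD.
Qed.

Lemma tens_prod_mul (g h : 'I_N -> Gam) f f' : tens_hom g f -> tens_hom h f' ->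
  tens_prod f * tens_prod f' = sc (mul_sign k g h) * tens_prod [ffun i => f i * f' i].
Proof.
move=> fg fh.
rewrite /tens_prod (@prod_super_mul _ _ _ _ (fun i => (g i).2) (fun j => (h j).2)).
  congr (_ * _); last by apply: eq_bigr => i _; rewrite ffunE wTM.
  by rewrite -sc_prod_sign.
by move=> i j ij; exact: (wTC A ij (fg i) (fh j)).
Qed.

Lemma tens_prod_perm s (g : 'I_N -> Gam) f : tens_hom g f ->
  S s * tens_prod f = sc (perm_sign k s g) * (tens_prod (perm_tens s f) * S s).
Proof.
move=> fg; transitivity ((\prod_i T (s i) (f i)) * S s).
  rewrite /tens_prod; elim/big_rec2: _ => [|i y1 y2 _ IH]; first by rewrite mulr1 mul1r.
  by rewrite mulrA wST -mulrA IH mulrA.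
rewrite mulrA; congr (_ * _).
pose B j := T j (f (s^-1%g j)).
transitivity (\prod_i B (s i)); first by apply: eq_bigr => i _; rewrite /B permK.
rewrite (@prod_perm _ _ B (fun j => (g (s^-1%g j)).2)) => [|i j ij]; last first.
  exact: (wTC A ij (fg _) (fg _)).
congr (_ * _); last by apply: eq_bigr => i _; rewrite ffunE.
rewrite -sc_prod_sign; congr (sc _).
by apply: eq_bigr => i _; apply: eq_bigr => j _; rewrite !permK.
Qed.

(** The relations of the presentation, whose signs run over all pairs of sites,
    follow from the single-site relations. *)
Lemma ev_awp t u : awp_rel t u -> ev t = ev u.
Proof.
case=> {t u} [i j|f i a b|f i c a||g h f f' fh fh'||s t|f i|i i' j ii' ji ji'|i i' ii'|s g f fh] /=.
- exact: aXC.
- by have [L [R e]] := tens_prod_setat f i; rewrite !e wTD mulrDl mulrDr.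
- have [L [R e]] := tens_prod_setat f i.
  by rewrite !e wTZ [RHS]mulrA [in RHS]scC -!mulrA.
- by rewrite /tens_prod big1 ?rmorph1// => i _; rewrite ffunE wT1.
- exact: tens_prod_mul.
- by rewrite wS1 rmorph1.
- by rewrite wSM.
- rewrite /tens_prod.
  under [in RHS]eq_bigr do rewrite ffunE.
  elim/big_rec2: _ => [|j y1 y2 _ IH]; first by rewrite mulr1 mul1r.
  rewrite -mulrA IH mulrA aTX -mulrA; congr (_ * (T j _ * _)).
  by case: eqP => // ->.
- exact: aSX_far.
- by rewrite ev_tele (rmorphN1 sc) mulN1r aSX.
- exact: tens_prod_perm.
Qed.

End Evaluation.

Section PresentedRep.
Variables (k : comNzRingType) (D : wreath_data k) (C : cyclo_data D).
Local Notation F := (wd_F D).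
Local Notation G := (fr_gr (wd_F D)).
Local Notation psi := (wd_psi D).
Variable n : nat.
Local Notation N := n.+1.
Local Notation A := (cyc_pos C n).
Local Notation "[ t ]" := (aclass (@cyc_rel k D C n) t : cyc_pos C n).
Local Notation sc := (sa_scal A).
Implicit Types (i j : 'I_N) (f : F).

Let rel t u : awp_rel t u -> [t] = [u].
Proof. by move=> tu; apply: aclass_rel; left. Qed.

Let T i f : A := [eT (at_pos i f)].

Let T_D i f (g : F) : T i (f + g) = T i f + T i g.
Proof. exact: T_add. Qed.

Let T_Z i c f : T i (c *: f) = sc c * T i f.
Proof. exact: T_scale. Qed.

Let T_0 i : T i 0 = 0.
Proof. exact: T_setat0. Qed.

Lemma at_pos1 i : at_pos i 1 = tens1 D N.
Proof. by apply/ffunP => j; rewrite !ffunE; case: eqP. Qed.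

Let T_1 i : T i 1 = 1.
Proof. by rewrite /T at_pos1 (rel (rel_T1 D N)); exact: (rmorph1 sc). Qed.

Lemma mul_sign_at i j (g h : 'I_N -> Gam) :
  (forall l, l != i -> (g l).2 = false) -> (forall l, l != j -> (h l).2 = false) ->
  mul_sign k g h = (-1) ^+ ((j < i)%N && ((g i).2 && (h j).2)).
Proof.
move=> g0 h0; rewrite /mul_sign (bigD1 i)//= [X in _ * X]big1 ?mulr1 => [|l li].
  case: ltnP => [ji|ij]; last first.
    rewrite big1//= => l li; rewrite (h0 l) ?andbF//.
    by apply: contraTneq li => ->; rewrite -leqNgt.
  by rewrite (bigD1 j)//= big1 ?mulr1// => l /andP[_ lj]; rewrite (h0 l) ?andbF.
by rewrite big1// => m _; rewrite g0.
Qed.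

Let T_T i j g h f f' : ghom G g f -> ghom G h f' ->
  T i f * T j f' = (-1) ^+ ((j < i)%N && (g.2 && h.2)) *
    [eT [ffun l => at_pos i f l * at_pos j f' l]].
Proof.
move=> fg fh.
have := rel (rel_TM (at_pos_hom i fg) (at_pos_hom j fh)).
rewrite !aclassM (@mul_sign_at i j) ?eqxx => [->|l /negPf ->|l /negPf ->]//.
by congr (_ * _); exact: (rmorph_sign sc).
Qed.

Let T_M i f (g : F) : T i (f * g) = T i f * T i g.
Proof.
elim/(ghom_ind (G := G)): f => [|f f' IHf IHf'|d f fd].
- by rewrite mul0r T_0 mul0r.
- by rewrite mulrDl !T_D mulrDl IHf IHf'.
elim/(ghom_ind (G := G)): g => [|g g' IHg IHg'|e g ge].
- by rewrite mulr0 T_0 mulr0.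
- by rewrite mulrDr !T_D mulrDr IHg IHg'.
rewrite (T_T _ _ fd ge) ltnn /= mul1r; congr [eT _].
by apply/ffunP => j; rewrite !ffunE; case: eqP => // _; rewrite mulr1.
Qed.

Let T_C i j g h f f' : i != j -> ghom G g f -> ghom G h f' ->
  T i f * T j f' = (-1) ^+ (g.2 && h.2) * (T j f' * T i f).
Proof.
move=> ij fg fh; rewrite (T_T _ _ fg fh) (T_T _ _ fh fg) mulrA -signr_addb.
congr ((-1) ^+ nat_of_bool _ * [eT _]).
  move: ij; rewrite -(inj_eq val_inj) neq_ltn /= => /orP[] lt;
    by rewrite lt ltnNge (ltnW lt); case: g.2; case: h.2.
apply/ffunP => l; rewrite !ffunE; case: eqP => [->|_]; last by rewrite mulr1 mul1r.
by rewrite (negPf ij) mulr1 mul1r.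
Qed.

Let T_S s i f : [eS D s] * T i f = T (s i) f * [eS D s].
Proof.
elim/(ghom_ind (G := G)): f => [|f f' IHf IHf'|d f fd].
- by rewrite !T_0 mul0r mulr0.
- by rewrite !T_D mulrDr mulrDl IHf IHf'.
rewrite /T -!aclassM (rel (rel_ST s (at_pos_hom i fd))) !aclassM.
rewrite [X in aclass _ (Scal _ X)](_ : _ = 1).
  rewrite [X in X * _](rmorph1 (ascal _)) mul1r; congr (aclass _ (eT _) * _).
  apply/ffunP => j; rewrite !ffunE; congr (if _ then _ else _).
  by rewrite -(inj_eq (@perm_inj _ s)) permKV.
rewrite /perm_sign big1// => l _; rewrite big1// => j /andP[lj _].
case: eqP lj => [->|//]; case: eqP => [->|_ _]; first by rewrite ltnn.
by rewrite andbF.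
Qed.

Let S_1 : [eS D 1%g] = 1.
Proof. by rewrite (rel (rel_S1 D N)); exact: (rmorph1 sc). Qed.

Let S_M s t : [eS D (s * t)%g] = [eS D t] * [eS D s].
Proof. by rewrite -aclassM; exact/esym/rel/rel_SM. Qed.

Definition cyc_wreath : @wreath_rep k D N A sc :=
  WreathRep T_D T_Z T_1 T_M T_C S_1 S_M T_S.

Lemma aclass_tele i j : [eteleporter D i j] = tele cyc_wreath i j.
Proof.
rewrite /eteleporter /tele; elim/big_rec2: _ => [|b y1 y2 _ <-]; first exact: (rmorph0 sc).
by rewrite aclassD aclassM.
Qed.

Let X_C i j : [eX D i] * [eX D j] = [eX D j] * [eX D i].
Proof. by rewrite -!aclassM; exact/rel/rel_XX. Qed.

Let T_X i j f : T i f * [eX D j] = [eX D j] * T i (if i == j then psi f else f).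
Proof.
rewrite /T [LHS]T_psi; congr (_ * [eT _]).
apply/ffunP => l; rewrite !ffunE; case: eqP => [->|lj].
  by rewrite eq_sym; case: eqP => // _; rewrite rmorph1.
by case: eqP => // li; case: eqP => // ij; rewrite li ij in lj.
Qed.

Let S_X_far i i' j : i' = i.+1 :> nat -> j != i -> j != i' ->
  [eS D (tperm i i')] * [eX D j] = [eX D j] * [eS D (tperm i i')].
Proof. by move=> ii' ji ji'; rewrite -!aclassM; exact/rel/rel_SX_far. Qed.

Let S_X i i' : i' = i.+1 :> nat ->
  [eS D (tperm i i')] * [eX D i] =
  [eX D i'] * [eS D (tperm i i')] - tele cyc_wreath i i'.
Proof.
move=> ii'; rewrite -aclass_tele -!aclassM -aclassN -aclassD; exact/rel/rel_SX.
Qed.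

Definition cyc_affine : @affine_rep k D N A sc :=
  @AffineRep k D N A sc cyc_wreath (fun i => [eX D i]) X_C T_X S_X_far S_X.

Let tensP (f : {ffun 'I_N -> F}) := [eT f] = tens_prod cyc_affine f.

Let tens_hom_prod (g : 'I_N -> Gam) (f : {ffun 'I_N -> F}) : tens_hom g f -> tensP f.
Proof.
move=> fg; suff H m : (m <= N)%N ->
    [eT [ffun i : 'I_N => if (i < m)%N then f i else 1]] =
    \prod_(i < N | (i < m)%N) T i (f i).
  have := H N (leqnn N); rewrite /tensP /tens_prod => e.
  rewrite -[RHS]/(\prod_(i < N) T i (f i)) (eq_bigl (fun i : 'I_N => (i < N)%N)).
    by rewrite -e; congr [eT _]; apply/ffunP => i; rewrite ffunE ltn_ord.
  by move=> i; rewrite ltn_ord.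
elim: m => [|m IHm] mN.
  by rewrite big_pred0// -[RHS](T_1 ord0) /T at_pos1.
pose i := Ordinal mN; rewrite (@prod_split _ _ m).
rewrite [X in _ * X](eq_bigl (pred1 i)) => [|j]; last first.
  by rewrite /= ltnS -eqn_leq -(inj_eq val_inj).
rewrite big_pred1_eq [X in X * _](eq_bigl (fun j : 'I_N => (j < m)%N)) => [|j]; last first.
  by apply: andb_idl => jm; rewrite ltnS ltnW.
rewrite -(IHm (ltnW mN)).
have gh : tens_hom (fun j : 'I_N => if (j < m)%N then g j else 0)
    [ffun j : 'I_N => if (j < m)%N then f j else 1].
  by move=> j; rewrite ffunE; case: ifP => // _; exact: fr1_hom.
have := rel (rel_TM gh (at_pos_hom i (fg i))).
rewrite !aclassM /T => ->; rewrite (_ : mul_sign _ _ _ = 1).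
  rewrite [X in X * _](rmorph1 (ascal _)) mul1r; congr [eT _]; apply/ffunP => j.
  rewrite !ffunE ltnS leq_eqVlt -[(j : nat) == m]/(j == i).
  by case: eqVneq => [->|ji]; rewrite ?ltnn ?mul1r ?mulr1.
rewrite /mul_sign big1// => j _; rewrite big1// => l lj.
case: eqP lj => [->|_ _]; last by rewrite andbF.
by rewrite /= ltnNge; case: (ltnP j m) => //= jm; rewrite (ltnW jm).
Qed.

(** The relation for products of tensors concerns homogeneous tensors; by
    multilinearity the factors are decomposed one after the other. *)
Lemma eT_prod (f : {ffun 'I_N -> F}) : [eT f] = tens_prod cyc_affine f.
Proof.
suff H m : forall f : {ffun 'I_N -> F},
    (forall i : 'I_N, (m <= i)%N -> exists g, ghom G g (f i)) -> tensP f.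
  by apply: (H N) => i; rewrite leqNgt ltn_ord.
elim: m => [|m IHm] {}f fP.
  have /choice[g gP] : forall i, exists g, ghom G g (f i) by move=> i; exact: fP.
  exact: (tens_hom_prod gP).
have [mN|Nm] := ltnP m N; last first.
  apply: IHm => i mi; apply: fP; have := ltn_ord i.
  by rewrite ltnNge (leq_trans Nm mi).
pose i := Ordinal mN; rewrite -(setat_id f i).
have [L [R e]] := tens_prod_setat cyc_affine f i.
elim/(ghom_ind (G := G)): (f i) => [|a b aP bP|g a ah].
- by rewrite /tensP T_setat0 e wT0 mul0r mulr0.
- by rewrite /tensP T_add e wTD mulrDl mulrDr -!e aP bP.
apply: IHm => j mj; rewrite ffunE; case: eqP => [_|/eqP ji]; first by exists g.
apply: fP; rewrite ltn_neqAle mj andbT; apply: contra ji => /eqP mj'.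
by apply/eqP/val_inj.
Qed.

(** Hence the presented algebra is accessible through [cyc_affine] alone. *)
Lemma aclass_eval t : [t] = aeval sc (rep_gen cyc_affine) t.
Proof.
elim: t => [c|[i|f|s]|t IHt u IHu|t IHt u IHu] //=.
- exact: eT_prod.
- by rewrite aclassD IHt IHu.
- by rewrite aclassM IHt IHu.
Qed.

End PresentedRep.

(** * The induced module *)

(** The algebra as a [k]-module, so that [endo] applies to what is built from it. *)
Definition kmod (k : comNzRingType) (A : superalg k) : Type := A.

Section KModule.
Variables (k : comNzRingType) (A : superalg k).

HB.instance Definition _ := GRing.Zmodule.on (kmod A).

Let scale (c : k) (a : kmod A) : kmod A := sa_scal A c * (a : A).

Let scaleA c d a : scale c (scale d a) = scale (c * d) a.
Proof. by rewrite /scale rmorphM mulrA. Qed.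
Let scale1 : left_id 1 scale.
Proof. by move=> a; rewrite /scale rmorph1 mul1r. Qed.
Let scaleDr : right_distributive scale +%R.
Proof. by move=> c x y; exact: mulrDr. Qed.
Let scaleDl a : {morph scale^~ a : c d / c + d}.
Proof. by move=> c d; rewrite /scale rmorphD mulrDl. Qed.

HB.instance Definition _ := GRing.Zmodule_isLmodule.Build k (kmod A)
  scaleA scale1 scaleDr scaleDl.

Lemma kmod_scaleE c (a : kmod A) : c *: a = sa_scal A c * (a : A) :> A.
Proof. by []. Qed.

End KModule.

Section Restrictions.
Variable n : nat.
Implicit Types (s t : 'S_n.+1) (i j : 'I_n.+1).

Let res_fun s j (l : 'I_n) : 'I_n := odflt l (unlift (s j) (s (lift j l))).

Let lift_res_fun s j l : lift (s j) (res_fun s j l) = s (lift j l).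
Proof.
rewrite /res_fun; case: unliftP => [l' ->//|].
by move/perm_inj/eqP; rewrite eq_sym (negPf (neq_lift _ _)).
Qed.

Let res_fun_inj s j : injective (res_fun s j).
Proof.
move=> l l' e; apply: (@lift_inj _ j); apply: (@perm_inj _ s).
by rewrite -!lift_res_fun e.
Qed.

(** The permutation of the remaining points induced by [s] when [j] is deleted
    from its domain and [s j] from its codomain, both renumbered in order. *)
Definition perm_del s j : 'S_n := perm (@res_fun_inj s j).

Lemma lift_perm_del s j l : lift (s j) (perm_del s j l) = s (lift j l).
Proof. by rewrite permE lift_res_fun. Qed.

Lemma perm_del_mul s t j : perm_del (s * t)%g j = (perm_del s j * perm_del t (s j))%g.
Proof.
apply/permP => l; apply: (@lift_inj _ ((s * t)%g j)).
by rewrite lift_perm_del !permM !lift_perm_del.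
Qed.

Lemma perm_del1 j : perm_del 1 j = 1%g.
Proof.
apply/permP => l; apply: (@lift_inj _ j).
by have := lift_perm_del 1 j l; rewrite !perm1.
Qed.

Lemma perm_del_up (s : 'S_n) : perm_del (up_perm s) ord_max = s.
Proof.
apply/permP => l; apply: (@lift_inj _ ord_max).
by have := lift_perm_del (up_perm s) ord_max l; rewrite up_perm_max up_permE.
Qed.

(** The cycle moving [j] to the last position, keeping the order of the other
    points. *)
Definition to_last j : 'S_n.+1 := lift_perm j ord_max 1.

Lemma to_last_id j : to_last j j = ord_max.
Proof. exact: lift_perm_id. Qed.

Lemma to_last_lift j l : to_last j (lift j l) = up l.
Proof. by rewrite /to_last lift_perm_lift perm1. Qed.

Lemma to_last_max : to_last ord_max = 1%g.
Proof. exact: lift_perm1. Qed.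

Lemma to_last_perm s j i : to_last (s j) (s i) = up_perm (perm_del s j) (to_last j i).
Proof.
case: (unliftP j i) => [l ->|->]; last by rewrite !to_last_id up_perm_max.
by rewrite -lift_perm_del !to_last_lift up_permE.
Qed.

End Restrictions.

Section CyclotomicReps.
Variables (k : comNzRingType) (D : wreath_data k) (C : cyclo_data D).

Definition chi_at N (E : pzRingType) (sc : k -> E) (A : @affine_rep k D N E sc) i : E :=
  \prod_(1 <= m < (wd_theta D).+1) \prod_(1 <= j < (cy_e C m).+1)
     (aX A i ^+ m - wT A i (cy_c C m j)).

(** An interface common to the cyclotomic algebras and to the ground ring, which
    plays their part on no position: the step from [n] to [n.+1] positions can
    then be made for all [n] at once. *)
Record cyc_rep (n : nat) (Q : superalg k) := CycRep {
  cr_rep :> @affine_rep k D n Q (sa_scal Q);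
  cr_X_hom : forall i, ghom (sa_gr Q) (wd_delta D, false) (aX cr_rep i);
  cr_T_hom : forall i g f, ghom (fr_gr (wd_F D)) g f ->
    ghom (sa_gr Q) g (wT cr_rep i f);
  cr_S_hom : forall s, ghom (sa_gr Q) 0 (wS cr_rep s);
  cr_ind : forall P : Q -> Prop, (forall c, P (sa_scal Q c)) ->
    (forall i, P (aX cr_rep i)) -> (forall i f, P (wT cr_rep i f)) ->
    (forall s, P (wS cr_rep s)) -> (forall a b, P a -> P b -> P (a + b)) ->
    (forall a b, P a -> P b -> P (a * b)) -> forall a, P a;
  cr_chi : forall i : 'I_n, i = 0%N :> nat -> chi_at cr_rep i = 0 }.

End CyclotomicReps.

Section InducedModule.
Variables (k : comNzRingType) (D : wreath_data k) (C : cyclo_data D).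
Local Notation F := (wd_F D).
Local Notation G := (fr_gr (wd_F D)).
Local Notation tr := (fr_tr (wd_F D)).
Local Notation psi := (wd_psi D).
Local Notation B := (wd_B D).
Local Notation Bv := (wd_Bv D).
Local Notation dg := (wd_deg D).
Local Notation I := (wd_I D).
Variables (n : nat) (Q : superalg k).
Local Notation sc := (sa_scal Q).
Variable A : cyc_rep C n Q.

Lemma psgn_X i : psgn (sa_gr Q) (aX A i) = aX A i.
Proof. by rewrite (psgn_hom (cr_X_hom A i)). Qed.

Lemma psgn_S s : psgn (sa_gr Q) (wS A s) = wS A s.
Proof. by rewrite (psgn_hom (cr_S_hom A s)). Qed.

Lemma psgn_T i g f : ghom G g f ->
  psgn (sa_gr Q) (wT A i f) = (-1) ^+ g.2 * wT A i f.
Proof.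
by move=> fg; rewrite (psgn_hom (cr_T_hom A i fg)); case: g.2; rewrite ?mul1r ?mulN1r.
Qed.

(** Finite order makes the inverse a power, whence a homomorphism that preserves
    degrees and parities. *)
Definition psi_inv (f : F) : F := iter (wd_theta D).-1 psi f.

Lemma psi_invK f : psi_inv (psi f) = f.
Proof. by rewrite /psi_inv -iterSr prednK ?wd_theta_gt0// wd_psi_theta. Qed.

Lemma psiK f : psi (psi_inv f) = f.
Proof. by rewrite /psi_inv -iterS prednK ?wd_theta_gt0// wd_psi_theta. Qed.

Lemma psi_inv_lin : linear psi_inv.
Proof.
move=> c f g; rewrite /psi_inv; elim: (_.-1) => //= m ->.
by rewrite linearP.
Qed.

Lemma psi_inv_hom g f : ghom G g f -> ghom G g (psi_inv f).
Proof. by move=> fg; rewrite /psi_inv; elim: (_.-1) => //= m; exact: psi_hom. Qed.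

Lemma psi_invM f g : psi_inv (f * g) = psi_inv f * psi_inv g.
Proof. by rewrite /psi_inv; elim: (_.-1) => //= m ->; rewrite rmorphM. Qed.

(** ** Operators on [F[x] (x) Q] *)

(* [phi m b] stands for the coefficient of [b x^m], written on the right.  All
   families of coefficients are allowed; polynomials are singled out later. *)
Local Notation Y := (nat -> I -> kmod Q).

(** What becomes of [a] in [Q] when it passes [b]. *)
Definition sgn_pass (b : I) (a : Q) : Q := if (dg b).2 then psgn (sa_gr Q) a else a.

Lemma sgn_passM b a a' : sgn_pass b (a * a') = sgn_pass b a * sgn_pass b a'.
Proof. by rewrite /sgn_pass; case: ifP => // _; exact: psgnM. Qed.
Lemma sgn_pass1 b : sgn_pass b 1 = 1.
Proof. by rewrite /sgn_pass; case: ifP => // _; exact: psgn1. Qed.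
Lemma sgn_passD b a a' : sgn_pass b (a + a') = sgn_pass b a + sgn_pass b a'.
Proof. by rewrite /sgn_pass; case: ifP => // _; exact: psgnD. Qed.
Lemma sgn_pass_scal b c : sgn_pass b (sc c) = sc c.
Proof.
by rewrite /sgn_pass; case: ifP => // _; rewrite (psgn_hom (sa_scal_hom Q c)).
Qed.
Lemma sgn_pass_X b i : sgn_pass b (aX A i) = aX A i.
Proof. by rewrite /sgn_pass; case: ifP => // _; exact: psgn_X. Qed.
Lemma sgn_pass_S b s : sgn_pass b (wS A s) = wS A s.
Proof. by rewrite /sgn_pass; case: ifP => // _; exact: psgn_S. Qed.
Lemma sgn_pass_T b i g f : ghom G g f ->
  sgn_pass b (wT A i f) = (-1) ^+ ((dg b).2 && g.2) * wT A i f.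
Proof.
by move=> fg; rewrite /sgn_pass; case: ifP => _ /=; [exact: psgn_T | rewrite mul1r].
Qed.

Definition lmul_fun (a : Q) (phi : Y) : Y := fun m b => sgn_pass b a * (phi m b : Q).

Lemma lmul_lin a : linear (lmul_fun a).
Proof.
move=> c x y; apply/funext => m; apply/funext => b; rewrite /lmul_fun.
rewrite -[(c *: x + y) m b]/(c *: x m b + y m b).
rewrite -[RHS]/(c *: (sgn_pass b a * (x m b : Q) : kmod Q) + sgn_pass b a * (y m b : Q)).
by rewrite !kmod_scaleE mulrDr !mulrA sa_scalC.
Qed.

Definition lmul a : endo Y := Endo (lmul_lin a).

Lemma lmulE a phi m b : lmul a phi m b = sgn_pass b a * (phi m b : Q).
Proof. by []. Qed.

Lemma lmulD a a' : lmul (a + a') = lmul a + lmul a'.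
Proof.
apply: endo_eq => x; apply/funext => m; apply/funext => b.
by rewrite lmulE sgn_passD mulrDl.
Qed.

Lemma lmulM a a' : lmul (a * a') = lmul a * lmul a'.
Proof.
apply: endo_eq => x; apply/funext => m; apply/funext => b.
by rewrite endo_mulE !lmulE sgn_passM mulrA.
Qed.

Lemma lmul1 : lmul 1 = 1.
Proof.
apply: endo_eq => x; apply/funext => m; apply/funext => b.
by rewrite lmulE sgn_pass1 mul1r.
Qed.

Lemma lmul0 : lmul 0 = 0.
Proof. by apply: (addIr (lmul 0)); rewrite -lmulD !add0r. Qed.

Lemma lmulN a : lmul (- a) = - lmul a.
Proof. by apply/eqP; rewrite -addr_eq0 -lmulD addNr lmul0. Qed.

Lemma lmul_sum J (r : seq J) P (a : J -> Q) :
  lmul (\sum_(i <- r | P i) a i) = \sum_(i <- r | P i) lmul (a i).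
Proof. by apply: big_morph; [exact: lmulD | exact: lmul0]. Qed.

Lemma lmul_sign (b : bool) a : lmul ((-1) ^+ b * a) = (-1) ^+ b * lmul a.
Proof. by case: b; rewrite ?expr1 ?expr0 ?mulN1r ?mul1r// lmulN. Qed.

Lemma lmul_scal c : lmul (sc c) = endo_scal Y c.
Proof.
apply: endo_eq => x; apply/funext => m; apply/funext => b.
by rewrite lmulE sgn_pass_scal.
Qed.

(** The linear map [g] acting on the factor [F], as a matrix in the basis [B]. *)
Definition fmat_fun (g : F -> F) (phi : Y) : Y :=
  fun m b => \sum_(c : I) tr (Bv b * g (B c)) *: phi m c.

Lemma fmat_lin g : linear (fmat_fun g).
Proof.
move=> c x y; apply/funext => m; apply/funext => b.
rewrite -[RHS]/(c *: fmat_fun g x m b + fmat_fun g y m b) /fmat_fun scaler_sumr.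
rewrite -big_split; apply: eq_bigr => e _ /=.
rewrite -[(c *: x + y) m e]/(c *: x m e + y m e) scalerDr !scalerA.
by congr (_ *: _ + _); rewrite mulrC.
Qed.

Definition fmat g : endo Y := Endo (fmat_lin g).

Lemma fmatE g phi m b : fmat g phi m b = \sum_(c : I) tr (Bv b * g (B c)) *: phi m c.
Proof. by []. Qed.

Lemma eq_fmat g h : g =1 h -> fmat g = fmat h.
Proof. by move/funext ->. Qed.

Lemma fmat_comp g h : linear g -> fmat (g \o h) = fmat g * fmat h.
Proof.
move=> gl; pose gg : {linear F -> F} := HB.pack g (GRing.isLinear.Build _ _ _ _ g gl).
apply: endo_eq => x; apply/funext => m; apply/funext => b; rewrite endo_mulE !fmatE.
transitivity (\sum_c \sum_e (tr (Bv b * g (B e)) * tr (Bv e * h (B c))) *: x m c).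
  apply: eq_bigr => c _; rewrite /= [in LHS](B_expand (h (B c))) -[g]/(gg : _ -> _).
  rewrite linear_sum mulr_sumr linear_sum scaler_suml; apply: eq_bigr => e _.
  by rewrite linearZ /= -scalerAr linearZ /= mulrC.
rewrite exchange_big; apply: eq_bigr => e _ /=; rewrite /fmat_fun scaler_sumr.
by apply: eq_bigr => c _; rewrite scalerA.
Qed.

Lemma fmat_id : fmat id = 1.
Proof.
apply: endo_eq => x; apply/funext => m; apply/funext => b; rewrite fmatE.
rewrite (bigD1 b)//= wd_BvP eqxx scale1r big1 ?addr0// => c cb.
by rewrite wd_BvP eq_sym (negPf cb) scale0r.
Qed.

Lemma fmatD g h : fmat (fun x => g x + h x) = fmat g + fmat h.
Proof.
apply: endo_eq => x; apply/funext => m; apply/funext => b.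
rewrite endo_addE -[RHS]/(fmat g x m b + fmat h x m b) !fmatE -big_split.
by apply: eq_bigr => c _; rewrite mulrDr linearD scalerDl.
Qed.

Lemma fmatZ g c : fmat (fun x => c *: g x) = endo_scal Y c * fmat g.
Proof.
apply: endo_eq => x; apply/funext => m; apply/funext => b.
rewrite endo_mulE endo_scalE -[RHS]/(c *: fmat g x m b) !fmatE scaler_sumr.
by apply: eq_bigr => e _; rewrite -scalerAr linearZ scalerA.
Qed.

(** The trace vanishes on odd elements, so that a homogeneous map has matrix
    coefficients only between parities that it relates. *)
Lemma fmat_coef0 (g : F -> F) h b c : ghom G (h + dg c) (g (B c)) ->
  (dg b).2 != h.2 (+) (dg c).2 -> tr (Bv b * g (B c)) = 0.
Proof.
move=> gh bc; apply: (tr_parity (fr_mul_hom (Bv_hom b) gh)).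
by move: bc; case: (dg b) (dg c) h {gh} => ? [] [? []] [? []].
Qed.

Lemma lmul_fmat_inv a g : psgn (sa_gr Q) a = a -> lmul a * fmat g = fmat g * lmul a.
Proof.
move=> aa; have sa b : sgn_pass b a = a by rewrite /sgn_pass; case: ifP.
apply: endo_eq => x; apply/funext => m; apply/funext => b.
rewrite !endo_mulE lmulE !fmatE sa mulr_sumr; apply: eq_bigr => c _.
by rewrite lmulE sa !kmod_scaleE !mulrA sa_scalC.
Qed.

Lemma lmul_fmat_even a g : (forall c, ghom G (dg c) (g (B c))) ->
  lmul a * fmat g = fmat g * lmul a.
Proof.
move=> gh; apply: endo_eq => x; apply/funext => m; apply/funext => b.
rewrite !endo_mulE lmulE !fmatE mulr_sumr; apply: eq_bigr => c _.
rewrite lmulE !kmod_scaleE !mulrA sa_scalC.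
have [bc|bc] := eqVneq (dg b).2 (dg c).2; first by rewrite /sgn_pass bc.
have gh' : ghom G (0 + dg c) (g (B c)) by rewrite add0r.
by rewrite (fmat_coef0 gh')// rmorph0 !mulr0 !mul0r.
Qed.

Lemma lmul_fmat_T i g h f f' : ghom G g f -> ghom G h f' ->
  lmul (wT A i f) * fmat (fun x => f' * x) =
  (-1) ^+ (g.2 && h.2) * (fmat (fun x => f' * x) * lmul (wT A i f)).
Proof.
move=> fg fh; apply: endo_eq => x; apply/funext => m; apply/funext => b.
have -> (a : endo Y) : ((-1) ^+ (g.2 && h.2) * a) x m b =
    (-1) ^+ (g.2 && h.2) * (a x m b : Q).
  by case: (_ && _); rewrite ?mul1r// !mulN1r.
rewrite !endo_mulE lmulE !fmatE !mulr_sumr; apply: eq_bigr => c _.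
rewrite lmulE !kmod_scaleE !(sgn_pass_T _ _ fg).
have gh : ghom G (h + dg c) (f' * B c) by exact: fr_mul_hom fh (wd_B_hom c).
have [bc|bc] := eqVneq (dg b).2 (h.2 (+) (dg c).2); last first.
  by rewrite (fmat_coef0 (g := fun x => f' * x) gh)// rmorph0 !mul0r !mulr0.
set u := sc _; transitivity ((-1) ^+ ((dg b).2 && g.2) * (u * (wT A i f * x m c))).
  by rewrite -!mulrA; congr (_ * _); rewrite !mulrA sa_scalC.
rewrite -[_ * wT A i f * _]mulrA [u * ((-1) ^+ _ * _)]mulrA [u * (-1) ^+ _]commr_sign.
rewrite -[X in _ = _ * X]mulrA.
rewrite [RHS]mulrA -signr_addb bc; congr ((-1) ^+ nat_of_bool _ * _).
by case: g.2; case: h.2; case: (dg c).2.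
Qed.

Definition shift_fun (phi : Y) : Y := fun m => if m is m'.+1 then phi m' else 0.

Lemma shift_lin : linear shift_fun.
Proof.
move=> c x y; apply/funext => -[|m] //.
by rewrite -[RHS]/(c *: (0 : I -> kmod Q) + 0) scaler0 addr0.
Qed.

Definition shift_up : endo Y := Endo shift_lin.

Lemma lmul_shift a : lmul a * shift_up = shift_up * lmul a.
Proof.
apply: endo_eq => x; apply/funext => -[|m]; apply/funext => b //.
by rewrite endo_mulE lmulE; exact: mulr0.
Qed.

Lemma fmat_shift g : fmat g * shift_up = shift_up * fmat g.
Proof.
apply: endo_eq => x; apply/funext => -[|m]; apply/funext => b //.
by rewrite endo_mulE fmatE big1// => c _; exact: scaler0.
Qed.

(** Multiplication by the last polynomial generator: [x b = psi^-1(b) x]. *)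
Definition last_X : endo Y := shift_up * fmat psi_inv.

Lemma lmul_last_X a : lmul a * last_X = last_X * lmul a.
Proof.
rewrite /last_X mulrA lmul_shift -!mulrA; congr (_ * _); apply: lmul_fmat_even => c.
exact/psi_inv_hom/wd_B_hom.
Qed.

Lemma mul_lin f : linear (fun x : F => f * x).
Proof. by move=> c x y; rewrite mulrDr scalerAr. Qed.

Lemma fmat_mul_last_X f :
  fmat (fun x => f * x) * last_X = last_X * fmat (fun x => psi f * x).
Proof.
rewrite /last_X mulrA fmat_shift -!mulrA; congr (_ * _).
rewrite -!fmat_comp; [|exact: psi_inv_lin|exact: mul_lin].
by apply: eq_fmat => x /=; rewrite psi_invM psi_invK.
Qed.

(** ** The parabolic subalgebra *)

(** The subalgebra of the affine algebra generated by [F] on all positions, all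
    [x_i] and the permutations fixing the last position acts on [F[x] (x) Q]: the
    last position through [F[x]], the others through [Q].  The operators [par_Z]
    are those of the covariant elements of [Q], completed by [x]. *)
Definition par_T i f : endo Y :=
  up_val_fun (fmat (fun x => f * x)) (fun l => lmul (wT A l f)) i.
Definition par_Z i : endo Y :=
  up_val_fun last_X (fun l => lmul (aX A l - jucys A l)) i.
Definition par_X i : endo Y := up_val_fun last_X (fun l => lmul (aX A l)) i.
Definition par_S (s : 'S_n) : endo Y := lmul (wS A s).

Lemma par_T_up l f : par_T (up l) f = lmul (wT A l f).
Proof. exact: up_val_funE. Qed.
Lemma par_T_max f : par_T ord_max f = fmat (fun x => f * x).
Proof. exact: up_val_fun_max. Qed.
Lemma par_Z_up l : par_Z (up l) = lmul (aX A l - jucys A l).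
Proof. exact: up_val_funE. Qed.
Lemma par_Z_max : par_Z ord_max = last_X.
Proof. exact: up_val_fun_max. Qed.
Lemma par_X_up l : par_X (up l) = lmul (aX A l).
Proof. exact: up_val_funE. Qed.
Lemma par_X_max : par_X ord_max = last_X.
Proof. exact: up_val_fun_max. Qed.

Lemma par_TD i f g : par_T i (f + g) = par_T i f + par_T i g.
Proof.
case: (upP i) => [->|[l ->]]; last by rewrite !par_T_up wTD lmulD.
by rewrite !par_T_max -fmatD; apply: eq_fmat => x; rewrite mulrDl.
Qed.

Lemma par_TZ i c f : par_T i (c *: f) = endo_scal Y c * par_T i f.
Proof.
case: (upP i) => [->|[l ->]]; last by rewrite !par_T_up wTZ lmulM lmul_scal.
by rewrite !par_T_max -fmatZ; apply: eq_fmat => x; rewrite scalerAl.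
Qed.

Lemma par_T1 i : par_T i 1 = 1.
Proof.
case: (upP i) => [->|[l ->]]; last by rewrite par_T_up wT1 lmul1.
by rewrite par_T_max -fmat_id; apply: eq_fmat => x; rewrite mul1r.
Qed.

Lemma par_TM i f g : par_T i (f * g) = par_T i f * par_T i g.
Proof.
case: (upP i) => [->|[l ->]]; last by rewrite !par_T_up wTM lmulM.
rewrite !par_T_max -fmat_comp; last exact: mul_lin.
by apply: eq_fmat => x /=; rewrite mulrA.
Qed.

Lemma par_TC i j g h f f' : i != j -> ghom G g f -> ghom G h f' ->
  par_T i f * par_T j f' = (-1) ^+ (g.2 && h.2) * (par_T j f' * par_T i f).
Proof.
move=> ij fg fh; case: (upP i) (upP j) ij => [->|[l ->]] [->|[m ->]].
- by rewrite eqxx.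
- move=> _; rewrite par_T_max par_T_up (lmul_fmat_T _ fh fg) andbC.
  by rewrite mulrA -signr_addb addbb mul1r.
- by move=> _; rewrite par_T_max par_T_up (lmul_fmat_T _ fg fh).
- by rewrite up_eq !par_T_up -!lmulM => lm; rewrite (wTC A lm fg fh) lmul_sign.
Qed.

Lemma par_S1 : par_S 1%g = 1.
Proof. by rewrite /par_S wS1 lmul1. Qed.

Lemma par_SM s t : par_S (s * t)%g = par_S t * par_S s.
Proof. by rewrite /par_S wSM lmulM. Qed.

Lemma par_ST s i f : par_S s * par_T i f = par_T (up_perm s i) f * par_S s.
Proof.
case: (upP i) => [->|[l ->]].
  by rewrite up_perm_max par_T_max lmul_fmat_inv// psgn_S.
by rewrite up_permE !par_T_up -!lmulM wST.
Qed.

Let sub_jucys_cov : covariant A (fun i => aX A i - jucys A i).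
Proof.
by apply: (covariant_sub_jucys (x := aX A)) => *; [exact: aSX_far|exact: aSX].
Qed.

Lemma par_SZ s i : par_S s * par_Z i = par_Z (up_perm s i) * par_S s.
Proof.
case: (upP i) => [->|[l ->]].
  by rewrite up_perm_max par_Z_max lmul_last_X.
by rewrite up_permE !par_Z_up -!lmulM sub_jucys_cov.
Qed.

Lemma psgn_jucys i : psgn (sa_gr Q) (jucys A i) = jucys A i.
Proof.
apply: (big_ind (fun a => psgn (sa_gr Q) a = a)) => [|a b aE bE|l _].
- exact: psgn0.
- by rewrite psgnD aE bE.
rewrite psgnM psgn_S; congr (_ * _).
apply: (big_ind (fun a => psgn (sa_gr Q) a = a)) => [|a b aE bE|b _].
- exact: psgn0.
- by rewrite psgnD aE bE.
rewrite psgnM (psgn_T _ (wd_B_hom b)) (psgn_T _ (Bv_hom b)) dual_parity.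
by case: (dg b).2; rewrite ?mul1r// !mulN1r mulrNN.
Qed.

Lemma psgn_sub_jucys i : psgn (sa_gr Q) (aX A i - jucys A i) = aX A i - jucys A i.
Proof.
have psgnN a : psgn (sa_gr Q) (- a) = - psgn (sa_gr Q) a.
  by apply/eqP; rewrite -addr_eq0 -psgnD addNr psgn0.
by rewrite psgnD psgnN psgn_X psgn_jucys.
Qed.

Lemma par_TZ_comm i j f :
  par_T i f * par_Z j = par_Z j * par_T i (if i == j then psi f else f).
Proof.
case: (upP i) (upP j) => [->|[l ->]] [->|[m ->]].
- by rewrite eqxx !par_T_max par_Z_max fmat_mul_last_X.
- by rewrite up_neq_max par_T_max par_Z_up lmul_fmat_inv// psgn_sub_jucys.
- by rewrite eq_sym up_neq_max par_T_up par_Z_max lmul_last_X.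
rewrite up_eq !par_T_up par_Z_up -!lmulM mulrBr mulrBl aTX.
by rewrite (jucys_T (@sa_scalC k Q)).
Qed.

Lemma par_XC i j : par_X i * par_X j = par_X j * par_X i.
Proof.
case: (upP i) (upP j) => [->|[l ->]] [->|[m ->]]//.
- by rewrite par_X_max par_X_up lmul_last_X.
- by rewrite par_X_max par_X_up lmul_last_X.
by rewrite !par_X_up -!lmulM aXC.
Qed.

End InducedModule.

(** * The induced representation *)

Section InducedRep.
Variables (k : comNzRingType) (D : wreath_data k) (C : cyclo_data D).
Local Notation G := (fr_gr (wd_F D)).
Local Notation psi := (wd_psi D).
Local Notation I := (wd_I D).
Variables (n : nat) (Q : superalg k) (A : cyc_rep C n Q).
Local Notation Y := (nat -> I -> kmod Q).
Local Notation V := ('I_n.+1 -> Y).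
Implicit Types (s t : 'S_n.+1) (i j l : 'I_n.+1) (a b : 'I_n.+1 -> endo Y) (phi : V).

(** Monomial matrices, moving component [j] to component [s j] through [a j]. *)
Definition mono_fun s a phi : V := fun j => a (s^-1%g j) (phi (s^-1%g j)).

Lemma mono_lin s a : linear (mono_fun s a).
Proof. by move=> c x y; apply/funext => j; exact: endo_lin. Qed.

Definition mono s a : endo V := Endo (mono_lin s a).

Lemma monoE s a phi j : mono s a phi (s j) = a j (phi j).
Proof. by rewrite /= /mono_fun permK. Qed.

Lemma mono1E a phi j : mono 1 a phi j = a j (phi j).
Proof. by rewrite -{1}[j]perm1 monoE. Qed.

Lemma eq_mono s a b : a =1 b -> mono s a = mono s b.
Proof. by move/funext ->. Qed.

Lemma mono_mul s t a b : mono s a * mono t b = mono (t * s)%g (fun j => a (t j) * b j).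
Proof.
apply: endo_eq => x; apply/funext => j; rewrite -[j](permKV (t * s)%g) monoE.
by rewrite permM endo_mulE !monoE.
Qed.

Lemma mono1 : mono 1 (fun _ => 1) = 1.
Proof. by apply: endo_eq => x; apply/funext => j; rewrite mono1E. Qed.

Lemma monoD s a b : mono s (fun j => a j + b j) = mono s a + mono s b.
Proof. by apply: endo_eq => x; apply/funext => j. Qed.

Lemma mono0 s : mono s (fun _ => 0) = 0.
Proof. by apply: endo_eq => x; apply/funext => j. Qed.

Lemma mono_sum s J (r : seq J) P (a : J -> 'I_n.+1 -> endo Y) :
  mono s (fun j => \sum_(l <- r | P l) a l j) = \sum_(l <- r | P l) mono s (a l).
Proof.
elim: r => [|l r IHr]; first by rewrite big_nil -(mono0 s); apply: eq_mono => j; rewrite big_nil.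
rewrite big_cons -IHr; case: ifP => Pl; last by apply: eq_mono => j; rewrite big_cons Pl.
by rewrite -monoD; apply: eq_mono => j; rewrite big_cons Pl.
Qed.

Lemma mono_scal c : mono 1 (fun _ => endo_scal Y c) = endo_scal V c.
Proof. by apply: endo_eq => x; apply/funext => j; rewrite mono1E. Qed.

Lemma mono_sign (e : bool) s a : mono s (fun j => (-1) ^+ e * a j) = (-1) ^+ e * mono s a.
Proof.
case: e; last by rewrite expr0 mul1r; apply: eq_mono => j; rewrite mul1r.
by apply: endo_eq => x; apply/funext => j; rewrite expr1 [in RHS]mulN1r /= /mono_fun mulN1r.
Qed.

(** Component [j] of a vector stands for [w_j (phi j)], where [w_j] is the inverse
    of [to_last j]; these are coset representatives of the permutations fixing the
    last position.  The operators express that [f_i w_j = w_j f_(to_last j i)] and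
    that [s w_j = w_(s j) (perm_del s j)]. *)
Definition ind_T i f : endo V := mono 1 (fun j => par_T A (to_last j i) f).
Definition ind_S s : endo V := mono s (fun j => par_S A (perm_del s j)).

Let ind_TD i f g : ind_T i (f + g) = ind_T i f + ind_T i g.
Proof. by rewrite -monoD; apply: eq_mono => j; exact: par_TD. Qed.

Let ind_TZ i c f : ind_T i (c *: f) = endo_scal V c * ind_T i f.
Proof.
by rewrite -mono_scal mono_mul mulg1; apply: eq_mono => j; exact: par_TZ.
Qed.

Let ind_T1 i : ind_T i 1 = 1.
Proof. by rewrite -mono1; apply: eq_mono => j; exact: par_T1. Qed.

Let ind_TM i f g : ind_T i (f * g) = ind_T i f * ind_T i g.
Proof. by rewrite mono_mul mulg1; apply: eq_mono => j; rewrite perm1; exact: par_TM. Qed.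

Let ind_TC i j g h f f' : i != j -> ghom G g f -> ghom G h f' ->
  ind_T i f * ind_T j f' = (-1) ^+ (g.2 && h.2) * (ind_T j f' * ind_T i f).
Proof.
move=> ij fg fh; rewrite !mono_mul -mono_sign mulg1; apply: eq_mono => l.
by rewrite perm1; apply: par_TC => //; rewrite (inj_eq perm_inj).
Qed.

Let ind_S1 : ind_S 1%g = 1.
Proof. by rewrite -mono1; apply: eq_mono => j; rewrite perm_del1 par_S1. Qed.

Let ind_SM s t : ind_S (s * t)%g = ind_S t * ind_S s.
Proof. by rewrite mono_mul; apply: eq_mono => j; rewrite perm_del_mul par_SM. Qed.

Let ind_ST s i f : ind_S s * ind_T i f = ind_T (s i) f * ind_S s.
Proof.
rewrite !mono_mul mul1g mulg1; apply: eq_mono => j.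
by rewrite perm1 to_last_perm par_ST.
Qed.

Definition ind_wreath : @wreath_rep k D n.+1 (endo V) (endo_scal V) :=
  WreathRep ind_TD ind_TZ ind_T1 ind_TM ind_TC ind_S1 ind_SM ind_ST.

Local Notation T := (wT ind_wreath).
Local Notation S := (wS ind_wreath).

Definition comp_proj i : endo V := mono 1 (fun j => if j == i then 1 else 0).
Definition at_last (u : endo Y) : endo V := mono 1 (fun j => if j == ord_max then u else 0).

Lemma at_lastM u v : at_last (u * v) = at_last u * at_last v.
Proof.
rewrite mono_mul mulg1; apply: eq_mono => j; rewrite perm1.
by case: eqP => // _; rewrite mul0r.
Qed.

Lemma at_lastD u v : at_last (u + v) = at_last u + at_last v.
Proof. by rewrite -monoD; apply: eq_mono => j; case: eqP => // _; rewrite addr0. Qed.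

Lemma at_last0 : at_last 0 = 0.
Proof. by rewrite -(mono0 1); apply: eq_mono => j; case: eqP. Qed.

Lemma at_last_sum J (r : seq J) P (u : J -> endo Y) :
  at_last (\sum_(l <- r | P l) u l) = \sum_(l <- r | P l) at_last (u l).
Proof. by apply: big_morph; [exact: at_lastD | exact: at_last0]. Qed.

Lemma at_last1 : at_last 1 = comp_proj ord_max.
Proof. by []. Qed.

Lemma comp_proj_at_last i u : comp_proj i * at_last u = if i == ord_max then at_last u else 0.
Proof.
rewrite mono_mul mulg1; case: eqVneq => [->|im].
  by apply: eq_mono => j; rewrite perm1; case: eqP => //= _; rewrite ?mul1r ?mul0r.
rewrite -(mono0 1); apply: eq_mono => j; rewrite perm1.
by case: (eqVneq j i) => [->|]; rewrite ?(negPf im) ?mulr0 ?mul0r.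
Qed.

Lemma ind_T_at_last i f u : T i f * at_last u = at_last (par_T A i f * u).
Proof.
rewrite mono_mul mulg1; apply: eq_mono => j; rewrite perm1.
by case: eqP => [->|_]; rewrite ?mulr0// to_last_max perm1.
Qed.

Lemma ind_S_at_last (s : 'S_n) u :
  S (up_perm s) * at_last u = at_last (par_S A s * u).
Proof.
apply: endo_eq => x; apply/funext => j; rewrite endo_mulE mono1E.
case: (upP j) => [->|[l ->]].
  rewrite eqxx -{1}(up_perm_max s) monoE perm_del_up endo_mulE.
  by rewrite mono1E eqxx.
rewrite -(permKV s l) -up_permE monoE mono1E eq_sym up_neq_max.
by rewrite [up_perm _ _ == _]eq_sym up_permE up_neq_max endo0.
Qed.

Lemma comp_proj_T i j f : T i f * comp_proj j = comp_proj j * T i f.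
Proof.
rewrite !mono_mul mulg1; apply: eq_mono => l; rewrite !perm1.
by case: eqP => // _; rewrite ?mulr1 ?mul1r ?mulr0 ?mul0r.
Qed.

Lemma comp_proj_S s j : S s * comp_proj j = comp_proj (s j) * S s.
Proof.
rewrite !mono_mul mulg1 mul1g; apply: eq_mono => l; rewrite !perm1 (inj_eq perm_inj).
by case: eqP => // _; rewrite ?mulr1 ?mul1r ?mulr0 ?mul0r.
Qed.

Lemma sum_comp_proj : \sum_i comp_proj i = 1.
Proof.
rewrite -mono_sum -mono1; apply: eq_mono => j.
by rewrite (bigD1 j)//= eqxx big1 ?addr0// => i; rewrite eq_sym => /negPf ->.
Qed.

Definition ind_Z0 i : endo V := mono 1 (fun j => par_Z A (to_last j i)).
Local Notation Yt := (swap_tele ind_wreath).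

(** The covariant elements.  Let [w_j] move the last position to [j].  Then
    [z_i w_j = w_j z_l] with [l] the position that [w_j] moves to [i], so that
    covariance leaves no choice: for [i] different from [j] the element [z_l] acts
    through the smaller algebra, while for [i = j] it is the last one,
    [x_last] minus the sum of all swapping teleporters into the last position. *)
Definition ind_Z i : endo V := ind_Z0 i - \sum_(l | l != i) Yt l i * comp_proj i.

Lemma ind_Z_cov : covariant ind_wreath ind_Z.
Proof.
move=> s i; rewrite /ind_Z mulrBr mulrBl; congr (_ - _).
  rewrite !mono_mul mul1g mulg1; apply: eq_mono => j.
  by rewrite perm1 to_last_perm par_SZ.
rewrite mulr_sumr mulr_suml [RHS](reindex_inj (@perm_inj _ s)).
apply: eq_big => [l|l _]; first by rewrite (inj_eq perm_inj).
by rewrite mulrA swap_tele_perm -!mulrA comp_proj_S.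
Qed.

Lemma ind_Z_T i j f : T i f * ind_Z j = ind_Z j * T i (if i == j then psi f else f).
Proof.
rewrite /ind_Z mulrBr mulrBl; congr (_ - _).
  rewrite !mono_mul mulg1; apply: eq_mono => l.
  by rewrite perm1 par_TZ_comm (inj_eq perm_inj).
rewrite mulr_sumr mulr_suml; apply: eq_bigr => l lj.
rewrite mulrA (swap_tele_T (@endo_scalC _ _) ind_wreath) ?mulrA//.
by rewrite -!mulrA comp_proj_T.
Qed.

Definition ind_X i : endo V := ind_Z i + jucys ind_wreath i.

Let ind_X_T i j f : T i f * ind_X j = ind_X j * T i (if i == j then psi f else f).
Proof. exact: (shifted_T (@endo_scalC _ _) ind_Z_T). Qed.

Let ind_X_far i i' j : i' = i.+1 :> nat -> j != i -> j != i' ->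
  S (tperm i i') * ind_X j = ind_X j * S (tperm i i').
Proof. exact: (shifted_far ind_Z_cov). Qed.

Let ind_X_adj i i' : i' = i.+1 :> nat ->
  S (tperm i i') * ind_X i = ind_X i' * S (tperm i i') - tele ind_wreath i i'.
Proof. exact: (shifted_adj ind_Z_cov). Qed.

Lemma swap_tele_at_last (l m : 'I_n) u :
  Yt (up l) (up m) * at_last u = at_last (lmul D (swap_tele A l m) * u).
Proof.
rewrite /swap_tele -up_tperm -mulrA ind_S_at_last lmulM -mulrA -/(par_S A _).
set v := par_S A _ * u; rewrite mulr_suml lmul_sum mulr_suml at_last_sum.
apply: eq_bigr => b _; rewrite -mulrA.
rewrite [T _ _ * at_last _]ind_T_at_last [LHS]ind_T_at_last.
by rewrite !par_T_up lmulM mulrA.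
Qed.

Lemma jucys_at_last (m : 'I_n) u :
  jucys ind_wreath (up m) * at_last u = at_last (lmul D (jucys A m) * u).
Proof.
have max_m : ((ord_max : 'I_n.+1) < up m)%N = false by rewrite up_val ltnNge ltnW/=.
rewrite mulr_suml big_mkcond big_ord_recr max_m [LHS]addr0.
rewrite lmul_sum mulr_suml at_last_sum [RHS]big_mkcond; apply: eq_bigr => l _.
have -> : widen_ord (leqnSn n) l = up l by apply/val_inj; rewrite [RHS]up_val.
by rewrite !up_val; case: ifP => // _; rewrite swap_tele_at_last.
Qed.

(** On the last component, where [w_j = 1], the generators act as those of the
    parabolic subalgebra: the Jucys-Murphy elements restore what [par_Z] and the
    correction in [ind_Z] take away. *)
Lemma ind_X_at_last i u : ind_X i * at_last u = at_last (par_X A i * u).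
Proof.
have Z0 : ind_Z0 i * at_last u = at_last (par_Z A i * u).
  rewrite mono_mul mulg1; apply: eq_mono => j; rewrite perm1.
  by case: eqP => [->|_]; rewrite ?mulr0// to_last_max perm1.
rewrite mulrDl mulrBl Z0; case: (upP i) => [->|[m ->]].
  rewrite par_Z_max par_X_max /jucys !mulr_suml.
  rewrite (eq_bigl (fun l : 'I_n.+1 => (l < (ord_max : 'I_n.+1))%N)) => [|l]; last first.
    by rewrite -(inj_eq val_inj) /= ltn_neqAle -ltnS ltn_ord andbT.
  rewrite -addrA -[RHS]addr0; congr (_ + _); apply/eqP; rewrite addrC subr_eq0; apply/eqP.
  by apply: eq_bigr => l _; rewrite -[RHS]mulrA comp_proj_at_last eqxx.
rewrite mulr_suml big1 => [|l _]; last first.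
  by rewrite -mulrA comp_proj_at_last eq_sym up_neq_max mulr0.
rewrite subr0 par_Z_up par_X_up jucys_at_last -at_lastD -mulrDl -lmulD.
by rewrite subrK.
Qed.

(** Commutators of the [x_i] are permuted by the symmetric group, so that it is
    enough to check that they vanish on the last component, where they come
    from the action of the parabolic subalgebra. *)
Lemma ind_XC i j : ind_X i * ind_X j = ind_X j * ind_X i.
Proof.
apply/eqP; rewrite -subr_eq0; apply/eqP; set c := _ - _.
have c_last i' j' : (ind_X i' * ind_X j' - ind_X j' * ind_X i') * comp_proj ord_max = 0.
  rewrite -at_last1 mulrBl -!mulrA !ind_X_at_last !mulr1 par_XC.
  by rewrite subrr.
rewrite -[c]mulr1 -sum_comp_proj mulr_sumr big1// => l _.
pose s := tperm ord_max l; have sl : s ord_max = l by rewrite tpermL.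
have -> : comp_proj l = S s * comp_proj ord_max * S s^-1%g.
  by rewrite comp_proj_S sl -mulrA wS_invr mulr1.
have := comm_perm (@endo_scalC _ _) ind_X_T ind_X_far ind_X_adj s (s^-1%g i) (s^-1%g j).
rewrite !permKV -/c 2!mulrA => <-.
by rewrite -[S s * _ * _]mulrA c_last mulr0 mul0r.
Qed.

Definition ind_affine : @affine_rep k D n.+1 (endo V) (endo_scal V) :=
  @AffineRep k D n.+1 (endo V) (endo_scal V) ind_wreath ind_X ind_XC ind_X_T ind_X_far ind_X_adj.

End InducedRep.

(** * The cyclotomic polynomial *)

Section ChiTheory.
Variables (k : comNzRingType) (D : wreath_data k) (C : cyclo_data D).
Local Notation F := (wd_F D).
Local Notation G := (fr_gr (wd_F D)).
Local Notation psi := (wd_psi D).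
Variables (n : nat) (E : pzRingType) (sc : {rmorphism k -> E}).
Hypothesis scC : forall c a, sc c * a = a * sc c.
Variable A : @affine_rep k D n.+1 E sc.
Local Notation T := (wT A).
Local Notation S := (wS A).
Local Notation X := (aX A).
Local Notation chi := (chi_at C A ord0).
Implicit Types (i j : 'I_n.+1) (s : 'S_n.+1).

Lemma aeval_chi : aeval sc (rep_gen A) (Defs.chi C n) = chi.
Proof.
rewrite /Defs.chi /chi_at; elim/big_rec2: _ => [|m y1 y2 _ <-] /=; first exact: rmorph1.
congr (_ * _); elim/big_rec2: _ => [|j z1 z2 _ <-] /=; first exact: rmorph1.
rewrite tens_prod_at (rmorphN1 sc) mulN1r; congr ((_ - _) * _).
by elim: m => [|m IHm] /=; rewrite ?rmorph1 ?expr0// IHm exprS.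
Qed.

Lemma chi_ind (P : E -> Prop) : P 1 -> (forall a b, P a -> P b -> P (a * b)) ->
  (forall m j : nat, (1 <= m <= wd_theta D)%N -> (1 <= j <= cy_e C m)%N ->
     P (X ord0 ^+ m - T ord0 (cy_c C m j))) -> P chi.
Proof.
move=> P1 PM Pf; rewrite /chi_at big_nat_cond; apply: (big_ind P) => // m /andP[mP _].
rewrite big_nat_cond; apply: (big_ind P) => // j /andP[jP _]; exact: Pf.
Qed.

Lemma jucys_first : jucys A ord0 = 0.
Proof. by rewrite /jucys big_pred0. Qed.

Lemma S_fix_X s : s ord0 = ord0 -> S s * X ord0 = X ord0 * S s.
Proof.
move=> s0.
have := covariant_sub_jucys (@aSX_far _ _ _ _ _ A) (@aSX _ _ _ _ _ A) s ord0.
by rewrite jucys_first subr0 s0 jucys_first subr0.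
Qed.

Lemma S_fix_chi s : s ord0 = ord0 -> S s * chi = chi * S s.
Proof.
move=> s0; apply: (chi_ind (P := fun a => S s * a = a * S s)).
- by rewrite mulr1 mul1r.
- by move=> a b aP bP; rewrite mulrA aP -mulrA bP mulrA.
move=> m j _ _; rewrite mulrBr mulrBl wST s0; congr (_ - _).
elim: m => [|m IHm]; first by rewrite expr0 mulr1 mul1r.
by rewrite exprS mulrA S_fix_X// -mulrA IHm mulrA.
Qed.

(** The coefficients of [chi] are fixed by [psi]. *)
Lemma X_chi i : X i * chi = chi * X i.
Proof.
apply: (chi_ind (P := fun a => X i * a = a * X i)).
- by rewrite mulr1 mul1r.
- by move=> a b aP bP; rewrite mulrA aP -mulrA bP mulrA.
move=> m j mP jP; rewrite mulrBr mulrBl; congr (_ - _).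
  elim: m {mP jP} => [|m IHm]; first by rewrite expr0 mulr1 mul1r.
  by rewrite exprS mulrA (aXC A) -mulrA IHm mulrA.
have [_ cpsi] := cy_twist mP jP.
by rewrite aTX; case: ifP => // _; rewrite cpsi.
Qed.

Lemma ppart_sum (g : F) : ppart G true g + ppart G false g = g.
Proof.
elim/(ghom_ind (G := G)): g => [|g g' IHg IHg'|h g gh].
- by rewrite !ppart0 addr0.
- by rewrite !ppartD addrACA IHg IHg'.
by rewrite !(ppart_hom _ gh); case: h.2; rewrite /= ?addr0 ?add0r.
Qed.

Lemma twist_mul m (c g : F) d : ghom G (d, false) c -> in_Ftwist m c ->
  g * c = c * iter m psi g.
Proof.
move=> cd ct; rewrite (ct g) /sbil !big_bool /= !(ppart_hom _ cd) /=.
rewrite !mul0r !mul0rz !add0r -mulrDr -[in RHS](ppart_sum g); congr (_ * _).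
by elim: m {ct} => //= m <-; rewrite linearD.
Qed.

(** The coefficient of a factor [x^m - c] lies in the [m]-th twisted centre of [F],
    so that both of its terms carry [f] to [psi^m f]. *)
Lemma T_chi i f : exists f', T i f * chi = chi * T i f'.
Proof.
move: f; apply: (chi_ind (P := fun a => forall f, exists f', T i f * a = a * T i f')).
- by move=> f; exists f; rewrite mulr1 mul1r.
- move=> a b aP bP f; have [f1 e1] := aP f; have [f2 e2] := bP f1.
  by exists f2; rewrite mulrA e1 -mulrA e2 mulrA.
move=> m j mP jP f; have cd := cy_hom mP jP; have [ct _] := cy_twist mP jP.
have [i0|i0] := eqVneq i ord0.
  exists (iter m psi f); rewrite i0 mulrBr mulrBl -!wTM (twist_mul f cd ct); congr (_ - _).
  elim: m f {mP jP cd ct} => [|m IHm] f; first by rewrite expr0 mulr1 mul1r.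
  by rewrite exprS mulrA aTX eqxx -mulrA IHm mulrA iterSr.
exists f; rewrite mulrBr mulrBl; congr (_ - _).
  elim: m {mP jP cd ct} => [|m IHm]; first by rewrite expr0 mulr1 mul1r.
  by rewrite exprS mulrA aTX (negPf i0) -mulrA IHm mulrA.
elim/(ghom_ind (G := G)): f => [|f f' IHf IHf'|g f fg].
- by rewrite (wT0 A) mul0r mulr0.
- by rewrite wTD mulrDl mulrDr IHf IHf'.
by rewrite (wTC A i0 fg cd) andbF mul1r.
Qed.

(** The conjugates of [chi] depend only on the position reached. *)
Definition chi_conj j : E := S (tperm ord0 j) * chi * S (tperm ord0 j).

Lemma S_chi s : S s * chi = chi_conj (s ord0) * S s.
Proof.
rewrite /chi_conj; set w := tperm _ _.
have v0 : (s * w)%g ord0 = ord0 by rewrite permM /w tpermR.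
rewrite -[RHS]mulrA -wSM -[RHS]mulrA -(S_fix_chi v0) mulrA -wSM -mulgA.
by rewrite [(w * w)%g]tperm2 mulg1.
Qed.

Lemma S_chi_conj s j : S s * chi_conj j = chi_conj (s j) * S s.
Proof.
rewrite /chi_conj; set w := tperm ord0 j; rewrite !mulrA -wSM S_chi permM tpermL.
by rewrite -!mulrA -!wSM mulgA tperm2 mul1g.
Qed.

(** On each component of the induced module all but one of the summands will turn
    out to vanish; the sum treats the components on the same footing, and
    commutes with permutations. *)
Definition chi_sum : E := \sum_j chi_conj j.

Lemma S_chi_sum s : S s * chi_sum = chi_sum * S s.
Proof.
rewrite mulr_sumr mulr_suml [RHS](reindex_inj (@perm_inj _ s)).
by apply: eq_bigr => j _; exact: S_chi_conj.
Qed.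

End ChiTheory.

(** * Division by the cyclotomic polynomial *)

Section Division.
Variables (k : comNzRingType) (D : wreath_data k) (C : cyclo_data D).
Local Notation psi := (wd_psi D).
Local Notation I := (wd_I D).
Variables (n : nat) (Q : superalg k) (A : cyc_rep C n Q).
Local Notation Y := (nat -> I -> kmod Q).
Local Notation V := ('I_n.+1 -> Y).
Local Notation R := (ind_affine A).
Local Notation T := (wT R).
Local Notation S := (wS R).
Local Notation X := (aX R).
Local Notation chi := (chi_at C R ord0).
Local Notation d := (level C).
Local Notation fmat := (@fmat k D Q).
Local Notation psi_inv := (@psi_inv k D).
Local Notation at_last := (@at_last k D n Q).
Implicit Types (i j : 'I_n.+1) (s : 'S_n.+1) (phi xi eta : V) (m e : nat) (o : endo V)
  (u : endo Y) (y : Y).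

(** ** Degrees *)

Definition ydeg_lt m y := forall a, (m <= a)%N -> y a = 0.
Definition deg_lt m phi := forall j, ydeg_lt m (phi j).
(** The polynomial vectors. *)
Definition fin phi := exists m, deg_lt m phi.
Definition yraises e u := forall m y, ydeg_lt m y -> ydeg_lt (m + e) (u y).
Definition raises e o := forall m phi, deg_lt m phi -> deg_lt (m + e) (o phi).

Lemma deg_lt_le m m' phi : (m <= m')%N -> deg_lt m phi -> deg_lt m' phi.
Proof. by move=> mm' h j a ma; apply: h; exact: leq_trans ma. Qed.

Lemma deg_ltD m phi xi : deg_lt m phi -> deg_lt m xi -> deg_lt m (phi + xi).
Proof.
move=> h h' j a ma; rewrite -[LHS]/(phi j a + xi j a) h// h'//.
by rewrite addr0.
Qed.

Lemma deg_ltN m phi : deg_lt m phi -> deg_lt m (- phi).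
Proof. by move=> h j a ma; rewrite -[LHS]/(- phi j a) h// oppr0. Qed.

Lemma fin0 : fin 0. Proof. by exists 0%N. Qed.

Lemma finD phi xi : fin phi -> fin xi -> fin (phi + xi).
Proof.
move=> [m h] [m' h']; exists (maxn m m'); apply: deg_ltD.
  by apply: deg_lt_le h; exact: leq_maxl.
by apply: deg_lt_le h'; exact: leq_maxr.
Qed.

Lemma finN phi : fin phi -> fin (- phi).
Proof. by move=> [m h]; exists m; exact: deg_ltN. Qed.

Lemma raises_fin e o phi : raises e o -> fin phi -> fin (o phi).
Proof. by move=> oe [m h]; exists (m + e)%N; exact: oe. Qed.

Lemma raises_le e e' o : (e <= e')%N -> raises e o -> raises e' o.
Proof. by move=> ee' h m phi /h; apply: deg_lt_le; rewrite leq_add2l. Qed.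

Lemma raises1 : raises 0 1.
Proof. by move=> m phi; rewrite addn0. Qed.

Lemma raisesD e o o' : raises e o -> raises e o' -> raises e (o + o').
Proof. by move=> h h' m phi hphi; apply: deg_ltD; [exact: h | exact: h']. Qed.

Lemma raisesN e o : raises e o -> raises e (- o).
Proof. by move=> h m phi hphi; apply: deg_ltN; exact: h. Qed.

Lemma raisesM e e' o o' : raises e o -> raises e' o' -> raises (e + e') (o * o').
Proof. by move=> h h' m phi /h' /h; rewrite -addnA [(e' + e)%N]addnC. Qed.

Lemma raises_sum J (r : seq J) (P : pred J) e (o : J -> endo V) :
  (forall l, P l -> raises e (o l)) -> raises e (\sum_(l <- r | P l) o l).
Proof.
move=> h; apply: (big_ind (raises e)) => //; last by move=> *; exact: raisesD.
Qed.

Lemma raises_prod J (r : seq J) (P : pred J) (o : J -> endo V) :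
  (forall l, P l -> raises 0 (o l)) -> raises 0 (\prod_(l <- r | P l) o l).
Proof.
move=> h; apply: (big_ind (raises 0)) => //; first exact: raises1.
by move=> a b ha hb; exact: (raisesM ha hb).
Qed.

Lemma raises_mono s (a : 'I_n.+1 -> endo Y) e :
  (forall j, yraises e (a j)) -> raises e (mono s a).
Proof. by move=> h m phi hphi j; rewrite -[j](permKV s) monoE; apply: h. Qed.

Lemma yraises_lmul a : yraises 0 (lmul D a).
Proof.
move=> m y hy l; rewrite addn0 => ml; apply/funext => b.
by rewrite lmulE hy//; exact: mulr0.
Qed.

Lemma yraises_fmat g : yraises 0 (fmat g : endo Y).
Proof.
move=> m y hy l; rewrite addn0 => ml; apply/funext => b.
by rewrite fmatE hy// big1// => c _; exact: scaler0.
Qed.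

Lemma yraises_last_X : yraises 1 (last_X D Q).
Proof.
move=> m y hy [|l]; rewrite addn1// ltnS => ml; rewrite endo_mulE /=.
by apply: (yraises_fmat psi_inv hy); rewrite addn0.
Qed.

Lemma S_comp s phi j : S s phi (s j) = par_S A (perm_del s j) (phi j).
Proof. exact: monoE. Qed.

Lemma raises_T i f : raises 0 (T i f).
Proof.
apply: raises_mono => j; case: (upP (to_last j i)) => [->|[l ->]].
  by rewrite par_T_max; exact: yraises_fmat.
by rewrite par_T_up; exact: yraises_lmul.
Qed.

Lemma raises_S s : raises 0 (S s).
Proof. by apply: raises_mono => j; exact: yraises_lmul. Qed.

Lemma raises_comp_proj i : raises 0 (comp_proj D Q i).
Proof. by apply: raises_mono => j; case: eqP => // _ m y; rewrite addn0. Qed.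

Lemma raises_swap i j : raises 0 (swap_tele R i j).
Proof.
apply: (@raisesM 0 0 _ _ _ (raises_S _)); apply: raises_sum => b _.
exact: (raisesM (raises_T _ _) (raises_T _ _)).
Qed.

Lemma raises_jucys i : raises 0 (jucys R i).
Proof. by apply: raises_sum => j _; exact: raises_swap. Qed.

Lemma raises_Z0 i : raises 1 (ind_Z0 A i).
Proof.
apply: raises_mono => j; case: (upP (to_last j i)) => [->|[l ->]].
  by rewrite par_Z_max; exact: yraises_last_X.
rewrite par_Z_up => m y hy a ma; apply: (yraises_lmul _ hy).
by apply: leq_trans ma; rewrite leq_add2l.
Qed.

Lemma raises_Z_tail i : raises 0 (\sum_(l | l != i) swap_tele R l i * comp_proj D Q i).
Proof.
apply: raises_sum => l _; exact: (raisesM (raises_swap _ _) (raises_comp_proj _)).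
Qed.

Lemma raises_X i : raises 1 (X i).
Proof.
apply: raisesD; last by apply: (raises_le (leq0n 1)); exact: raises_jucys.
apply: raisesD; first exact: raises_Z0.
by apply: raisesN; apply: (raises_le (leq0n 1)); exact: raises_Z_tail.
Qed.

Lemma fin_eval t phi : fin phi -> fin (aeval (endo_scal V) (rep_gen R) t phi).
Proof.
elim: t phi => [c|[i|f|s]|t IHt u IHu|t IHt u IHu] phi hphi /=.
- by have [m h] := hphi; exists m => j a ma; rewrite -[LHS]/(c *: phi j a) h// scaler0.
- exact: raises_fin (raises_X i) hphi.
- by apply: raises_fin hphi; apply: raises_prod => i _; exact: raises_T.
- exact: raises_fin (raises_S s) hphi.
- by apply: finD; [exact: IHt | exact: IHu].
- exact/IHt/IHu.
Qed.

(** ** Leading coefficients *)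

Definition mat_psi_inv (v : I -> kmod Q) : I -> kmod Q := fmat psi_inv (fun _ => v) 0%N.
Definition mat_psi (v : I -> kmod Q) : I -> kmod Q := fmat psi (fun _ => v) 0%N.

Lemma mat_psiK v : mat_psi_inv (mat_psi v) = v.
Proof.
have := fmat_comp Q psi (@psi_inv_lin k D); rewrite (eq_fmat _ (@psi_invK k D)) fmat_id.
by move=> /(congr1 (fun u : endo Y => u (fun _ => v) 0%N)).
Qed.

Lemma mat_psi_invK v : mat_psi (mat_psi_inv v) = v.
Proof.
have psi_lin : linear psi by exact: linearP.
have := fmat_comp Q psi_inv psi_lin; rewrite (eq_fmat _ (@psiK k D)) fmat_id.
by move=> /(congr1 (fun u : endo Y => u (fun _ => v) 0%N)).
Qed.

Lemma lmul_mat_psi_inv a y m z l : mat_psi_inv (y m) = z l ->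
  mat_psi_inv (lmul D a y m) = lmul D a z l.
Proof.
move=> e; have := congr1 (fun u : endo Y => u y m.+1) (lmul_last_X D a).
move=> /esym; rewrite -[X in X = _]/(mat_psi_inv (lmul D a y m)) => ->.
by apply/funext => b; rewrite lmulE -e.
Qed.

Lemma iter_mat_psi_inv a y m z l e : iter e mat_psi_inv (y m) = z l ->
  iter e mat_psi_inv (lmul D a y m) = lmul D a z l.
Proof.
elim: e z l => [|e IHe] z l h.
  by apply/funext => b; rewrite [RHS]lmulE -h.
rewrite iterS.
rewrite (IHe (fun _ => iter e mat_psi_inv (y m)) l)//.
exact: lmul_mat_psi_inv.
Qed.

(** Products of operators of this kind are of this kind: the leading coefficient is
    only followed as long as it is supported on the first component, where [x_1]
    acts as the last polynomial generator up to lower terms. *)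
Definition leads e o := raises e o /\
  forall m phi, deg_lt m.+1 phi -> (forall j, j != ord0 -> phi j m = 0) ->
    (forall j, j != ord0 -> o phi j (m + e)%N = 0) /\
    o phi ord0 (m + e)%N = iter e mat_psi_inv (phi ord0 m).

Lemma leads1 : leads 0 1.
Proof. by split=> [|m phi _ h]; [exact: raises1 | rewrite addn0]. Qed.

Lemma leadsM e e' o o' : leads e o -> leads e' o' -> leads (e + e') (o * o').
Proof.
move=> [h1 h2] [h1' h2']; split=> [|m phi hphi h0]; first exact: raisesM.
have [z v] := h2' m phi hphi h0; have := h1' _ _ hphi; rewrite addSn => hd.
have [z' v'] := h2 _ _ hd z.
have -> : (m + (e + e') = m + e' + e)%N by rewrite -addnA [(e' + e)%N]addnC.
by split=> [j j0|]; [exact: z' | rewrite endo_mulE v' v -iterD].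
Qed.

Lemma leads_lower e e' o o' : (e' < e)%N -> leads e o -> raises e' o' -> leads e (o - o').
Proof.
move=> ee' [h1 h2] h'; split=> [|m phi hphi h0].
  by apply: (raisesD h1); apply: raisesN; exact: (raises_le (ltnW ee')).
have low j : (o - o') phi j (m + e)%N = o phi j (m + e)%N.
  have z : o' phi j (m + e)%N = 0 by apply: (h' _ _ hphi); rewrite addSnnS leq_add2l.
  by rewrite -[LHS]/(o phi j (m + e)%N - o' phi j (m + e)%N) z subr0.
have [z v] := h2 m phi hphi h0.
by split=> [j j0|]; rewrite low//; exact: z.
Qed.

Lemma to_last_neq i j : i != j -> exists l, to_last j i = up l.
Proof.
by case: (unliftP j i) => [l -> _|->]; [exists l; rewrite to_last_lift | rewrite eqxx].
Qed.

Lemma leads_X : leads 1 (X ord0).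
Proof.
split=> [|m phi hphi h0]; first exact: raises_X.
have Xm j : X ord0 phi j (m + 1)%N = ind_Z0 A ord0 phi j (m + 1)%N.
  pose w : endo V := \sum_(l | l != ord0) swap_tele R l ord0 * comp_proj D Q ord0.
  have z : w phi j (m + 1)%N = 0.
    by apply: (@raises_Z_tail ord0 _ _ hphi); rewrite addn0 addn1.
  rewrite -[X ord0]/(ind_Z0 A ord0 - w + jucys R ord0) jucys_first addr0.
  by rewrite -[LHS]/(ind_Z0 A ord0 phi j (m + 1)%N - w phi j (m + 1)%N) z subr0.
split=> [j j0|]; rewrite Xm mono1E.
  have [l ->] : exists l, to_last j ord0 = up l by apply: to_last_neq; rewrite eq_sym.
  by rewrite par_Z_up (yraises_lmul _ (hphi j))// addn0 addn1.
by rewrite to_last_id par_Z_max addn1.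
Qed.

Lemma leads_prod J (r : seq J) (P : pred J) (o : J -> endo V) (e : J -> nat) :
  (forall l, P l -> leads (e l) (o l)) ->
  leads (\sum_(l <- r | P l) e l)%N (\prod_(l <- r | P l) o l).
Proof.
move=> h; elim/big_rec2: _ => [|l o' e' Pl]; first exact: leads1.
by apply: leadsM; exact: h.
Qed.

Lemma leads_chi : leads d chi.
Proof.
rewrite /level /chi_at big_nat_cond [X in leads _ X]big_nat_cond.
apply: leads_prod => m /andP[/andP[m0 _] _].
have -> : (m * cy_e C m = \sum_(1 <= j < (cy_e C m).+1) m)%N.
  by rewrite sum_nat_const_nat subSS subn0 mulnC.
apply: leads_prod => j _; apply: (leads_lower m0 _ (raises_T _ _)).
elim: m {m0} => [|m IHm]; first by rewrite expr0; exact: leads1.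
by rewrite exprS; exact: (leadsM leads_X IHm).
Qed.

Definition restricts o (a : Q) := forall u, o * at_last u = at_last (lmul D a * u).

Lemma restricts1 : restricts 1 1.
Proof. by move=> u; rewrite lmul1 !mul1r. Qed.

Lemma restrictsM o o' a a' : restricts o a -> restricts o' a' -> restricts (o * o') (a * a').
Proof. by move=> h h' u; rewrite -mulrA h' h lmulM mulrA. Qed.

Lemma restrictsD o o' a a' : restricts o a -> restricts o' a' -> restricts (o + o') (a + a').
Proof. by move=> h h' u; rewrite mulrDl h h' lmulD mulrDl at_lastD. Qed.

Lemma restrictsN o a : restricts o a -> restricts (- o) (- a).
Proof.
move=> h u; rewrite mulNr h lmulN mulNr; apply/eqP.
by rewrite eq_sym -addr_eq0 -at_lastD addNr at_last0.
Qed.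

Lemma restricts_X (l : 'I_n) : restricts (X (up l)) (aX A l).
Proof. by move=> u; rewrite [LHS]ind_X_at_last par_X_up. Qed.

Lemma restricts_T (l : 'I_n) f : restricts (T (up l) f) (wT A l f).
Proof. by move=> u; rewrite [LHS]ind_T_at_last par_T_up. Qed.

Lemma restricts_S (s : 'S_n) : restricts (S (up_perm s)) (wS A s).
Proof. by move=> u; rewrite [LHS]ind_S_at_last. Qed.

(** A permutation fixing the first position reduces to the last component.  There
    [chi] acts through [chi] of [Q], provided that the first position is not the
    last one; and this is zero. *)
Lemma chi_comp_proj i : i != ord0 -> chi * comp_proj D Q i = 0.
Proof.
move=> i0; have [m0|max0] := eqVneq (ord_max : 'I_n.+1) ord0.
  have n0 : n = 0%N := congr1 val m0; have le_in : (i <= n)%N by rewrite -ltnS.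
  have := leq_trans le_in (eq_leq n0); rewrite leqn0 => /eqP i0'.
  by case/eqP: i0; apply/val_inj.
pose s := tperm ord_max i; have s0 : s ord0 = ord0 by rewrite tpermD// eq_sym.
have -> : comp_proj D Q i = S s * comp_proj D Q ord_max * S s^-1%g.
  by rewrite comp_proj_S tpermL -mulrA wS_invr mulr1.
rewrite 2!mulrA -(S_fix_chi C R s0).
suff c0 : chi * comp_proj D Q ord_max = 0 by rewrite -[S s * _ * _]mulrA c0 mulr0 mul0r.
case: (upP (ord0 : 'I_n.+1)) => [e|[l e]]; first by rewrite -e eqxx in max0.
have l0 : l = 0%N :> nat by have := congr1 val e; rewrite [val (up l)]up_val.
suff h : restricts chi (chi_at C A l).
  by rewrite -at_last1 h (cr_chi A l0) lmul0 mul0r at_last0.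
rewrite /chi_at e; elim/big_rec2: _ => [|m a o _ h]; first exact: restricts1.
apply: restrictsM h; elim/big_rec2: _ => [|j a' o' _]; first exact: restricts1.
apply: restrictsM; apply: restrictsD; last exact/restrictsN/restricts_T.
elim: m => [|m IHm]; first by rewrite !expr0; exact: restricts1.
by rewrite !exprS; exact: (restrictsM (restricts_X l) IHm).
Qed.

(** On the first component the sum reduces to [chi]. *)
Lemma chi_sum_first : chi_sum C R * comp_proj D Q ord0 = chi.
Proof.
rewrite /chi_sum mulr_suml (bigD1 ord0)//= big1 ?addr0 => [|j j0].
  rewrite /chi_conj tperm1 wS1 mul1r mulr1.
  rewrite -[RHS]mulr1 -(sum_comp_proj D n Q) mulr_sumr (bigD1 ord0)//= big1 ?addr0//.
  by move=> i; exact: chi_comp_proj.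
rewrite /chi_conj -mulrA comp_proj_S tpermL mulrA -[_ * chi * _]mulrA chi_comp_proj//.
by rewrite mulr0 mul0r.
Qed.

Lemma raises_chi_sum : raises d (chi_sum C R).
Proof.
apply: raises_sum => j _; have [hc _] := leads_chi.
by have := raisesM (raisesM (raises_S (tperm ord0 j)) hc) (raises_S (tperm ord0 j)); rewrite addn0.
Qed.

(** [chi_sum] is monic of degree [d], up to the twist. *)
Lemma chi_sum_lead m phi j : deg_lt m.+1 phi ->
  chi_sum C R phi j (m + d)%N = iter d mat_psi_inv (phi j m).
Proof.
move=> hphi; rewrite /chi_sum endo_sumE.
rewrite [LHS](_ : _ = \sum_i (chi_conj C R i phi j (m + d)%N)); last first.
  by elim: (index_enum _) => [|i r IHr]; rewrite ?big_nil// !big_cons -IHr.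
have [hc lc] := leads_chi.
have term i : exists eta, [/\ deg_lt m.+1 eta,
    forall l, l != ord0 -> eta l m = 0,
    eta ord0 = par_S A (perm_del (tperm ord0 i) i) (phi i) &
    chi_conj C R i phi = S (tperm ord0 i) (chi eta)].
  exists ((comp_proj D Q ord0 * S (tperm ord0 i)) phi).
  have hS := @raises_S (tperm ord0 i) _ _ hphi; rewrite addn0 in hS.
  split.
  - by have := @raises_comp_proj ord0 _ _ hS; rewrite addn0.
  - by move=> l /negPf l0; rewrite endo_mulE mono1E l0.
  - by rewrite endo_mulE mono1E eqxx endo_oneE -S_comp tpermR.
  have chi0 : chi = chi * comp_proj D Q ord0.
    rewrite -[LHS]mulr1 -(sum_comp_proj D n Q) mulr_sumr (bigD1 ord0)//= big1 ?addr0//.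
    by move=> l; exact: chi_comp_proj.
  by rewrite /chi_conj {1}chi0 -!mulrA.
rewrite (bigD1 j)// big1 => [|i ij]; last first.
  have [eta [h1 h2 _ ->]] := term i; have [z _] := lc m eta h1 h2.
  rewrite -[in LHS](tpermK ord0 i j) S_comp.
  have wj : tperm ord0 i j != ord0.
    by rewrite -[X in _ != X](tpermR ord0 i) (inj_eq perm_inj) eq_sym.
  by apply/funext => b; rewrite lmulE z//; exact: mulr0.
rewrite [LHS]addr0; have [eta [h1 h2 h3 ->]] := term j; have [_ v] := lc m eta h1 h2.
pose w := tperm ord0 j; pose z : Y := fun _ => iter d mat_psi_inv (phi j m).
have e2 : chi eta ord0 (m + d)%N = par_S A (perm_del w j) z m.
  by rewrite v h3; apply: iter_mat_psi_inv.
have e1 : par_S A (perm_del w ord0) * par_S A (perm_del w j) = 1.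
  rewrite -par_SM -[X in (_ * perm_del w X)%g](tpermR ord0 j) -perm_del_mul tperm2.
  by rewrite perm_del1 par_S1.
rewrite -[X in S _ _ X](tpermL ord0 j) S_comp.
transitivity ((par_S A (perm_del w ord0) * par_S A (perm_del w j)) z m).
  by apply/funext => b; rewrite endo_mulE [LHS]lmulE e2.
by rewrite e1.
Qed.

Local Notation W := (fun phi => exists2 xi, fin xi & phi = chi_sum C R xi).

(** Long division: the leading coefficient can be reached since [psi] is
    invertible. *)
Lemma div_exists phi : fin phi -> exists2 r, deg_lt d r & W (phi - r).
Proof.
move=> [m]; elim: m phi => [|m IHm] phi hphi.
  by exists phi; [exact: deg_lt_le hphi | exists 0; rewrite ?subrr ?endo0//; exact: fin0].
have [md|dm] := ltnP m d.
  by exists phi; [exact: deg_lt_le hphi | exists 0; rewrite ?subrr ?endo0//; exact: fin0].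
pose xi : V := fun j a => if a == (m - d)%N then iter d mat_psi (phi j m) else 0.
have hxi : deg_lt (m - d).+1 xi.
  by move=> j a ma; rewrite /xi gtn_eqF.
have iterK e v : iter e mat_psi_inv (iter e mat_psi v) = v.
  by elim: e v => // e IHe v; rewrite iterSr iterS mat_psiK IHe.
have h : deg_lt m (phi - chi_sum C R xi).
  move=> j a; rewrite leq_eqVlt => /orP[/eqP <-|ma];
    rewrite -[LHS]/(phi j _ - chi_sum C R xi j _).
    have := chi_sum_lead j hxi; rewrite subnK// => ->.
    by rewrite /xi eqxx iterK subrr.
  rewrite hphi// (raises_chi_sum hxi) ?subr0//.
  by rewrite addSn subnK.
have [r hr [zeta hz e]] := IHm _ h; exists r => //; exists (xi + zeta).
  by apply: finD => //; exists (m - d).+1.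
by rewrite endoD -e [in RHS]addrAC [RHS]addrC subrK.
Qed.

(** A nonzero multiple of an element with invertible leading coefficient has at
    least its degree. *)
Lemma div_unique xi : fin xi -> deg_lt d (chi_sum C R xi) -> xi = 0.
Proof.
move=> [m]; elim: m => [|m IHm] hxi ht.
  by apply/funext => j; apply/funext => a; exact: hxi.
apply: IHm => // j a; rewrite leq_eqVlt => /orP[/eqP <-|]; last exact: hxi.
have := chi_sum_lead j hxi; rewrite ht ?leq_addl// => /esym.
have iterK e v : iter e mat_psi (iter e mat_psi_inv v) = v.
  by elim: e v => // e IHe v; rewrite iterSr iterS mat_psi_invK IHe.
move=> /(congr1 (iter d mat_psi)); rewrite iterK => ->.
elim: (d) => //= e ->.
exact: (congr1 (fun y : Y => y 0%N) (endo0 (fmat psi))).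
Qed.

End Division.

(** * The action of the cyclotomic quotient *)

Section CyclotomicQuotient.
Variables (k : comNzRingType) (D : wreath_data k) (C : cyclo_data D).
Local Notation I := (wd_I D).
Variables (n : nat) (Q : superalg k) (A : cyc_rep C n Q).
Local Notation Y := (nat -> I -> kmod Q).
Local Notation V := ('I_n.+1 -> Y).
Local Notation R := (ind_affine A).
Local Notation T := (wT R).
Local Notation S := (wS R).
Local Notation X := (aX R).
Local Notation chi := (chi_at C R ord0).
Implicit Types (i j : 'I_n.+1) (s : 'S_n.+1) (phi xi eta : V) (o : endo V).

Definition chi_image phi := exists2 xi, fin xi & phi = chi_sum C R xi.
Local Notation W := chi_image.

Lemma chi_image0 : W 0.
Proof. by exists 0; [exact: fin0 | rewrite endo0]. Qed.

Lemma chi_imageD phi xi : W phi -> W xi -> W (phi + xi).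
Proof.
move=> [a fa ->] [b fb ->]; exists (a + b); first exact: finD.
by rewrite endoD.
Qed.

Lemma chi_imageN phi : W phi -> W (- phi).
Proof. by move=> [a fa ->]; exists (- a); [exact: finN | rewrite endoN]. Qed.

Lemma chi_image_sum J (r : seq J) (P : pred J) (phi : J -> V) :
  (forall l, P l -> W (phi l)) -> W (\sum_(l <- r | P l) phi l).
Proof.
by move=> h; apply: (big_ind W) => //; [exact: chi_image0 | exact: chi_imageD].
Qed.

Lemma chi_image_S s phi : W phi -> W (S s phi).
Proof.
move=> [xi hxi ->]; exists (S s xi); first exact: raises_fin (raises_S A s) hxi.
by have := congr1 (fun o : endo V => o xi) (S_chi_sum C R s).
Qed.

Lemma chi_image_chi s eta : fin eta -> W (S s (chi eta)).
Proof.
move=> heta; apply: chi_image_S; exists (comp_proj D Q ord0 eta).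
  exact: raises_fin (@raises_comp_proj _ _ _ _ _) heta.
by have := congr1 (fun o : endo V => o eta) (chi_sum_first A).
Qed.

(** The image is spanned by the vectors [s chi eta], for which the relations
    between [chi] and the generators are at hand. *)
Lemma chi_image_stable o :
  (forall s eta, fin eta -> W (o (S s (chi eta)))) -> forall phi, W phi -> W (o phi).
Proof.
move=> ho phi [xi hxi ->]; rewrite endo_sumE endo_sum; apply: chi_image_sum => j _.
by apply: ho; exact: raises_fin (raises_S _ _) hxi.
Qed.

Lemma chi_image_T i f phi : W phi -> W (T i f phi).
Proof.
apply: chi_image_stable => s eta heta.
have [f' e'] := T_chi C R (s^-1%g i) f.
have -> : T i f (S s (chi eta)) = S s (chi (T (s^-1%g i) f' eta)).
  have e := wST R s (s^-1%g i) f; rewrite permKV in e.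
  have : T i f * S s * chi = S s * chi * T (s^-1%g i) f' by rewrite -e -mulrA e' mulrA.
  by move=> /(congr1 (fun o : endo V => o eta)).
by apply: chi_image_chi; exact: raises_fin (raises_T A _ _) heta.
Qed.

Lemma chi_image_swap i j phi : W phi -> W (swap_tele R i j phi).
Proof.
move=> hphi; have hS := chi_image_S (tperm i j) hphi.
rewrite /swap_tele endo_mulE endo_sumE; apply: chi_image_sum => b _.
by rewrite endo_mulE; do 2!apply: chi_image_T.
Qed.

Lemma chi_image_jucys i phi : W phi -> W (jucys R i phi).
Proof.
by move=> hphi; rewrite endo_sumE; apply: chi_image_sum => j _; exact: chi_image_swap.
Qed.

(** Moving [x_i] past [s] creates Jucys-Murphy elements, under which the image is
    already stable. *)
Lemma chi_image_X i phi : W phi -> W (X i phi).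
Proof.
apply: chi_image_stable => s eta heta; set i' := s^-1%g i.
have -> : X i (S s (chi eta)) =
    S s (chi (X i' eta)) - S s (jucys R i' (chi eta)) + jucys R i (S s (chi eta)).
  have := x_mul_S (@aSX_far _ _ _ _ _ R) (@aSX _ _ _ _ _ R) s i.
  move=> /(congr1 (fun o : endo V => o (chi eta))); rewrite endo_mulE => ->.
  rewrite endo_addE !endo_mulE endo_subE endoB; congr (S s _ - _ + _).
  by have := congr1 (fun o : endo V => o eta) (X_chi C R i').
have hc : W (chi eta).
  by have := chi_image_chi 1%g heta; rewrite wS1.
apply: chi_imageD.
  apply: chi_imageD; first by apply: chi_image_chi; exact: raises_fin (raises_X A _) heta.
  by apply/chi_imageN/chi_image_S/chi_image_jucys.
exact/chi_image_jucys/chi_image_chi.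
Qed.

Lemma chi_image_scal c phi : W phi -> W (c *: phi).
Proof.
move=> [xi [m h] ->]; exists (c *: xi); last by rewrite endoZ.
by exists m => j a ma; rewrite -[LHS]/(c *: xi j a) h// scaler0.
Qed.

Local Notation ev := (aeval (endo_scal V) (rep_gen R)).

Lemma chi_image_eval t phi : W phi -> W (ev t phi).
Proof.
elim: t phi => [c|[i|f|s]|t IHt u IHu|t IHt u IHu] phi hphi /=.
- exact: chi_image_scal.
- exact: chi_image_X.
- rewrite /tens_prod; elim: (index_enum _) => [|i r IHr]; first by rewrite big_nil.
  by rewrite big_cons; exact: chi_image_T.
- exact: chi_image_S.
- by apply: chi_imageD; [exact: IHt | exact: IHu].
- exact/IHt/IHu.
Qed.

(** Congruent expressions act in the same way modulo the image of [chi_sum]. *)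
Lemma ev_cong t u : acong (@cyc_rel k D C n) t u ->
  forall phi, fin phi -> W (ev t phi - ev u phi).
Proof.
have eqW (a b : endo V) : a = b -> forall phi, fin phi -> W (a phi - b phi).
  by move=> -> phi _; rewrite subrr; exact: chi_image0.
elim=> {t u}.
- move=> t u [tu|-> ->]; first by apply: eqW; exact: (ev_awp (@endo_scalC _ _) R tu).
  move=> phi hphi; rewrite (aeval_chi C R) /= scale0r subr0.
  by have := chi_image_chi 1%g hphi; rewrite wS1.
- by move=> t; exact: eqW.
- by move=> t u _ IH phi hphi; rewrite -opprB; exact/chi_imageN/IH.
- move=> t u v _ IHt _ IHu phi hphi; rewrite -(subrKA (ev u phi)).
  by apply: chi_imageD; [exact: IHt | exact: IHu].
- move=> t u t' u' _ IH _ IH' phi hphi /=; rewrite opprD addrACA.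
  by apply: chi_imageD; [exact: IH | exact: IH'].
- move=> t u t' u' _ IH _ IH' phi hphi /=.
  rewrite -(subrKA (ev t (ev u' phi))) -endoB; apply: chi_imageD.
    exact/chi_image_eval/IH'.
  exact/IH/fin_eval.
- by move=> t u v; apply: eqW; exact: addrA.
- by move=> t u; apply: eqW; exact: addrC.
- by move=> t; apply: eqW; rewrite /= rmorph0 add0r.
- by move=> t; apply: eqW; rewrite /= rmorphN rmorph1 mulN1r addNr rmorph0.
- by move=> t u v; apply: eqW; exact: mulrA.
- by move=> t; apply: eqW; rewrite /= rmorph1 mul1r.
- by move=> t u v; apply: eqW; exact: mulrDl.
- by move=> t u v; apply: eqW; exact: mulrDr.
- by move=> c e; apply: eqW; exact: rmorphD.
- by move=> c e; apply: eqW; exact: rmorphM.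
- by move=> c t; apply: eqW; exact: endo_scalC.
Qed.

End CyclotomicQuotient.

(** * Freeness of the next cyclotomic quotient *)

Section Freeness.
Variables (k : comNzRingType) (D : wreath_data k) (C : cyclo_data D).
Local Notation F := (wd_F D).
Local Notation G := (fr_gr (wd_F D)).
Local Notation tr := (fr_tr (wd_F D)).
Local Notation B := (wd_B D).
Local Notation Bv := (wd_Bv D).
Local Notation dg := (wd_deg D).
Local Notation I := (wd_I D).
Variables (n : nat) (Q : superalg k) (A : cyc_rep C n Q).
Local Notation P := (cyc_pos C n).
Local Notation AP := (cyc_affine C n).
Variable iota : superalg_hom Q P.
Hypothesis iota_X : forall l, iota (aX A l) = aX AP (up l).
Hypothesis iota_T : forall l f, iota (wT A l f) = wT AP (up l) f.
Hypothesis iota_S : forall s, iota (wS A s) = wS AP (up_perm s).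

Local Notation Y := (nat -> I -> kmod Q).
Local Notation V := ('I_n.+1 -> Y).
Local Notation R := (ind_affine A).
Local Notation d := (level C).
Local Notation scP := (sa_scal P).
Implicit Types (i j : 'I_n.+1) (s : 'S_n.+1) (phi xi eta : V) (o : endo V) (y : Y) (x : P).

Let PC c (a : P) : scP c * a = a * scP c. Proof. exact: sa_scalC. Qed.

Definition last_T (f : F) : P := wT AP ord_max f.
Definition last_x : P := aX AP ord_max.

Lemma iota_pass_T b a : iota a * last_T (B b) = last_T (B b) * iota (sgn_pass b a).
Proof.
elim/(@cr_ind _ _ _ _ _ A): a => [c|l|l f|s|a a' IH IH'|a a' IH IH'].
- by rewrite sgn_pass_scal sah_scal PC.
- by rewrite (sgn_pass_X A) iota_X aTX up_neq_max.
- have lm : up l != ord_max by rewrite eq_sym up_neq_max.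
  elim/(ghom_ind (G := G)): f => [|f f' IHf IHf'|g f fg].
  + rewrite (wT0 A) rmorph0 mul0r.
    suff -> : sgn_pass b (0 : Q) = 0 by rewrite rmorph0 mulr0.
    by rewrite -(rmorph0 (sa_scal Q)) sgn_pass_scal.
  + by rewrite wTD sgn_passD !rmorphD mulrDl mulrDr IHf IHf'.
  rewrite (sgn_pass_T A _ _ fg) rmorphM rmorph_sign iota_T.
  rewrite (wTC AP lm fg (wd_B_hom b)) mulrA commr_sign -mulrA.
  by rewrite andbC mulrA.
- by rewrite (sgn_pass_S A) iota_S wST up_perm_max.
- by rewrite sgn_passD !rmorphD mulrDl mulrDr IH IH'.
- by rewrite sgn_passM !rmorphM -mulrA IH' mulrA IH mulrA.
Qed.

(** The last generator differs from a covariant element by the Jucys-Murphy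
    element of all other positions, which commutes with their permutations. *)
Lemma iota_pass_x a : iota a * last_x = last_x * iota a.
Proof.
elim/(@cr_ind _ _ _ _ _ A): a => [c|l|l f|s|a a' IH IH'|a a' IH IH'].
- by rewrite sah_scal PC.
- by rewrite iota_X aXC.
- by rewrite iota_T aTX eq_sym up_neq_max.
- rewrite iota_S; set t := up_perm s.
  have t_max : t ord_max = ord_max by rewrite up_perm_max.
  have := covariant_sub_jucys (@aSX_far _ _ _ _ _ AP) (@aSX _ _ _ _ _ AP) t ord_max.
  rewrite t_max mulrBr mulrBl jucys_perm t_max.
  rewrite (eq_bigl (fun l : 'I_n.+1 => (l < (ord_max : 'I_n.+1))%N)) => [|l].
    by move/addIr.
  have lt_max (m : 'I_n.+1) : (m < (ord_max : 'I_n.+1))%N = (m != ord_max).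
    by rewrite -(inj_eq val_inj) /= ltn_neqAle -ltnS ltn_ord andbT.
  by rewrite !lt_max -(inj_eq (@perm_inj _ t)) permKV t_max.
- by rewrite !rmorphD mulrDl mulrDr IH IH'.
- by rewrite !rmorphM -mulrA IH' mulrA IH mulrA.
Qed.

Lemma iota_pass b a m :
  iota a * (last_T (B b) * last_x ^+ m) =
  last_T (B b) * last_x ^+ m * iota (sgn_pass b a).
Proof.
rewrite mulrA iota_pass_T -!mulrA; congr (_ * _).
elim: m => [|m IHm]; first by rewrite expr0 mulr1 mul1r.
by rewrite exprS mulrA iota_pass_x -mulrA IHm mulrA.
Qed.

(** ** Values of polynomial vectors *)

(** The value of a polynomial vector in the algebra, truncated at degree [m]. *)
Definition last_sum m y : P :=
  \sum_(a < m) \sum_(b : I) last_T (B b) * last_x ^+ a * iota (y a b : Q).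
Definition coset_rep j : 'S_n.+1 := (to_last j)^-1%g.
Definition total_sum m phi : P :=
  \sum_j wS AP (coset_rep j) * last_sum m (phi j).

Lemma last_sum_lmul m a y : last_sum m (lmul D a y) = iota a * last_sum m y.
Proof.
rewrite /last_sum mulr_sumr; apply: eq_bigr => e _.
rewrite mulr_sumr; apply: eq_bigr => b _.
by rewrite mulrA iota_pass lmulE rmorphM mulrA.
Qed.

Lemma last_T_scal c f (a : Q) :
  last_T (c *: f) * iota a = last_T f * iota (c *: (a : kmod Q) : Q).
Proof. by rewrite /last_T wTZ kmod_scaleE rmorphM sah_scal mulrA PC. Qed.

Lemma last_T_sum J (r : seq J) (f : J -> F) :
  last_T (\sum_(l <- r) f l) = \sum_(l <- r) last_T (f l).
Proof. exact: wT_sum. Qed.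

Lemma iota_sum J (r : seq J) (a : J -> kmod Q) :
  iota (\sum_(l <- r) a l : Q) = \sum_(l <- r) iota (a l : Q).
Proof. exact: rmorph_sum. Qed.

Lemma last_x_iota m a : last_x ^+ m * iota a = iota a * last_x ^+ m.
Proof.
elim: m => [|m IHm]; first by rewrite expr0 mulr1 mul1r.
by rewrite exprS -mulrA IHm mulrA -iota_pass_x -mulrA.
Qed.

Lemma last_sum_mat (g : F -> F) (v : I -> kmod Q) m :
  \sum_b last_T (B b) * last_x ^+ m * iota (\sum_(c : I) tr (Bv b * g (B c)) *: v c : Q) =
  \sum_c last_T (g (B c)) * last_x ^+ m * iota (v c : Q).
Proof.
under eq_bigr do rewrite iota_sum mulr_sumr.
rewrite exchange_big; apply: eq_bigr => c _ /=.
rewrite [in RHS](B_expand (g (B c))) last_T_sum !mulr_suml; apply: eq_bigr => b _.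
by rewrite -!mulrA !last_x_iota !mulrA last_T_scal.
Qed.

Lemma last_sum_mul m f y : last_sum m (fmat Q (fun z => f * z) y) = last_T f * last_sum m y.
Proof.
rewrite /last_sum mulr_sumr; apply: eq_bigr => e _.
rewrite last_sum_mat mulr_sumr; apply: eq_bigr => c _.
by rewrite !mulrA /last_T wTM.
Qed.

Lemma last_sum_x m y : last_sum m.+1 (last_X D Q y) = last_x * last_sum m y.
Proof.
rewrite /last_sum big_ord_recl big1 ?add0r => [|b _]; last by rewrite rmorph0 mulr0.
rewrite mulr_sumr; apply: eq_bigr => e _.
rewrite [LHS](last_sum_mat (@psi_inv k D) (y e)) mulr_sumr; apply: eq_bigr => c _.
rewrite lift0 exprS !mulrA; congr (_ * _ * _).
by rewrite /last_T aTX eqxx psiK.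
Qed.

Lemma coset_rep_mul s j : (s * to_last (s j) = to_last j * up_perm (perm_del s j))%g.
Proof. by apply/permP => i; rewrite !permM to_last_perm. Qed.

Lemma total_sum_S m s phi : total_sum m (wS R s phi) = wS AP s * total_sum m phi.
Proof.
rewrite /total_sum mulr_sumr (reindex_inj (@perm_inj _ s)); apply: eq_bigr => j _.
rewrite (S_comp A) last_sum_lmul iota_S !mulrA -!wSM; congr (wS AP _ * _).
by rewrite /coset_rep; apply: (mulIg (to_last (s j))); rewrite mulgKV -mulgA coset_rep_mul mulKg.
Qed.

Lemma total_sum_T m i f phi : total_sum m (wT R i f phi) = wT AP i f * total_sum m phi.
Proof.
rewrite /total_sum mulr_sumr; apply: eq_bigr => j _.
have e := wST AP (coset_rep j) (to_last j i) f; rewrite /coset_rep permK in e.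
rewrite mulrA -e -mulrA; congr (_ * _); rewrite -[wT R i f phi]/(ind_T A i f phi) mono1E.
case: (upP (to_last j i)) => [->|[l ->]].
  by rewrite par_T_max last_sum_mul.
by rewrite par_T_up last_sum_lmul iota_T.
Qed.

(** The truncations stabilize on polynomial vectors; a limit value avoids keeping
    track of how the operators raise degrees. *)
Definition evals phi x := fin phi /\ exists M, forall m, (M <= m)%N -> total_sum m phi = x.

Lemma total_sum_deg M m phi : deg_lt M phi -> (M <= m)%N ->
  total_sum m phi = total_sum M phi.
Proof.
move=> h /subnKC <-; elim: (m - M)%N => [|e IHe]; first by rewrite addn0.
rewrite addnS -IHe; apply: eq_bigr => j _; congr (_ * _).
rewrite {1}/last_sum big_ord_recr /= [X in _ + X]big1 ?addr0// => b _.
by rewrite (h j _ (leq_addr e M)) rmorph0 mulr0.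
Qed.

Lemma evals_deg M phi : deg_lt M phi -> evals phi (total_sum M phi).
Proof. by move=> h; split; [exists M | exists M => m; exact: total_sum_deg]. Qed.

Lemma evals_uniq phi x x' : evals phi x -> evals phi x' -> x = x'.
Proof.
move=> [_ [M h]] [_ [M' h']].
by rewrite -(h _ (leq_maxl M M')) -(h' _ (leq_maxr M M')).
Qed.

Lemma total_sumD m phi xi : total_sum m (phi + xi) = total_sum m phi + total_sum m xi.
Proof.
rewrite /total_sum -big_split; apply: eq_bigr => j _; rewrite -[RHS]mulrDr; congr (_ * _).
rewrite /last_sum -big_split; apply: eq_bigr => a _.
rewrite -[RHS]big_split; apply: eq_bigr => b _.
by rewrite -[RHS]mulrDr -rmorphD.
Qed.

Lemma total_sumN m phi : total_sum m (- phi) = - total_sum m phi.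
Proof.
apply/eqP; rewrite -addr_eq0 -total_sumD addNr; apply/eqP.
rewrite /total_sum big1// => j _; rewrite /last_sum big1 ?mulr0// => a _.
by rewrite big1// => b _; rewrite rmorph0 mulr0.
Qed.

Lemma evalsD phi xi x x' : evals phi x -> evals xi x' -> evals (phi + xi) (x + x').
Proof.
move=> [f [M h]] [f' [M' h']]; split; first exact: finD.
exists (maxn M M') => m; rewrite geq_max => /andP[/h e /h' e'].
by rewrite total_sumD e e'.
Qed.

Lemma evalsN phi x : evals phi x -> evals (- phi) (- x).
Proof.
move=> [f [M h]]; split; first exact: finN.
by exists M => m /h e; rewrite total_sumN e.
Qed.

Lemma evals0 : evals 0 0.
Proof.
split; first exact: fin0.
by exists 0%N => m _; rewrite -(subrr (0 : V)) total_sumD total_sumN subrr.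
Qed.

Lemma evals_sum J (r : seq J) (phi : J -> V) (x : J -> P) :
  (forall l, evals (phi l) (x l)) -> evals (\sum_(l <- r) phi l) (\sum_(l <- r) x l).
Proof.
move=> h; elim: r => [|l r IHr]; first by rewrite !big_nil; exact: evals0.
by rewrite !big_cons; exact: evalsD.
Qed.

Definition intertwines o x := forall phi x', evals phi x' -> evals (o phi) (x * x').

Lemma intertwinesM o o' x x' :
  intertwines o x -> intertwines o' x' -> intertwines (o * o') (x * x').
Proof. by move=> h h' phi z hz; rewrite -mulrA; exact/h/h'. Qed.

Lemma intertwines1 : intertwines 1 1.
Proof. by move=> phi z; rewrite mul1r. Qed.

Lemma intertwinesD o o' x x' :
  intertwines o x -> intertwines o' x' -> intertwines (o + o') (x + x').
Proof. by move=> h h' phi z hz; rewrite mulrDl; apply: evalsD; [exact: h|exact: h']. Qed.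

Lemma intertwines0 : intertwines 0 0.
Proof. by move=> phi z _; rewrite mul0r; exact: evals0. Qed.

Lemma intertwines_sum J (r : seq J) (p : pred J) (o : J -> endo V) (x : J -> P) :
  (forall l, intertwines (o l) (x l)) ->
  intertwines (\sum_(l <- r | p l) o l) (\sum_(l <- r | p l) x l).
Proof.
move=> h; apply: (big_ind2 intertwines) => //; first exact: intertwines0.
by move=> *; exact: intertwinesD.
Qed.

Lemma intertwines_S s : intertwines (wS R s) (wS AP s).
Proof.
move=> phi z [f [M h]]; split; first exact: raises_fin (raises_S A s) f.
by exists M => m /h <-; rewrite total_sum_S.
Qed.

Lemma intertwines_T i f : intertwines (wT R i f) (wT AP i f).
Proof.
move=> phi z [fp [M h]]; split; first exact: raises_fin (raises_T A i f) fp.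
by exists M => m /h <-; rewrite total_sum_T.
Qed.

Lemma intertwines_jucys i : intertwines (jucys R i) (jucys AP i).
Proof.
apply: intertwines_sum => l; apply: intertwinesM; last exact: intertwines_S.
by apply: intertwines_sum => b; apply: intertwinesM; exact: intertwines_T.
Qed.

Lemma intertwines_scal c : intertwines (endo_scal V c) (scP c).
Proof.
move=> phi z hz; have := intertwines_T ord0 (c *: 1) hz.
by rewrite !wTZ !wT1 !mulr1.
Qed.

Lemma total_sum_at_last m (u : endo Y) phi :
  total_sum m (at_last n u phi) = last_sum m (u (phi ord_max)).
Proof.
rewrite /total_sum (bigD1 ord_max)// big1 => [|j jm].
  by rewrite [LHS]addr0 /coset_rep to_last_max invg1 wS1 mul1r mono1E eqxx.
rewrite mono1E (negPf jm) /last_sum big1 ?mulr0// => a _; rewrite big1// => b _.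
by rewrite rmorph0 mulr0.
Qed.

Lemma evals_X_last i phi x :
  evals (at_last n 1 phi) x -> evals (aX R i (at_last n 1 phi)) (aX AP i * x).
Proof.
move=> [f [M h]]; split; first exact: raises_fin (raises_X A i) f.
have e : aX R i (at_last n 1 phi) = at_last n (par_X A i) phi.
  have := ind_X_at_last A i 1; rewrite mulr1.
  by move/(congr1 (fun o : endo V => o phi)).
exists M.+1 => -[//|m] Mm; rewrite e total_sum_at_last.
case: (upP i) => [->|[l ->]].
  rewrite par_X_max last_sum_x -(h m Mm) total_sum_at_last //.
by rewrite par_X_up last_sum_lmul iota_X -(h m.+1 (leqW Mm)) total_sum_at_last.
Qed.

(** For the polynomial generators this is clear on the last component.  The other
    components are its translates, and both sides obey the same rule for moving a
    generator past a permutation. *)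
Lemma intertwines_X i : intertwines (aX R i) (aX AP i).
Proof.
move=> phi x hx; have [[M hM] _] := hx.
pose w j := tperm ord_max j; pose eta j := (at_last n 1 * wS R (w j)^-1%g) phi.
have heta j : exists z, evals (eta j) z.
  have : fin (eta j).
    have hR := raisesM (@raises_comp_proj k D n Q ord_max) (raises_S A (w j)^-1%g).
    by apply: (raises_fin hR); exists M.
  by move=> [M' hM']; exists (total_sum M' (eta j)); exact: evals_deg.
have /choice[z hz] := heta.
have phiE : phi = \sum_j wS R (w j) (eta j).
  rewrite -[LHS]/((1 : endo V) phi) -(sum_comp_proj D n Q) endo_sumE.
  apply: eq_bigr => j _; rewrite /eta.
  rewrite -[RHS]/((wS R (w j) * (at_last n 1 * wS R (w j)^-1%g)) phi) mulrA at_last1.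
  by rewrite comp_proj_S tpermL -mulrA wS_invr mulr1.
have -> : x = \sum_j wS AP (w j) * z j.
  apply: evals_uniq hx _; rewrite {1}phiE; apply: evals_sum => j.
  exact: intertwines_S.
rewrite {1}phiE endo_sum mulr_sumr; apply: evals_sum => j.
have eR := x_mul_S (@aSX_far _ _ _ _ _ R) (@aSX _ _ _ _ _ R) (w j) i.
have eP := x_mul_S (@aSX_far _ _ _ _ _ AP) (@aSX _ _ _ _ _ AP) (w j) i.
rewrite -endo_mulE eR mulrA eP endo_addE mulrDl; apply: evalsD; last first.
  rewrite endo_mulE -mulrA; exact/intertwines_jucys/intertwines_S.
rewrite endo_mulE -mulrA; apply: intertwines_S; rewrite endo_subE mulrBl.
apply: evalsD; last exact/evalsN/intertwines_jucys.
exact: (evals_X_last _ (hz j : evals (at_last n 1 (wS R (w j)^-1%g phi)) (z j))).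
Qed.

Local Notation ev := (aeval (endo_scal V) (rep_gen R)).
Local Notation "[ t ]" := (aclass (@cyc_rel k D C n) t : P).

Lemma intertwines_eval t : intertwines (ev t) [t].
Proof.
rewrite aclass_eval; elim: t => [c|[i|f|s]|t IHt u IHu|t IHt u IHu] /=.
- exact: intertwines_scal.
- exact: intertwines_X.
- apply: (big_ind2 intertwines) => [|*|i _]; first exact: intertwines1.
    exact: intertwinesM.
  exact: intertwines_T.
- exact: intertwines_S.
- exact: intertwinesD.
- exact: intertwinesM.
Qed.

Lemma evals_chi_image phi : chi_image A phi -> evals phi 0.
Proof.
move=> [xi [M hM] ->]; have hchi : intertwines (chi_at C R ord0) 0.
  have := intertwines_eval (Defs.chi C n); rewrite (aeval_chi C R).
  suff -> : [Defs.chi C n] = 0 by [].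
  have -> : (0 : P) = [Scal _ 0] by exact/esym/(rmorph0 scP).
  by apply: aclass_rel; right.
have hsum : intertwines (chi_sum C R) 0.
  have -> : (0 : P) = \sum_(j : 'I_n.+1) 0 by rewrite big1.
  apply: intertwines_sum => j; rewrite -[0 : P](mul0r (wS AP (tperm ord0 j))).
  apply: intertwinesM (intertwines_S _); rewrite -[0 : P](mulr0 (wS AP (tperm ord0 j))).
  by apply: intertwinesM hchi; exact: intertwines_S.
by have := hsum _ _ (evals_deg hM); rewrite mul0r.
Qed.

(** ** The cyclic vector *)

Definition ymono m (v : I -> kmod Q) : Y := fun a => if a == m then v else 0.
Definition coords (f : F) (a : Q) : I -> kmod Q :=
  fun b => tr (Bv b * f) *: (a : kmod Q).
(** The vector 1: the component [j = ord_max] has coset representative 1, and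
    [coords 1 1] are the coordinates of the unit of [F]. *)
Definition unit_vec : V := fun j => if j == ord_max then ymono 0 (coords 1 1) else 0.

Lemma ymono_ext (u : endo Y) m m' v v' : (forall a, a != m' -> u (ymono m v) a = 0) ->
  u (ymono m v) m' = v' -> u (ymono m v) = ymono m' v'.
Proof.
move=> h0 h; apply/funext => a; rewrite /ymono -/(ymono m v).
by case: eqVneq => [->//|/h0].
Qed.

Lemma lmul_unit a : lmul D a (ymono 0 (coords 1 1)) = ymono 0 (coords 1 a).
Proof.
apply: ymono_ext => [m /negPf m0|].
  by apply/funext => b; rewrite lmulE /ymono m0; exact: mulr0.
apply/funext => b; rewrite lmulE /ymono eqxx /coords mulr1 !kmod_scaleE.
rewrite mulr1 -sa_scalC; case: (boolP (dg b).2) => bo; last by rewrite /sgn_pass (negPf bo).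
have -> : tr (Bv b) = 0 by apply: (tr_parity (Bv_hom b)); rewrite dual_parity.
by rewrite rmorph0 !mul0r.
Qed.

Lemma fmat_mono (g : {linear F -> F}) m f a :
  fmat Q g (ymono m (coords f a)) = ymono m (coords (g f) a).
Proof.
apply: ymono_ext => [l /negPf lm|]; apply/funext => b; rewrite fmatE.
  by rewrite /ymono lm big1// => c _; exact: scaler0.
rewrite /ymono eqxx /coords [in RHS](B_expand f) linear_sum mulr_sumr linear_sum.
rewrite scaler_suml; apply: eq_bigr => c _.
by rewrite scalerA linearZ /= -scalerAr linearZ /= mulrC.
Qed.

Lemma last_X_mono m a : last_X D Q (ymono m (coords 1 a)) = ymono m.+1 (coords 1 a).
Proof.
rewrite /last_X endo_mulE.
pose g : {linear F -> F} := HB.pack (@psi_inv k D)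
  (GRing.isLinear.Build _ _ _ _ (@psi_inv k D) (@psi_inv_lin k D)).
rewrite -[@psi_inv k D]/(g : F -> F) fmat_mono.
have -> : g 1 = 1 by rewrite -[RHS]psi_invK rmorph1.
by apply/funext => -[|l].
Qed.

Lemma last_X_exp_mono m a : (last_X D Q ^+ m) (ymono 0 (coords 1 a)) = ymono m (coords 1 a).
Proof.
elim: m => [//|m IHm]; by rewrite exprS endo_mulE IHm last_X_mono.
Qed.

Lemma evals_unit : evals unit_vec 1.
Proof.
have h : deg_lt 1 unit_vec.
  by move=> j a; rewrite /unit_vec; case: eqP => // _; case: a.
have := evals_deg h; congr evals.
rewrite /total_sum (bigD1 ord_max)// big1 => [|j /negPf jm]; last first.
  rewrite /unit_vec jm /last_sum big1 ?mulr0// => a _; rewrite big1// => b _.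
  by rewrite rmorph0 mulr0.
rewrite [LHS]addr0 /coset_rep to_last_max invg1 wS1 mul1r /unit_vec eqxx /last_sum big_ord1.
rewrite -[RHS](wT1 AP ord_max) [in RHS](B_expand (1 : F)) wT_sum.
apply: eq_bigr => b _; rewrite /ymono /coords /= expr0 mulr1 -last_T_scal //.
by rewrite rmorph1 mulr1.
Qed.

(** Every element is the value of an expression in the generators applied to the
    cyclic vector, and the value does not change on passing to the remainder. *)
Theorem total_sum_surj u : exists2 r, deg_lt d r & u = total_sum d r.
Proof.
elim/presalg_term: u => t; have ht := @intertwines_eval t _ _ evals_unit.
rewrite mulr1 in ht; have [ft _] := ht.
have [r hr hW] := div_exists A ft; exists r => //.
apply: evals_uniq ht _; rewrite -[ev t unit_vec](subrK r) -[X in evals _ X]add0r.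
by apply: evalsD; [exact: evals_chi_image | exact: evals_deg].
Qed.

(** An algebra element and an operator coming from one expression.  The
    element determines the action of the operator on polynomial vectors only
    modulo [chi_image]. *)
Definition represents (a : P) o := exists2 t, [t] = a & ev t = o.

Lemma representsD a a' o o' :
  represents a o -> represents a' o' -> represents (a + a') (o + o').
Proof. by move=> [t <- <-] [t' <- <-]; exists (Add t t'); rewrite ?aclassD. Qed.

Lemma representsM a a' o o' :
  represents a o -> represents a' o' -> represents (a * a') (o * o').
Proof. by move=> [t <- <-] [t' <- <-]; exists (Mul t t'); rewrite ?aclassM. Qed.

Lemma represents_scal c : represents (scP c) (endo_scal V c).
Proof. by exists (Scal _ c). Qed.

Lemma represents_sum J (r : seq J) (a : J -> P) (o : J -> endo V) :
  (forall l, represents (a l) (o l)) ->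
  represents (\sum_(l <- r) a l) (\sum_(l <- r) o l).
Proof.
move=> h; apply: (big_ind2 represents) => //; last by move=> *; exact: representsD.
by have := represents_scal 0; rewrite !rmorph0.
Qed.

Lemma represents_S s : represents (wS AP s) (wS R s).
Proof. by exists (eS D s). Qed.

Lemma represents_T i f : represents (wT AP i f) (wT R i f).
Proof. by exists (eT (at_pos i f)) => //=; exact: tens_prod_at. Qed.

Lemma represents_X i : represents (aX AP i) (aX R i).
Proof. by exists (eX D i). Qed.

Lemma represents_exp a o m : represents a o -> represents (a ^+ m) (o ^+ m).
Proof.
move=> h; elim: m => [|m IHm]; last by rewrite !exprS; exact: representsM.
by have := represents_scal 1; rewrite !rmorph1.
Qed.

Lemma represents_iota a : exists2 o, represents (iota a) o & restricts o a.
Proof.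
elim/(@cr_ind _ _ _ _ _ A): a => [c|l|l f|s|a a' [o h r] [o' h' r']|a a' [o h r] [o' h' r']].
- exists (endo_scal V c); first by rewrite sah_scal; exact: represents_scal.
  move=> u; rewrite lmul_scal -mono_scal mono_mul mulg1; apply: eq_mono => j.
  by case: eqP => // _; rewrite mulr0.
- exists (aX R (up l)); last exact: restricts_X.
  by rewrite iota_X; exact: represents_X.
- exists (wT R (up l) f); last exact: restricts_T.
  by rewrite iota_T; exact: represents_T.
- exists (wS R (up_perm s)); last exact: restricts_S.
  by rewrite iota_S; exact: represents_S.
- exists (o + o'); last exact: restrictsD.
  by rewrite rmorphD; exact: representsD.
- exists (o * o'); last exact: restrictsM.
  by rewrite rmorphM; exact: representsM.
Qed.

Lemma unit_vecE : unit_vec = at_last n 1 unit_vec.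
Proof. by apply/funext => j; rewrite mono1E /unit_vec; case: eqP. Qed.

Lemma coset_rep_comp j phi : wS R (coset_rep j) (at_last n 1 phi) =
  (fun i => if i == j then phi ord_max else 0).
Proof.
apply/funext => i; rewrite -[i](permKV (coset_rep j)) (S_comp A) mono1E.
set l := (coset_rep j)^-1%g i.
have e : (coset_rep j l == j) = (l == ord_max).
  rewrite -(inj_eq (@perm_inj _ (to_last j))) /coset_rep permKV to_last_id.
  by [].
rewrite e; case: eqVneq => [->|_]; last exact: endo0.
have -> : perm_del (coset_rep j) ord_max = 1%g.
  apply/permP => m; apply: (@lift_inj _ (coset_rep j ord_max)).
  rewrite lift_perm_del perm1; apply: (@perm_inj _ (to_last j)).
  rewrite /coset_rep permKV.
  have -> : (to_last j)^-1%g ord_max = j by rewrite -(to_last_id j) permK.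
  by rewrite to_last_lift.
by rewrite par_S1.
Qed.

(** An operator that represents [total_sum d r] maps the cyclic vector to [r].  If
    the sum is zero then so is [r] modulo the image of [chi_sum], which contains no
    nonzero vector of degree less than [d]. *)
Theorem total_sum_inj r : deg_lt d r -> total_sum d r = 0 -> r = 0.
Proof.
move=> hr r0.
have hc a : exists o, represents (iota a) o /\ restricts o a.
  by have [o h1 h2] := represents_iota a; exists o.
have /choice[oi hoi] := hc.
pose term j (a : 'I_d) (b : I) := wS R (coset_rep j) *
  (wT R ord_max (B b) * aX R ord_max ^+ a * oi (r j a b)).
have hrep : represents (total_sum d r) (\sum_j \sum_(a < d) \sum_b term j a b).
  apply: represents_sum => j; rewrite /last_sum mulr_sumr; apply: represents_sum => a.
  rewrite mulr_sumr; apply: represents_sum => b.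
  apply: representsM; first exact: represents_S.
  apply: representsM; last by have [] := hoi (r j a b).
  by apply: representsM; [exact: represents_T | apply: represents_exp; exact: represents_X].
have term_unit j a b : term j a b unit_vec =
    fun i => if i == j then ymono a (coords (B b) (r j a b : Q)) else 0.
  have [_ res] := hoi (r j a b).
  have X_last m u : aX R ord_max ^+ m * at_last n u = at_last n (last_X D Q ^+ m * u).
    elim: m => [|m IHm]; first by rewrite !expr0 !mul1r.
    by rewrite !exprS -mulrA IHm [LHS](ind_X_at_last A) par_X_max mulrA.
  pose u := fmat Q (fun z => B b * z) * (last_X D Q ^+ a * lmul D (r j a b : Q)).
  have opE : term j a b * at_last n 1 = wS R (coset_rep j) * (at_last n 1 * at_last n u).
    rewrite -at_lastM mul1r /term -!mulrA res mulr1 X_last.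
    by rewrite [wT R _ _ * at_last _ _](ind_T_at_last A) par_T_max.
  have -> : term j a b unit_vec = wS R (coset_rep j) (at_last n 1 (at_last n u unit_vec)).
    by rewrite {1}unit_vecE -endo_mulE opE.
  rewrite coset_rep_comp.
  apply/funext => i; case: eqP => // _; rewrite mono1E eqxx /unit_vec eqxx.
  rewrite !endo_mulE lmul_unit last_X_exp_mono.
  pose g : {linear F -> F} := HB.pack (fun z : F => B b * z)
    (GRing.isLinear.Build _ _ _ _ (fun z : F => B b * z) (mul_lin (B b))).
  by rewrite -[(fun z => _)]/(g : F -> F) fmat_mono /= mulr1.
have total_unit : (\sum_j \sum_(a < d) \sum_b term j a b) unit_vec = r.
  have sumE J (q : seq J) (phi : J -> V) i m c :
      (\sum_(l <- q) phi l) i m c = \sum_(l <- q) phi l i m c.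
    by elim: q => [|l q IHq]; rewrite ?big_nil// !big_cons -IHq.
  apply/funext => i; apply/funext => m; apply/funext => c.
  have coefE j (a : 'I_d) : (\sum_b term j a b) unit_vec i m c =
      if (i == j) && (m == a) then r i a c else 0.
    rewrite endo_sumE sumE; under eq_bigr do rewrite term_unit /ymono.
    case: eqVneq => [<-|_] /=; last by rewrite big1.
    case: eqP => _; last by rewrite big1.
    rewrite (bigD1 c)//= big1 ?addr0 => [|b bc]; rewrite /coords wd_BvP.
      by rewrite eqxx scale1r.
    by rewrite eq_sym (negPf bc) scale0r.
  have compE j : (\sum_(a < d) \sum_b term j a b) unit_vec i m c =
      if j == i then r i m c else 0.
    rewrite endo_sumE sumE; under eq_bigr do rewrite coefE; rewrite eq_sym.
    case: eqVneq => [_|_] /=; last by rewrite big1.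
    have [md|dm] := ltnP m d.
      rewrite (bigD1 (Ordinal md))//= eqxx big1 ?addr0// => a am.
      by case: eqP => // ma; case/eqP: am; apply/val_inj.
    rewrite big1 => [|a _]; first by rewrite (hr i m dm).
    by case: eqP => // ma; have := ltn_ord a; rewrite -ma ltnNge dm.
  rewrite endo_sumE sumE; under eq_bigr do rewrite compE.
  by rewrite -big_mkcond big_pred1_eq.
have [t t0 et] := hrep; rewrite r0 in t0.
have : acong (@cyc_rel k D C n) t (Scal _ 0).
  by apply/aclassP; rewrite t0; exact/esym/(rmorph0 scP).
have h1 : deg_lt 1 unit_vec.
  by move=> j a; rewrite /unit_vec; case: eqP => // _; case: a.
move=> /(ev_cong A) /(_ unit_vec (ex_intro _ 1%N h1)).
rewrite et total_unit /= scale0r subr0 => -[xi fxi e].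
by rewrite e (div_unique (A := A) fxi) ?endo0// -e.
Qed.

End Freeness.

(** * The tower of cyclotomic algebras *)

Section Levels.
Variables (k : comNzRingType) (D : wreath_data k) (C : cyclo_data D).
Local Notation F := (wd_F D).

Section Base.
Local Notation k0 := (base_superalg k).
Local Notation sc := (sa_scal k0).

Let T0 (i : 'I_0) (f : F) : k0 := 0.
Let S0 (s : 'S_0) : k0 := 1.
Let X0 (i : 'I_0) : k0 := 0.

Definition base_wreath : @wreath_rep k D 0 k0 sc.
Proof.
apply: (@WreathRep k D 0 k0 sc T0 S0) => [[]//|[]//|[]//|[]//|[]//|//|s t|s []//].
by rewrite mulr1.
Defined.

Definition base_affine : @affine_rep k D 0 k0 sc.
Proof. by apply: (@AffineRep k D 0 k0 sc base_wreath X0) => [[]//|[]//|[]//|[]//]. Defined.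

Definition base_rep : cyc_rep C 0 k0.
Proof.
apply: (@CycRep k D C 0 k0 base_affine) => [[]//|[]//|s|P Psc _ _ _ _ _ a|[]//].
  exact: base_scal_hom.
exact: (Psc a).
Defined.

End Base.

Section Step.
Variable n : nat.
Local Notation A := (cyc_affine C n).

Lemma cyc_affine_ind (P : cyc_pos C n -> Prop) : (forall c, P (sa_scal _ c)) ->
  (forall i, P (aX A i)) -> (forall i f, P (wT A i f)) -> (forall s, P (wS A s)) ->
  (forall a b, P a -> P b -> P (a + b)) -> (forall a b, P a -> P b -> P (a * b)) ->
  forall a, P a.
Proof.
move=> Psc PX PT PS PD PM a; elim/presalg_term: a => t.
rewrite [aclass _ _](aclass_eval C t).
elim: t => [c|[i|f|s]|t IHt u IHu|t IHt u IHu] /=.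
- exact: Psc.
- exact: PX.
- apply: (big_ind P) => [|a b|i _]; [|exact: PM|exact: PT].
  by have := Psc 1; rewrite rmorph1.
- exact: PS.
- exact: PD.
- exact: PM.
Qed.

Lemma cyc_affine_chi : chi_at C A ord0 = 0.
Proof.
rewrite -(aeval_chi C A) -(aclass_eval C); transitivity (sa_scal (cyc_pos C n) 0).
  by apply: aclass_rel; right.
exact: rmorph0.
Qed.

Definition step_rep : cyc_rep C n.+1 (cyc_pos C n).
Proof.
apply: (@CycRep k D C n.+1 (cyc_pos C n) A) => [i|i g f fg|s||i i0].
- by apply: (@cyc_hom k D C n _ (eX D i)); exact: ehom_X.
- by apply: (@cyc_hom k D C n _ (eT (at_pos i f))); exact: ehom_at_pos.
- by apply: (@cyc_hom k D C n _ (eS D s)); exact: ehom_S.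
- exact: cyc_affine_ind.
- have -> : i = ord0 by apply/val_inj.
  exact: cyc_affine_chi.
Defined.

End Step.

Definition level_rep (n : nat) : cyc_rep C n (cyc_alg C n) :=
  match n with 0 => base_rep | m.+1 => step_rep m end.

Section Inclusions.
Variable n : nat.
Local Notation AP := (cyc_affine C n).

Lemma cyc_incl_X l : cyc_incl C n (aX (level_rep n) l) = aX AP (up l).
Proof. by case: n l => [[]//|m] l; exact: incl_class. Qed.

Lemma cyc_incl_T l f : cyc_incl C n (wT (level_rep n) l f) = wT AP (up l) f.
Proof.
case: n l => [[]//|m] l; rewrite [LHS]incl_class /=.
by rewrite up_tens_at_pos.
Qed.

Lemma cyc_incl_S s : cyc_incl C n (wS (level_rep n) s) = wS AP (up_perm s).
Proof.
case: n s => [|m] s; last exact: incl_class.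
rewrite (_ : up_perm s = 1%g); first by rewrite [RHS]wS1; exact: rmorph1.
by rewrite (_ : s = 1%g); [exact: lift_perm1 | apply/permP => -[]].
Qed.

End Inclusions.

(** ** Bases *)

Local Notation d := (level C).
Local Notation J n := ('I_n.+1 * 'I_d * wd_I D)%type.

Definition last_elt n (l : 'I_d * wd_I D) : cyc_alg C n.+1 :=
  last_T C n (wd_B D l.2) * last_x C n ^+ l.1.

Definition basis_elt n (l : J n) : cyc_alg C n.+1 :=
  wS (cyc_affine C n) (coset_rep l.1.1) * last_elt n (l.1.2, l.2).

(** The families of coefficients cut off at the level are the functions on the
    index set of the basis. *)
Lemma basis_sum n (r : 'I_n.+1 -> nat -> wd_I D -> kmod (cyc_alg C n)) :
  total_sum (cyc_incl C n) d r =
  \sum_l basis_elt l * cyc_incl C n (r l.1.1 l.1.2 l.2 : cyc_alg C n).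
Proof.
rewrite /total_sum; under eq_bigr do rewrite /last_sum mulr_sumr.
under eq_bigr do under eq_bigr do rewrite mulr_sumr.
rewrite pair_bigA /= pair_bigA /=; apply: eq_bigr => -[[j a] b] _.
by rewrite mulrA.
Qed.

Lemma basis_surj n (u : cyc_alg C n.+1) : exists r : J n -> cyc_alg C n,
  u = \sum_l basis_elt l * cyc_incl C n (r l).
Proof.
have [r _ ->] := total_sum_surj (@cyc_incl_X n) (@cyc_incl_T n) (@cyc_incl_S n) u.
by exists (fun l : J n => r l.1.1 l.1.2 l.2); rewrite basis_sum.
Qed.

Lemma basis_inj n (r : J n -> cyc_alg C n) :
  \sum_l basis_elt l * cyc_incl C n (r l) = 0 -> forall l, r l = 0.
Proof.
move=> r0.
pose r' : 'I_n.+1 -> nat -> wd_I D -> kmod (cyc_alg C n) :=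
  fun j a b => if insub a is Some a' then r (j, a', b) else 0.
have r'E j (a : 'I_d) b : r' j a b = r (j, a, b) by rewrite /r' valK.
have hr' : deg_lt d r'.
  by move=> j a da; apply/funext => b; rewrite /r' insubN// -leqNgt.
have := total_sum_inj (@cyc_incl_X n) (@cyc_incl_T n) (@cyc_incl_S n) hr'.
rewrite basis_sum => H [[j a] b]; rewrite -r'E H// -[RHS]r0.
by apply: eq_bigr => -[[j' a'] b'] _; rewrite r'E.
Qed.

End Levels.

(** * Induction along a free extension *)

Section FreeInduction.
Variables (k : comNzRingType) (Q P : superalg k) (iota : superalg_hom Q P).
Variables (J : finType) (e : J -> P).
Hypothesis e_surj : forall u, exists r : J -> Q, u = \sum_l e l * iota (r l).
Hypothesis e_inj : forall r : J -> Q, \sum_l e l * iota (r l) = 0 -> forall l, r l = 0.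
Variable M : supermod Q.
Local Notation pure := (@pure Q P iota M).

Lemma pure_sumr (I : Type) (q : seq I) (p : pred I) u (m : I -> M) :
  pure u (\sum_(i <- q | p i) m i) = \sum_(i <- q | p i) pure u (m i).
Proof. by apply: big_morph; [exact: pureDr | exact: pure0r]. Qed.

Lemma pure_suml (I : Type) (q : seq I) (p : pred I) (u : I -> P) m :
  pure (\sum_(i <- q | p i) u i) m = \sum_(i <- q | p i) pure (u i) m.
Proof.
by apply: (big_morph (fun u => pure u m)) => [x y|]; [exact: pureDl | exact: pure0l].
Qed.

Lemma tensor_expand (x : tensor iota M) : exists m : J -> M, x = \sum_l pure (e l) (m l).
Proof.
elim/tensor_ind: x => [u m|x y [m ->] [m' ->]].
  have [r ->] := e_surj u; exists (fun l => r l *: m).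
  by rewrite pure_suml; apply: eq_bigr => l _; rewrite pureA.
exists (fun l => m l + m' l); rewrite -big_split.
by apply: eq_bigr => l _; rewrite pureDr.
Qed.

(** The coordinates with respect to a basis of the right module are right linear,
    hence extend to the tensor product. *)
Lemma tensor_expand_inj (m : J -> M) :
  \sum_l pure (e l) (m l) = 0 -> forall l, m l = 0.
Proof.
have /choice[c cP] := e_surj.
have cE u r l : u = \sum_l e l * iota (r l) -> c u l = r l.
  move=> ur; apply/eqP; rewrite -subr_eq0; apply/eqP.
  apply: (e_inj (r := fun l => c u l - r l)).
  under eq_bigr do rewrite rmorphB mulrBr.
  by rewrite sumrB -cP -ur subrr.
pose h l (u : P) (m : M) : M := c u l *: m.
have hDl l u u' m' : h l (u + u') m' = h l u m' + h l u' m'.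
  rewrite /h -scalerDl (cE _ (fun l => c u l + c u' l))// {1}(cP u) {1}(cP u').
  by rewrite -big_split; apply: eq_bigr => i _; rewrite rmorphD mulrDr.
have hDr l u m1 m2 : h l u (m1 + m2) = h l u m1 + h l u m2 by exact: scalerDr.
have hA l u a m' : h l (u * iota a) m' = h l u (a *: m').
  rewrite /h scalerA (cE _ (fun l => c u l * a))// {1}(cP u) mulr_suml.
  by apply: eq_bigr => i _; rewrite rmorphM mulrA.
move=> m0 l; have := congr1 (tlift (h l)) m0.
have lift_pure := @tlift_pure Q P iota M M (h l) (hDl l) (hDr l) (hA l).
have liftD := @tliftD Q P iota M M (h l) (hDl l) (hDr l) (hA l).
have lift0 : tlift (h l) (0 : tensor iota M) = 0.
  by rewrite -(@pure0l Q P iota M 0) lift_pure; exact: scaler0.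
rewrite lift0 (big_morph _ liftD lift0) (bigD1 l)//= big1 => [|i il].
  rewrite addr0 lift_pure /h (cE _ (fun i => (i == l)%:R)) ?eqxx ?scale1r//.
  rewrite (bigD1 l)//= big1 ?addr0 ?eqxx ?rmorph1 ?mulr1// => i /negPf ->.
  by rewrite rmorph0 mulr0.
rewrite lift_pure /h (cE _ (fun j => (j == i)%:R)) ?[l == i]eq_sym ?(negPf il) ?scale0r//.
rewrite (bigD1 i)//= big1 ?addr0 ?eqxx ?rmorph1 ?mulr1// => j /negPf ->.
by rewrite rmorph0 mulr0.
Qed.

End FreeInduction.

(** * The Mackey decomposition *)

Section Mackey.
Variables (k : comNzRingType) (D : wreath_data k) (C : cyclo_data D) (n : nat).
Local Notation F := (wd_F D).
Local Notation I := (wd_I D).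
Local Notation B := (wd_B D).
Local Notation d := (level C).
Local Notation Q1 := (cyc_alg C n).
Local Notation Q2 := (cyc_alg C n.+1).
Local Notation Q3 := (cyc_alg C n.+2).
Local Notation A2 := (cyc_affine C n).
Local Notation A3 := (cyc_affine C n.+1).
Local Notation i1 := (cyc_incl C n).
Local Notation i2 := (cyc_incl C n.+1).
Local Notation K := ('I_d * I)%type.
Local Notation J n := ('I_n.+1 * 'I_d * I)%type.
Local Notation p := (up (ord_max : 'I_n.+1)).
Local Notation q := (ord_max : 'I_n.+2).

Lemma i2_X l : i2 (aX A2 l) = aX A3 (up l).
Proof. exact: (@cyc_incl_X k D C n.+1 l). Qed.
Lemma i2_T l f : i2 (wT A2 l f) = wT A3 (up l) f.
Proof. exact: (@cyc_incl_T k D C n.+1 l f). Qed.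
Lemma i2_S s : i2 (wS A2 s) = wS A3 (up_perm s).
Proof. exact: (@cyc_incl_S k D C n.+1 s). Qed.

Lemma p_next : q = p.+1 :> nat.
Proof. by rewrite up_val. Qed.

Lemma pq : p != q.
Proof. by rewrite eq_sym up_neq_max. Qed.

(** The transposition of the two positions outside the smallest algebra. *)
Definition last_swap : Q3 := wS A3 (tperm p q).
Local Notation s := last_swap.
Local Notation bas := (@basis_elt k D C _).
Local Notation lst m := (@last_elt k D C m).

Lemma last_swap_comm z : i2 (i1 z) * s = s * i2 (i1 z).
Proof.
elim/(@cr_ind _ _ _ _ _ (level_rep C n)): z => [c|l|l f|t|a b IHa IHb|a b IHa IHb].
- by rewrite sah_scal sah_scal sa_scalC.
- rewrite cyc_incl_X i2_X; apply/esym/aSX_far; first exact: p_next.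
    by rewrite up_eq eq_sym up_neq_max.
  by rewrite eq_sym up_neq_max.
- rewrite cyc_incl_T i2_T [RHS]wST tpermD//.
    by rewrite up_eq up_neq_max.
  by rewrite up_neq_max.
- rewrite cyc_incl_S i2_S /s -!wSM; congr (wS A3 _).
  set u := up_perm _.
  have up_ : u p = p by rewrite /u up_permE up_perm_max.
  have uq : u q = q by rewrite /u up_perm_max.
  have := tpermJ p q u; rewrite up_ uq conjgE => e.
  by rewrite -[in RHS]e mulKVg.
- by rewrite !rmorphD mulrDl mulrDr IHa IHb.
- by rewrite !rmorphM -mulrA IHb mulrA IHa mulrA.
Qed.

Local Notation lsum := (last_sum i2).

Lemma i2_lsum m c y : i2 c * lsum m y = lsum m (lmul D c y).
Proof.
by rewrite (last_sum_lmul (A := level_rep C n.+1) i2_X i2_T i2_S).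
Qed.

Lemma T_x_pow (f : F) m : wT A3 p f * aX A3 q ^+ m = aX A3 q ^+ m * wT A3 p f.
Proof.
elim: m => [|m IHm]; first by rewrite !expr0 mul1r mulr1.
by rewrite !exprS mulrA aTX (negPf pq) -mulrA IHm mulrA.
Qed.

(** Moving a power of the polynomial generator through the last transposition
    replaces it by the same power of the last generator, and creates lower terms
    on the last position, with coefficients in the algebra without it. *)
Lemma x_pow_swap m : exists y,
  aX A3 p ^+ m * s = s * aX A3 q ^+ m + lsum m y.
Proof.
elim: m => [|m [y IHm]].
  by exists 0; rewrite /lsum big_ord0 addr0 !expr0 mul1r mulr1.
pose ym : nat -> I -> kmod Q2 := fun a b =>
  (if (a < m)%N then lmul D (aX A2 ord_max) y a b else - wT A2 ord_max (wd_Bv D b)).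
exists ym; rewrite exprS -mulrA IHm mulrDr mulrA.
have -> : aX A3 p * s = s * aX A3 q - tele A3 q p.
  by rewrite /s (xS_high (@aSX _ _ _ _ _ A3) p_next) addrK.
rewrite mulrBl exprS -mulrA -addrA; congr (_ + _).
rewrite -i2_X i2_lsum [RHS]big_ord_recr /= addrC; congr (_ + _).
  by apply: eq_bigr => a _; apply: eq_bigr => b _; rewrite /ym ltn_ord.
rewrite mulr_suml -sumrN; apply: eq_bigr => b _; rewrite /ym ltnn rmorphN mulrN.
congr (- _); rewrite -[LHS]mulrA -[RHS]mulrA; congr (_ * _).
by rewrite i2_T; exact: T_x_pow.
Qed.

Lemma coset_rep_max m (j : 'I_m.+1) : coset_rep j ord_max = j.
Proof. by rewrite -{1}(to_last_id j) /coset_rep permK. Qed.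

Lemma coset_rep_lift m (j : 'I_m.+1) l : coset_rep j (up l) = lift j l.
Proof. by rewrite -(to_last_lift j) /coset_rep permK. Qed.

(** Passing to one more position multiplies the representative by the last
    transposition: both sides send the last position to [j] and keep the order of
    the others. *)
Lemma coset_rep_up (j : 'I_n.+1) :
  coset_rep (up j) = (tperm p q * up_perm (coset_rep j))%g.
Proof.
apply/permP => i; rewrite permM; case: (upP i) => [->|[l ->]].
  by rewrite coset_rep_max tpermR up_permE coset_rep_max.
rewrite coset_rep_lift; case: (upP l) => [->|[l' ->]].
  rewrite tpermL up_perm_max; apply/val_inj.
  by rewrite -[LHS]/(bump (up j) n) up_val /bump -ltnS ltn_ord add1n.
rewrite tpermD ?up_eq ?up_neq_max// up_permE coset_rep_lift.
apply/val_inj; rewrite [RHS]up_val -[LHS]/(bump (up j) (up l')).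
by rewrite !up_val.
Qed.

Lemma coset_rep_last m : coset_rep (ord_max : 'I_m.+1) = 1%g.
Proof. by rewrite /coset_rep to_last_max invg1. Qed.

Lemma basis_last m (a : 'I_d) b : bas (ord_max, a, b) = lst m (a, b).
Proof. by rewrite /basis_elt coset_rep_last wS1 mul1r. Qed.

Lemma lsumE y : lsum d y = \sum_l lst n.+1 l * i2 (y l.1 l.2 : Q2).
Proof. by rewrite /last_sum pair_bigA; apply: eq_bigr => -[a b] _. Qed.

(** The basis elements of the larger algebra come in two kinds: those with
    representative 1, and those that arise from the basis one level below,
    multiplied by the last transposition, up to terms of the first kind. *)
Lemma basis_swap (l : J n) : exists r : K -> Q2,
  i2 (bas l) * s =
  bas (up l.1.1, l.1.2, l.2) + \sum_h lst n.+1 h * i2 (r h).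
Proof.
case: l => -[j a] b /=; have [y ye] := x_pow_swap a.
suff [z ze] : exists z, i2 (bas (j, a, b)) * s =
    bas (up j, a, b) + lsum d z.
  by exists (fun h : K => z h.1 h.2); rewrite ze lsumE.
(* The lower terms have degree less than [a], hence less than the level. *)
pose y' : nat -> I -> kmod Q2 := fun m => if (m < a)%N then y m else 0.
have yE : lsum a y = lsum d y'.
  suff key M : lsum a y = lsum (a + M) y' by rewrite (key (d - a)%N) subnKC// ltnW.
  elim: M => [|M IHM].
    by rewrite addn0; apply: eq_bigr => m _; apply: eq_bigr => c _; rewrite /y' ltn_ord.
  rewrite addnS IHM [RHS]big_ord_recr /= [X in _ + X]big1 ?addr0// => c _.
  by rewrite /y' ltnNge leq_addr rmorph0 mulr0.
exists (lmul D (wS A2 (coset_rep j)) (lmul D (wT A2 ord_max (B b)) y')).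
have basE j' : bas (j', a, b) = wS A3 (coset_rep j') * (wT A3 q (B b) * aX A3 q ^+ a) by [].
rewrite basE coset_rep_up wSM -i2_S -!i2_lsum -yE.
have -> : i2 (bas (j, a, b)) =
    i2 (wS A2 (coset_rep j)) * (i2 (wT A2 ord_max (B b)) * i2 (aX A2 ord_max) ^+ a).
  by rewrite -rmorphXn -rmorphM -rmorphM.
rewrite i2_X -!mulrA ye !mulrDr; congr (_ + _).
congr (_ * _).
by rewrite i2_T mulrA [RHS]mulrA wST tpermR.
Qed.

Variable M : supermod Q2.
Local Notation Ind_Res := (ind_mod i1 (res_mod i1 M)).
Local Notation Res_Ind := (res_mod i2 (ind_mod i2 M)).
Local Notation pure1 := (@pure Q1 Q2 i1 (res_mod i1 M)).
Local Notation pure2 := (@pure Q2 Q3 i2 M).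

(** The map u (x) m |-> u s (x) m, which is balanced because the last
    transposition commutes with everything supported on the first positions. *)
Definition mackey_pure (u : Q2) (m : res_mod i1 M) : tensor i2 M := pure2 (i2 u * s) m.

Lemma mackey_pureDl u u' m : mackey_pure (u + u') m = mackey_pure u m + mackey_pure u' m.
Proof. by rewrite /mackey_pure rmorphD mulrDl pureDl. Qed.
Lemma mackey_pureDr u m m' : mackey_pure u (m + m') = mackey_pure u m + mackey_pure u m'.
Proof. exact: pureDr. Qed.
Lemma mackey_pureA u a m : mackey_pure (u * i1 a) m = mackey_pure u (a *: m).
Proof.
rewrite /mackey_pure rmorphM -mulrA last_swap_comm mulrA.
exact: (@pureA Q2 Q3 i2 M _ (i1 a) m).
Qed.

Definition mackey_fun (y : Ind_Res) : Res_Ind := tlift mackey_pure y.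

Let mackey_fun_pure u m : mackey_fun (pure1 u m) = pure2 (i2 u * s) m.
Proof.
exact: (@tlift_pure Q1 Q2 i1 (res_mod i1 M) _ mackey_pure mackey_pureDl mackey_pureDr
  mackey_pureA).
Qed.

Let mackey_funD x y : mackey_fun (x + y) = mackey_fun x + mackey_fun y.
Proof.
exact: (@tliftD Q1 Q2 i1 (res_mod i1 M) _ mackey_pure mackey_pureDl mackey_pureDr
  mackey_pureA).
Qed.

Lemma mackey_fun_lin : linear mackey_fun.
Proof.
move=> c x y; rewrite mackey_funD; congr (_ + _).
elim/tensor_ind: x => [u m|x x' IHx IHx']; last first.
  by rewrite scalerDr !mackey_funD IHx IHx' scalerDr.
rewrite [c *: _]scale_pure !mackey_fun_pure rmorphM -mulrA.
exact/esym/(@scale_pure _ _ _ i2 M (i2 c)).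
Qed.

Lemma last_swap_hom : ghom (sa_gr Q3) 0 s.
Proof. exact: (cr_S_hom (level_rep C n.+2)). Qed.

Lemma mackey_fun_gproj g y :
  sm_gr Res_Ind g (mackey_fun y) = mackey_fun (sm_gr Ind_Res g y).
Proof.
have fun0 : mackey_fun 0 = 0 by rewrite -(pure0l i1 0) mackey_fun_pure pure0r.
elim/tensor_ind: y => [u m|x y IHx IHy]; last by rewrite mackey_funD !gprojD mackey_funD IHx IHy.
elim/(ghom_ind (G := sa_gr Q2)): u => [|u u' IH IH'|hu u uh].
- by rewrite pure0l gproj0 fun0 gproj0.
- by rewrite pureDl mackey_funD !gprojD mackey_funD IH IH'.
elim/(ghom_ind (G := sm_gr (res_mod i1 M))): m => [|m m' IH IH'|hm m mh].
- by rewrite pure0r gproj0 fun0 gproj0.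
- by rewrite pureDr mackey_funD !gprojD mackey_funD IH IH'.
rewrite mackey_fun_pure (ghomE _ (ind_pure_hom i1 uh mh)).
have ush := sa_mul_hom (sah_hom i2 uh) last_swap_hom; rewrite addr0 in ush.
rewrite (ghomE _ (ind_pure_hom i2 ush (mh : ghom (sm_gr M) hm m))); case: ifP => _.
  by rewrite mackey_fun_pure.
by rewrite fun0.
Qed.

Lemma mackey_fun_hom g y : ghom (sm_gr (shift_mod 0 Ind_Res)) g y ->
  ghom (sm_gr Res_Ind) g (mackey_fun y).
Proof.
rewrite /ghom /= /shift_pr (_ : g + (0, false) = g) => [yh|].
  by rewrite -[LHS]/(sm_gr Res_Ind g _) mackey_fun_gproj yh.
exact: addr0.
Qed.

Definition mackey_hom : smhom (shift_mod 0 Ind_Res) Res_Ind :=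
  @SMHom _ _ (shift_mod 0 Ind_Res) Res_Ind mackey_fun mackey_fun_lin mackey_fun_hom.

Lemma mackey_hom_pure u m : mackey_hom (pure1 u m) = pure2 (i2 u * s) m.
Proof. exact: mackey_fun_pure. Qed.

(** ** Bijectivity *)

Definition mackey_sum (m : K -> M) (y : Ind_Res) : tensor i2 M :=
  \sum_l pure2 (lst n.+1 l) (m l) + mackey_hom y.

Lemma sum_triple (J1 J2 J3 : finType) (V : zmodType) (f : J1 * J2 * J3 -> V) :
  \sum_l f l = \sum_j \sum_a \sum_b f (j, a, b).
Proof. by rewrite pair_bigA /= pair_bigA /=; apply: eq_bigr => -[[j a] b]. Qed.

Lemma sum_basis_split (V : zmodType) (f : J n.+1 -> V) :
  \sum_l f l = \sum_(l : J n) f (up l.1.1, l.1.2, l.2) +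
               \sum_(h : K) f (ord_max, h.1, h.2).
Proof.
rewrite -(pair_bigA _ (fun a b => f (ord_max, a, b))) !sum_triple big_ord_recr /=.
congr (_ + _); apply: eq_bigr => j _.
suff -> : widen_ord (leqnSn n.+1) j = up j by [].
by apply/val_inj; rewrite [RHS]up_val.
Qed.

(** By [basis_swap], with respect to the bases of both sides [mackey_sum] is a
    unitriangular block matrix. *)
Lemma mackey_sum_coords : exists r : J n -> K -> Q2,
  forall m (m' : J n -> M),
    mackey_sum m (\sum_l pure1 (bas l) (m' l)) =
    \sum_(l : J n) pure2 (bas (up l.1.1, l.1.2, l.2)) (m' l) +
    \sum_(h : K) pure2 (lst n.+1 h) (m h + \sum_l r l h *: m' l).
Proof.
have /choice[r rP] := basis_swap; exists r => m m'.
have hom_sum : mackey_hom (\sum_l pure1 (bas l) (m' l)) =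
    \sum_l mackey_hom (pure1 (bas l) (m' l)).
  by apply: (big_morph mackey_hom) => [x y|]; [exact: mackey_funD|exact: (smh0 mackey_hom)].
rewrite /mackey_sum hom_sum addrC; under eq_bigr => l _.
  rewrite mackey_hom_pure rP pureDl pure_suml.
  under eq_bigr do rewrite (@pureA Q2 Q3 i2 M).
  over.
rewrite big_split /= -addrA; congr (_ + _).
rewrite exchange_big -big_split; apply: eq_bigr => h _ /=.
by rewrite pureDr (@pure_sumr k Q2 Q3 i2 M) addrC.
Qed.

Let expand1 := @tensor_expand _ _ _ i1 _ _ (@basis_surj k D C n) (res_mod i1 M).
Let expand2 := @tensor_expand _ _ _ i2 _ _ (@basis_surj k D C n.+1) M.
Let expand_inj2 := @tensor_expand_inj _ _ _ i2 _ _ (@basis_surj k D C n.+1)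
  (@basis_inj k D C n.+1) M.

Lemma mackey_sum_inj m y : mackey_sum m y = 0 -> (forall l, m l = 0) /\ y = 0.
Proof.
have [r rP] := mackey_sum_coords; have [m' ->] := expand1 y.
rewrite rP => h.
pose f (l : J n.+1) : M :=
  if unlift ord_max l.1.1 is Some j then m' (j, l.1.2, l.2)
  else m (l.1.2, l.2) + \sum_i r i (l.1.2, l.2) *: m' i.
have f0 : forall l, f l = 0.
  apply: expand_inj2; rewrite sum_basis_split -[RHS]h; congr (_ + _); apply: eq_bigr => -[].
    by move=> [j a] b _; rewrite /f /= /up liftK.
  by move=> a b _; rewrite basis_last /f unlift_none.
have m'0 l : m' l = 0.
  by case: l => -[j a] b; have := f0 (up j, a, b); rewrite /f /= /up liftK.
split=> [[a b]|]; last by rewrite big1// => l _; rewrite m'0 pure0r.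
have := f0 (ord_max, a, b); rewrite /f unlift_none big1 ?addr0// => l _.
by rewrite m'0 scaler0.
Qed.

Lemma mackey_sum_surj x : exists m y, x = mackey_sum m y.
Proof.
have [r rP] := mackey_sum_coords; have [f ->] := expand2 x.
pose m' (l : J n) : M := f (up l.1.1, l.1.2, l.2).
exists (fun h => f (ord_max, h.1, h.2) - \sum_l r l h *: m' l).
exists (\sum_l pure1 (bas l) (m' l)).
rewrite rP sum_basis_split; congr (_ + _); apply: eq_bigr => -[a b] _.
by rewrite basis_last subrK.
Qed.

End Mackey.

(** * Homomorphisms out of finite direct sums *)

Section Cotuples.
Variables (k : comNzRingType) (A : superalg k).

Section Zero.
Variables M N : supermod A.

Lemma zero_fun_lin : linear (fun _ : M => 0 : N).
Proof. by move=> c x y; rewrite scaler0 addr0. Qed.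

Definition zero_hom : smhom M N :=
  SMHom zero_fun_lin (fun g _ _ => ghom0 (sm_gr N) g).

End Zero.

Section Pair.
Variables (M1 M2 N : supermod A) (f : smhom M1 N) (g : smhom M2 N).

Definition cotuple_fun (x : add_mod M1 M2) : N := f x.1 + g x.2.

Lemma cotuple_lin : linear cotuple_fun.
Proof.
by move=> c x y; rewrite /cotuple_fun /= !smhD !smhZ scalerDr addrACA.
Qed.

Lemma cotuple_hom h x :
  ghom (sm_gr (add_mod M1 M2)) h x -> ghom (sm_gr N) h (cotuple_fun x).
Proof.
by case: x => x y [xh yh]; apply: ghomD; apply: smh_hom; [exact: xh | exact: yh].
Qed.

Definition cotuple : smhom (add_mod M1 M2) N := SMHom cotuple_lin cotuple_hom.

End Pair.

Variable B : superalg k.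

Fixpoint big_cotuple (F : nat -> smfunctor B A) (M : supermod B) (N : supermod A)
    (g : forall i, smhom (F i M) N) (m : nat) : smhom (big_dsum_functor m F M) N :=
  match m return smhom (big_dsum_functor m F M) N with
  | 0 => zero_hom _ _
  | m'.+1 => cotuple (big_cotuple g m') (g m')
  end.

Lemma big_cotuple_nat (F : nat -> smfunctor B A) (M M' : supermod B) (N N' : supermod A)
    (g : forall i, smhom (F i M) N) (g' : forall i, smhom (F i M') N')
    (f : smhom M M') (h : smhom N N') :
  (forall i x, h (g i x) = g' i (fmap (F i) f x)) ->
  forall m x, h (big_cotuple g m x) = big_cotuple g' m (fmap (big_dsum_functor m F) f x).
Proof.
move=> hg; elim=> [|m IHm] x; first exact: smh0.
by rewrite /= /cotuple_fun smhD hg IHm.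
Qed.

Lemma smhom_inverse (M N : supermod A) (f : smhom M N) :
  (forall x, f x = 0 -> x = 0) -> (forall y, exists x, y = f x) ->
  exists g : smhom N M, cancel f g /\ cancel g f.
Proof.
move=> f_ker /choice[g gP].
have f_inj : injective f.
  by move=> x y xy; apply/subr0_eq/f_ker; rewrite smhB xy subrr.
have gK : cancel g f by move=> y; rewrite -gP.
have g_lin : linear g.
  by move=> c x y; apply: f_inj; rewrite gK smhD smhZ !gK.
have g_hom h y : ghom (sm_gr N) h y -> ghom (sm_gr M) h (g y).
  by move=> yh; apply: f_inj; rewrite smh_gproj !gK.
by exists (SMHom g_lin g_hom); split=> // x; apply: f_inj; exact: gK.
Qed.

(** ** Sums of shifts of one functor *)

Section Shifts.
Variables (sh : nat -> int) (E : smfunctor B A) (M : supermod B) (N : supermod A).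
Local Notation F := (fun i => comp_functor (shift_functor A (sh i)) E).

(** The summands being shifts of [E M], they share its carrier; so a family of
    components is a plain sequence. *)
Fixpoint dmake (m : nat) (v : nat -> E M) : big_dsum_functor m F M :=
  match m return big_dsum_functor m F M with
  | 0 => 0
  | m'.+1 => (dmake m' v, v m')
  end.

Lemma eq_dmake m v v' : (forall i, (i < m)%N -> v i = v' i) -> dmake m v = dmake m v'.
Proof.
elim: m => //= m IHm vv'; rewrite vv'// (IHm)// => i im.
by apply: vv'; exact: ltnW.
Qed.

Lemma dmake_surj m x : exists v, x = dmake m v.
Proof.
elim: m x => [|m IHm] x /=; first by exists (fun _ => 0); rewrite [x]thinmx0 [RHS]thinmx0.
case: x => x y; have [v ->] := IHm x.
exists (fun i => if i == m then y else v i); rewrite eqxx; congr (_, _).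
by apply: eq_dmake => i im; rewrite ltn_eqF.
Qed.

Lemma dmake0 m : dmake m (fun _ => 0) = 0.
Proof. by elim: m => //= m ->. Qed.

Lemma big_cotuple_make (g : forall i, smhom (F i M) N) m v :
  big_cotuple g m (dmake m v) = \sum_(i < m) g i (v i).
Proof.
elim: m => [|m IHm]; first by rewrite big_ord0.
by rewrite big_ord_recr -IHm.
Qed.

End Shifts.
End Cotuples.

(** * Summands that commute with the scalars up to sign *)

Section ParityShifts.
Variables (k : comNzRingType) (A B : superalg k) (phi : superalg_hom A B).

Definition parity_functor (p : bool) : smfunctor A A :=
  if p then pi_functor A else id_functor A.

(** An element of the larger algebra that commutes with the smaller one, up to
    the sign given by its parity [p], spans a copy of the identity functor or of
    the parity shift in induction. *)
Definition passes (p : bool) (e : int) (u : B) : Prop :=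
  ghom (sa_gr B) (e, p) u /\
  forall c, phi c * u = u * phi (if p then psgn (sa_gr A) c else c).

Section Pure.
Variables (p : bool) (e : int) (u : B) (M : supermod A).
Hypothesis uP : passes p e u.

Definition pure_fun : parity_functor p M -> res_mod phi (ind_mod phi M) :=
  match p return parity_functor p M -> res_mod phi (ind_mod phi M) with
  | true => fun m => pure phi u (m : M)
  | false => fun m => pure phi u m
  end.

Lemma pure_fun_lin : linear pure_fun.
Proof.
have [_] := uP; rewrite /pure_fun; case: p => uc c x y; rewrite pureDr; congr (_ + _).
  by rewrite -(@pureA A B phi M) -uc; exact/esym/scale_pure.
by rewrite -pureA -uc; exact/esym/scale_pure.
Qed.

Lemma pure_fun_hom g m : ghom (sm_gr (shift_mod (- e) (parity_functor p M))) g m ->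
  ghom (sm_gr (res_mod phi (ind_mod phi M))) g (pure_fun m).
Proof.
have [] := uP; case: g => i q; rewrite /pure_fun; case: p m => m uh _ mh.
  have := ind_pure_hom phi uh (mh : ghom (sm_gr M) (i - e, ~~ (q + false)) m).
  suff -> : (e, true) + (i - e, ~~ (q + false)) = (i, q) :> Gam by [].
  by congr pair; [exact: subrKC | case: (q)].
have := ind_pure_hom phi uh (mh : ghom (sm_gr M) (i - e, q + false) m).
suff -> : (e, false) + (i - e, q + false) = (i, q) :> Gam by [].
by congr pair; [exact: subrKC | case: (q)].
Qed.

Definition pure_hom : smhom (shift_mod (- e) (parity_functor p M))
    (res_mod phi (ind_mod phi M)) :=
  @SMHom _ _ (shift_mod (- e) (parity_functor p M)) _ pure_fun pure_fun_lin pure_fun_hom.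

End Pure.

Lemma pure_hom_nat p e u (uP : passes p e u) (M N : supermod A) (f : smhom M N) m :
  fmap (res_functor phi) (fmap (ind_functor phi) f) (pure_hom M uP m) =
  pure_hom N uP (fmap (comp_functor (shift_functor A (- e)) (parity_functor p)) f m).
Proof. by case: p uP m => uP m; exact: ind_map_pure. Qed.

End ParityShifts.

(** * The isomorphism of functors *)

Section MackeyIso.
Variables (k : comNzRingType) (D : wreath_data k) (C : cyclo_data D) (n : nat).
Local Notation I := (wd_I D).
Local Notation dg := (wd_deg D).
Local Notation d := (level C).
Local Notation Q2 := (cyc_alg C n.+1).
Local Notation Q3 := (cyc_alg C n.+2).
Local Notation i2 := (cyc_incl C n.+1).
Local Notation K := ('I_d * I)%type.
Local Notation lst := (@last_elt k D C n.+1).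

Lemma last_elt_hom (l : K) :
  ghom (sa_gr Q3) ((dg l.2).1 + wd_delta D *+ l.1, (dg l.2).2) (lst l).
Proof.
have xh m : ghom (sa_gr Q3) (wd_delta D *+ m, false) (last_x C n.+1 ^+ m).
  elim: m => [|m IHm]; first by rewrite expr0; exact: sa1_hom.
  by rewrite exprS mulrS; exact: sa_mul_hom (cr_X_hom (level_rep C n.+2) ord_max) IHm.
have Th := cr_T_hom (level_rep C n.+2) ord_max (wd_B_hom (w := D) l.2).
have := sa_mul_hom Th (xh l.1); congr (ghom _ _ _).
by case: (dg l.2) => a p; congr pair; case: p.
Qed.

Lemma last_elt_pass c (l : K) : i2 c * lst l = lst l * i2 (sgn_pass l.2 c).
Proof.
exact: (iota_pass (A := level_rep C n.+1) (@cyc_incl_X k D C n.+1)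
  (@cyc_incl_T k D C n.+1) (@cyc_incl_S k D C n.+1)).
Qed.

(** ** Numbering the elements of a given parity *)

Definition parity_list (p : bool) : seq K := enum [pred l : K | (dg l.2).2 == p].

Lemma size_parity_list p : size (parity_list p) = (d * #|[set i | (dg i).2 == p]|)%N.
Proof.
transitivity #|setX [set: 'I_d] [set i | (dg i).2 == p]|.
  by rewrite -cardE; apply: eq_card => l; rewrite !inE.
by rewrite cardsX cardsT card_ord.
Qed.

Lemma size_even : size (parity_list false) = (d * dim_even D)%N.
Proof.
rewrite size_parity_list; congr (_ * _)%N; apply: eq_card => i.
by rewrite !inE; case: (dg i).2.
Qed.

Lemma size_odd : size (parity_list true) = (d * dim_odd D)%N.
Proof.
rewrite size_parity_list; congr (_ * _)%N; apply: eq_card => i.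
by rewrite !inE; case: (dg i).2.
Qed.

Lemma sum_onth (T : eqType) (V : zmodType) (s : seq T) (h : option T -> nat -> V) :
  uniq s -> \sum_(i < size s) h (onth s i) i = \sum_(l <- s) h (Some l) (index l s).
Proof.
case: s => [|x0 s]; first by rewrite big_nil big_ord0.
set s' := x0 :: s => us; rewrite (big_nth x0) big_mkord; apply: eq_bigr => i _.
rewrite index_uniq// -(odflt_onth x0 s' i).
by have := onthTE s' i; rewrite ltn_ord; case: (onth s' i).
Qed.

(** The summands of either parity are numbered by an enumeration of the elements
    [b x^a] of that parity; numbers beyond it carry 0. *)
Definition slot_elt p i : Q3 := if onth (parity_list p) i is Some l then lst l else 0.
Definition slot_deg p i : int :=
  if onth (parity_list p) i is Some l then (dg l.2).1 + wd_delta D *+ l.1 else 0.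

Lemma slot_passes p i : passes i2 p (slot_deg p i) (slot_elt p i).
Proof.
rewrite /slot_elt /slot_deg; case il: (onth _ i) => [l|]; last first.
  by split=> [|c]; [exact: ghom0 | rewrite mulr0 mul0r].
have : l \in parity_list p by apply/onthP; exists i.
rewrite mem_enum inE => /eqP lp; split; first by rewrite -lp; exact: last_elt_hom.
by move=> c; rewrite last_elt_pass /sgn_pass lp.
Qed.

Definition slot_functor p i : smfunctor Q2 Q2 :=
  comp_functor (shift_functor Q2 (- slot_deg p i)) (parity_functor Q2 p).

Definition decomposition : smfunctor Q2 Q2 :=
  dsum_functor
    (dsum_functor (big_dsum_functor (d * dim_even D) (slot_functor false))
                  (big_dsum_functor (d * dim_odd D) (slot_functor true)))
    (comp_functor (shift_functor Q2 0) (comp_functor (cyc_ind C n) (cyc_res C n))).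

Section Module.
Variable M : supermod Q2.

Lemma sum_slots p (v : nat -> M) :
  \sum_(i < size (parity_list p)) pure i2 (slot_elt p i) (v i) =
  \sum_(l : K | (dg l.2).2 == p) pure i2 (lst l) (v (index l (parity_list p))).
Proof.
pose h (o : option K) i := pure i2 (if o is Some l then lst l else 0) (v i).
rewrite (sum_onth h) ?enum_uniq//.
by rewrite big_enum.
Qed.

Definition slot_hom p i : smhom (slot_functor p i M) (res_mod i2 (ind_mod i2 M)) :=
  pure_hom M (slot_passes p i).

(** On the summands numbered by [b x^a] it is m |-> b x^a (x) m, and on the last one
    it is u (x) m |-> u s (x) m. *)
Definition total_map :
    smhom (decomposition M) (comp_functor (cyc_res C n.+1) (cyc_ind C n.+1) M) :=
  cotuple
    (cotuple (big_cotuple (F := slot_functor false) (slot_hom false) (d * dim_even D))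
             (big_cotuple (F := slot_functor true) (slot_hom true) (d * dim_odd D)))
    (mackey_hom M).

(** The components of the two numbered sums as one family over all [b x^a]. *)
Definition merge (ve vo : nat -> M) (l : K) : M :=
  if (dg l.2).2 then vo (index l (parity_list true)) else ve (index l (parity_list false)).

Definition slots p m (v : nat -> parity_functor Q2 p M) :
    big_dsum_functor m (slot_functor p) M :=
  dmake (fun i => - slot_deg p i) m v.

Lemma slots_even (v : nat -> parity_functor Q2 false M) :
  big_cotuple (slot_hom false) (d * dim_even D) (slots _ v) =
  \sum_(l : K | (dg l.2).2 == false) pure i2 (lst l) (v (index l (parity_list false)) : M).
Proof. by rewrite /slots big_cotuple_make -size_even; exact: sum_slots. Qed.

Lemma slots_odd (v : nat -> parity_functor Q2 true M) :
  big_cotuple (slot_hom true) (d * dim_odd D) (slots _ v) =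
  \sum_(l : K | (dg l.2).2 == true) pure i2 (lst l) (v (index l (parity_list true)) : M).
Proof. by rewrite /slots big_cotuple_make -size_odd; exact: sum_slots. Qed.

Lemma total_mapE (ve : nat -> parity_functor Q2 false M)
    (vo : nat -> parity_functor Q2 true M) y :
  total_map (slots _ ve, slots _ vo, y) = mackey_sum (merge ve vo) y.
Proof.
rewrite -[LHS]/(big_cotuple (slot_hom false) _ (slots _ ve) +
  big_cotuple (slot_hom true) _ (slots _ vo) + mackey_hom M y).
rewrite slots_even slots_odd /mackey_sum; congr (_ + _).
rewrite [RHS](bigID (fun l : K => (dg l.2).2 == false)); congr (_ + _).
  by apply: eq_bigr => l /eqP lp; rewrite /merge lp.
apply: eq_big => [l|l /eqP lp]; first by case: (dg l.2).2.
by rewrite /merge lp.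
Qed.

Lemma decomposition_slots (x : decomposition M) : exists ve vo y,
  x = (slots _ ve, slots _ vo, y) :> decomposition M.
Proof.
case: x => -[x x'] y; have [ve ->] := dmake_surj x; have [vo ->] := dmake_surj x'.
by exists ve, vo, y.
Qed.

Lemma slots0 p m v : (forall i, (i < m)%N -> v i = 0) -> slots (p := p) m v = 0.
Proof. by move/eq_dmake => h; rewrite /slots h; exact: dmake0. Qed.

Lemma parity_list_nth p i : (i < size (parity_list p))%N ->
  exists2 l, (dg l.2).2 = p & index l (parity_list p) = i.
Proof.
move=> ip; have : onth (parity_list p) i by rewrite onthTE.
case il: (onth _ i) => [l|//] _; exists l; last first.
  by rewrite -(@onth_nth _ l _ _ _ il) index_uniq// enum_uniq.
have : l \in parity_list p by apply/onthP; exists i.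
by rewrite mem_enum inE => /eqP.
Qed.

Lemma total_map_ker x : total_map x = 0 -> x = 0.
Proof.
have [ve [vo [y ->]]] := decomposition_slots x.
rewrite total_mapE => /mackey_sum_inj[m0 ->].
rewrite !slots0// => i; rewrite -?size_even -?size_odd => /parity_list_nth[l lp li].
  by have := m0 l; rewrite /merge lp li.
by have := m0 l; rewrite /merge lp li.
Qed.

Lemma total_map_surj z : exists x, z = total_map x.
Proof.
have [m [y ->]] := mackey_sum_surj z.
pose v p i : M := if onth (parity_list p) i is Some l then m l else 0.
have vE l : v (dg l.2).2 (index l (parity_list (dg l.2).2)) = m l.
  have lin : l \in parity_list (dg l.2).2 by rewrite mem_enum inE.
  have /onthP[i il] := lin; rewrite (_ : index l _ = i) ?/v ?il//.
  by rewrite -[X in index X](@onth_nth _ l _ _ _ il) index_uniq ?enum_uniq// -onthTE il.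
exists (slots _ (v false : nat -> parity_functor Q2 false M),
        slots _ (v true : nat -> parity_functor Q2 true M), y).
rewrite total_mapE /mackey_sum; congr (_ + _); apply: eq_bigr => l _.
by rewrite -(vE l) /merge; case: (dg l.2).2.
Qed.

End Module.

Lemma mackey_hom_nat (M N : supermod Q2) (f : smhom M N) y :
  fmap (comp_functor (cyc_res C n.+1) (cyc_ind C n.+1)) f (mackey_hom M y) =
  mackey_hom N (fmap (comp_functor (cyc_ind C n) (cyc_res C n)) f y).
Proof.
elim/tensor_ind: y => [u m|x y IHx IHy]; last first.
  set g := fmap _ f in IHx IHy *; set g' := fmap _ f in IHx IHy *.
  have addE (L : supermod Q2) u v :
      mackey_hom L (u + v) = mackey_hom L u + mackey_hom L v :=
    smhD (mackey_hom L) u v.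
  have gE u v : g' (u + v) = g' u + g' v := smhD g' u v.
  by rewrite addE (smhD g) IHx IHy gE addE.
rewrite mackey_hom_pure.
have -> : fmap (comp_functor (cyc_ind C n) (cyc_res C n)) f (pure (cyc_incl C n) u m) =
    pure (cyc_incl C n) u (f m : res_mod (cyc_incl C n) N).
  exact: (ind_map_pure (cyc_incl C n) (res_hom (cyc_incl C n) f)).
rewrite mackey_hom_pure; exact: (ind_map_pure i2 f).
Qed.

Lemma total_map_nat (M N : supermod Q2) (f : smhom M N) x :
  fmap (comp_functor (cyc_res C n.+1) (cyc_ind C n.+1)) f (total_map M x) =
  total_map N (fmap decomposition f x).
Proof.
case: x => -[x x'] y; set h := fmap _ f.
rewrite -[total_map M _]/(big_cotuple (slot_hom M false) _ x +
  big_cotuple (slot_hom M true) _ x' + mackey_hom M y).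
rewrite 2!(smhD h) /h mackey_hom_nat.
rewrite (big_cotuple_nat (g' := slot_hom N false) (f := f)) => [|i m]; last first.
  exact: pure_hom_nat.
rewrite (big_cotuple_nat (g' := slot_hom N true) (f := f)) => [//|i m].
exact: pure_hom_nat.
Qed.

(** The isomorphism is the inverse of [total_map], whose naturality it inherits. *)
Lemma mackey_iso :
  nat_iso (comp_functor (cyc_res C n.+1) (cyc_ind C n.+1)) decomposition.
Proof.
have inv M : exists eta : smhom _ (decomposition M),
    cancel (total_map M) eta /\ cancel eta (total_map M).
  by apply: smhom_inverse; [exact: total_map_ker | exact: total_map_surj].
pose eta M := sval (cid (inv M)).
have etaP M : cancel (total_map M) (eta M) /\ cancel (eta M) (total_map M).
  by rewrite /eta; case: (cid _).
exists (fun M _ => eta M); split=> [M _|M N _ _ f].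
  by have [h1 h2] := etaP M; exists (total_map M).
apply: smhom_eq => x; have [_ KM] := etaP M; have [KN _] := etaP N.
rewrite -[LHS]/(eta N (fmap (comp_functor (cyc_res C n.+1) (cyc_ind C n.+1)) f x)).
by rewrite -{1}(KM x) total_map_nat KN.
Qed.

End MackeyIso.
Theorem theorem6p18 (k : comNzRingType) (p : nat) (hp : has_char k p)
    (hp2 : p <> 2%N) (D : wreath_data k) (hpt : ~~ (p %| wd_theta D)%N)
    (C : cyclo_data D) (hd : (1 <= level C)%N) (n : nat) :
  let A := cyc_alg C n.+1 in
  exists (a b : nat -> int) (c : int),
    nat_iso
      (comp_functor (cyc_res C n.+1) (cyc_ind C n.+1))
      (dsum_functor
        (dsum_functor
          (big_dsum_functor (level C * dim_even D)
             (fun i => comp_functor (shift_functor A (a i)) (id_functor A)))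
          (big_dsum_functor (level C * dim_odd D)
             (fun i => comp_functor (shift_functor A (b i)) (pi_functor A))))
        (comp_functor (shift_functor A c)
           (comp_functor (cyc_ind C n) (cyc_res C n)))).
Proof.
move=> A; exists (fun i => - slot_deg C false i), (fun i => - slot_deg C true i), 0.
exact: mackey_iso.
Qed.
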